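(* Let $R$ be a commutative ring with identity, let $M$ be a finitely generated $R$-module, and let $\mathbf{x}$ be a finite sequence of elements of $R$. (1) If $\mathbf{x}$ is a parameter sequence on $M$, then $\operatorname{ht}_M(\mathbf{x}R)\geq\ell(\mathbf{x})$. (2) Further assume that $R$ is Noetherian. Then $\mathbf{x}$ is a parameter sequence on $M$ if and only if $\operatorname{ht}_M(\mathbf{x}R)=\ell(\mathbf{x})$.
   Context: $\ell(\mathbf{x})$ denotes the length of $\mathbf{x}=x_1,\ldots,x_\ell$; $\mathbf{x}^m=x_1^m,\ldots,x_\ell^m$. Height: for a prime $\mathfrak{p}$, $\operatorname{ht}_M\mathfrak{p}$ is the Krull dimension of the $R_{\mathfrak{p}}$-module $M_{\mathfrak{p}}$; for an ideal $I$, $\operatorname{ht}_M I=\inf\{\operatorname{ht}_M\mathfrak{p}\mid\mathfrak{p}\in\operatorname{Supp}M\cap V(I)\}$ (with $\inf\emptyset=\infty$). Weakly proregular sequences: let $\mathbb{K}_\bullet(x,M)$ be the Koszul complex $0\to M\xrightarrow{x}M\to 0$ (degrees $1,0$), and $\mathbb{K}_\bullet(\mathbf{x},M)=\mathbb{K}_\bullet(x_1,R)\otimes_R\cdots\otimes_R\mathbb{K}_\bullet(x_\ell,R)\otimes_R M$ with homology $H_i(\mathbf{x},M)$. For $m\ge n$ let $\phi^m_n(\mathbf{x},M):\mathbb{K}_\bullet(\mathbf{x}^m,M)\to\mathbb{K}_\bullet(\mathbf{x}^n,M)$ be the chain map obtained by tensoring the maps $\mathbb{K}_\bullet(x_j^m,R)\to\mathbb{K}_\bullet(x_j^n,R)$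 that are multiplication by $x_j^{m-n}$ in degree $1$ and the identity in degree $0$. The sequence $\mathbf{x}$ is $M$-weakly proregular if for each $n$ there is $m\ge n$ such that the induced map $H_i(\mathbf{x}^m,M)\to H_i(\mathbf{x}^n,M)$ is zero for all $i\ge1$. Čech cohomology: $C(x)$ is the complex $0\to R\to R_x\to0$ (degrees $0,1$), $C(\mathbf{x})=C(x_1)\otimes_R\cdots\otimes_R C(x_\ell)$, and $H^i_{\mathbf{x}}(M)$ is the $i$th cohomology of $C(\mathbf{x})\otimes_R M$. Parameter sequences: $\mathbf{x}$ is a parameter sequence on $M$ if (i) $\mathbf{x}$ is $M$-weakly proregular, (ii) $\mathbf{x}M\ne M$, (iii) $H^{\ell(\mathbf{x})}_{\mathbf{x}}(M)_{\mathfrak{p}}\neq0$ for all primes $\mathfrak{p}\in\operatorname{Supp}_R(M/\mathbf{x}M)$. *)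

(* Defs.v *)
From HB Require Import structures.
From mathcomp Require Import all_boot all_order all_algebra ring.
From mathcomp Require Import boolp classical_sets constructive_ereal.

Set Implicit Arguments.
Unset Strict Implicit.
Unset Printing Implicit Defensive.

Import Order.TTheory GRing.Theory Num.Theory.
Local Open Scope quotient_scope.
Local Open Scope classical_set_scope.
Local Open Scope ring_scope.

Section Span.
Variables (R : pzRingType) (N : lmodType R) (T : set N).

Definition span : {pred N} := fun v =>
  `[< smallest (fun A : set N => submod_closed (fun w => `[< A w >])) T v >].

Fact span_closed : submod_closed span.
Proof.
split=> [|a u v uS vS]; apply/asboolP => A [[A0 AL] TA]; first exact/asboolP.
apply/asboolP/AL; apply/asboolP.
- by move/asboolP: uS; apply; split.
- by move/asboolP: vS; apply; split.
Qed.

HB.instance Definition _ := GRing.isSubmodClosed.Build R N span span_closed.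
End Span.

Definition fin_gen (R : pzRingType) (M : lmodType R) :=
  exists s : seq M, forall v, v \in span [set` s].

Notation ideal R := (submodClosed (R : pzRingType)^o).

Definition noetherian (R : comPzRingType) :=
  forall I : ideal R, exists s : seq R^o, forall a : R^o, (a \in I) = (a \in span [set` s]).

Definition seq_ideal (R : comPzRingType) (x : seq R) : ideal R :=
  span [set` (x : seq R^o)].

Definition seq_mul (R : comPzRingType) (x : seq R) (M : lmodType R) :
    submodClosed M :=
  span [set v | exists2 a, a \in x & exists m : M, v = a *: m].

(* The library's [prime_idealr] requires [1 != 0] in the ambient ring. *)
Record prime_ideal (R : comPzRingType) := PrimeIdeal {
  prime_ideal_val :> ideal R;
  prime_ideal_proper : (1 : R^o) \notin prime_ideal_val;
  prime_ideal_prime : forall a b : R, (a * b : R^o) \in prime_ideal_val ->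
    (a : R^o) \in prime_ideal_val \/ (b : R^o) \in prime_ideal_val }.

Section SubmodType.
Variables (R : pzRingType) (N : lmodType R) (U : submodClosed N).

Definition submod_type := {v : N | v \in U}.
HB.instance Definition _ := [isSub of submod_type for @sval N (fun v => v \in U)].
HB.instance Definition _ := [Choice of submod_type by <:].
HB.instance Definition _ := [SubChoice_isSubLmodule of submod_type by <:].
End SubmodType.

Section QuotMod.
Variables (R : pzRingType) (N : lmodType R) (U : submodClosed N).

Definition quotmod_rel (u v : N) := u - v \in U.

Fact quotmod_rel_equiv : equiv_class_of quotmod_rel.
Proof.
split=> [u|u v|v u w]; rewrite /quotmod_rel ?subrr ?rpred0 //.
  by apply/idP/idP => h; rewrite -opprB -scaleN1r rpredZ.
by move=> uv vw; rewrite -[u](subrK v) -addrA rpredD.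
Qed.

Canonical quotmod_equiv := EquivRelPack quotmod_rel_equiv.

Definition quotmod := {eq_quot quotmod_rel}.
HB.instance Definition _ := Choice.on quotmod.

Definition quot_class (u : N) : quotmod := \pi_quotmod u.

Lemma quot_classE u v : quot_class u = quot_class v <-> u - v \in U.
Proof. by rewrite /quot_class; split=> [/eqmodP//|uv]; apply/eqmodP. Qed.

Lemma quot_classW (P : quotmod -> Prop) :
  (forall u, P (quot_class u)) -> forall q, P q.
Proof. by move=> H q; elim/quotW: q. Qed.

Lemma quot_repr u : repr (quot_class u) - u \in U.
Proof. by apply/quot_classE; rewrite /quot_class reprK. Qed.

Definition quot_zero := quot_class 0.
Definition quot_add (p q : quotmod) := quot_class (repr p + repr q).
Definition quot_opp (p : quotmod) := quot_class (- repr p).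
Definition quot_scale a (p : quotmod) := quot_class (a *: repr p).

Lemma quot_addE u v : quot_add (quot_class u) (quot_class v) = quot_class (u + v).
Proof. by apply/quot_classE; rewrite opprD addrACA rpredD ?quot_repr. Qed.
Lemma quot_oppE u : quot_opp (quot_class u) = quot_class (- u).
Proof.
by apply/quot_classE; rewrite -opprD -[X in X \in _]scaleN1r rpredZ ?quot_repr.
Qed.
Lemma quot_scaleE a u : quot_scale a (quot_class u) = quot_class (a *: u).
Proof. by apply/quot_classE; rewrite -scalerBr rpredZ ?quot_repr. Qed.

Fact quot_addA : associative quot_add.
Proof.
by elim/quot_classW=> u; elim/quot_classW=> v; elim/quot_classW=> w;
  rewrite !quot_addE addrA.
Qed.
Fact quot_addC : commutative quot_add.
Proof. by elim/quot_classW=> u; elim/quot_classW=> v; rewrite !quot_addE addrC. Qed.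
Fact quot_add0 : left_id quot_zero quot_add.
Proof. by elim/quot_classW=> u; rewrite quot_addE add0r. Qed.
Fact quot_addN : left_inverse quot_zero quot_opp quot_add.
Proof. by elim/quot_classW=> u; rewrite quot_oppE quot_addE addNr. Qed.

HB.instance Definition _ :=
  GRing.isZmodule.Build quotmod quot_addA quot_addC quot_add0 quot_addN.

Fact quot_scaleA a b p : quot_scale a (quot_scale b p) = quot_scale (a * b) p.
Proof. by elim/quot_classW: p => u; rewrite !quot_scaleE scalerA. Qed.
Fact quot_scale1 : left_id 1 quot_scale.
Proof. by elim/quot_classW=> u; rewrite quot_scaleE scale1r. Qed.
Fact quot_scaleDr : right_distributive quot_scale +%R.
Proof.
move=> a; elim/quot_classW=> u; elim/quot_classW=> v.
have DE (p q : quotmod) : p + q = quot_add p q by [].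
by rewrite !(quot_scaleE, DE, quot_addE) scalerDr.
Qed.
Fact quot_scaleDl p : {morph quot_scale^~ p : a b / a + b}.
Proof.
elim/quot_classW: p => u a b.
have DE (q r : quotmod) : q + r = quot_add q r by [].
by rewrite /= !quot_scaleE DE quot_addE scalerDl.
Qed.

HB.instance Definition _ := GRing.Zmodule_isLmodule.Build R quotmod
  quot_scaleA quot_scale1 quot_scaleDr quot_scaleDl.

Fact quot_class_linear : linear quot_class.
Proof.
move=> a u v; apply/esym; transitivity (quot_add (quot_scale a (quot_class u)) (quot_class v)) => //.
by rewrite quot_scaleE quot_addE.
Qed.
HB.instance Definition _ :=
  GRing.isLinear.Build R N quotmod *:%R quot_class quot_class_linear.
End QuotMod.

Section Localization.
Variables (R : comPzRingType) (S : mulrClosed R).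

Definition denom := {s : R | s \in S}.

Definition denom1 : denom := exist _ 1 (rpred1 S).
Definition denom_mul (s t : denom) : denom :=
  exist _ (sval s * sval t) (rpredM (svalP s) (svalP t)).

Section LocMod.
Variable N : lmodType R.

Definition loc_rel (u v : N * denom) : bool :=
  `[< exists2 t, t \in S & t *: (sval v.2 *: u.1) = t *: (sval u.2 *: v.1) >].

Fact loc_rel_equiv : equiv_class_of loc_rel.
Proof.
split=> [u|u v|[v r] [u s] [w t]].
- by apply/asboolP; exists 1; rewrite ?rpred1.
- by apply/idP/idP => /asboolP[t tS e]; apply/asboolP; exists t.
- case/asboolP => a aS /= e1 /asboolP[b bS /= e2]; apply/asboolP.
  exists (a * b * sval r); first by rewrite !rpredM ?(svalP r).
  transitivity ((b * sval t) *: (a *: (sval r *: u))).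
    by rewrite !scalerA; congr (_ *: _); ring.
  rewrite e1; transitivity ((a * sval s) *: (b *: (sval t *: v))).
    by rewrite !scalerA; congr (_ *: _); ring.
  by rewrite e2 !scalerA; congr (_ *: _); ring.
Qed.

Canonical loc_equiv := EquivRelPack loc_rel_equiv.

Definition loc := {eq_quot loc_rel}.
HB.instance Definition _ := Choice.on loc.

Definition frac (u : N) (s : denom) : loc := \pi_loc (u, s).

Lemma fracP u s v t : frac u s = frac v t <->
  exists2 r, r \in S & r *: (sval t *: u) = r *: (sval s *: v).
Proof.
split=> [/eqmodP/asboolP//|e]; by apply/eqmodP/asboolP.
Qed.

Lemma frac_eq u s v t : sval t *: u = sval s *: v -> frac u s = frac v t.
Proof. by move=> e; apply/fracP; exists 1; rewrite ?rpred1 ?e. Qed.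

Lemma fracW (P : loc -> Prop) : (forall u s, P (frac u s)) -> forall q, P q.
Proof. by move=> H q; elim/quotW: q => -[u s]; apply: H. Qed.

Lemma frac_repr (q : loc) : frac (repr q).1 (repr q).2 = q.
Proof. by rewrite /frac -surjective_pairing reprK. Qed.

Definition loc_zero := frac 0 denom1.
Definition loc_add (p q : loc) :=
  frac (sval (repr q).2 *: (repr p).1 + sval (repr p).2 *: (repr q).1)
       (denom_mul (repr p).2 (repr q).2).
Definition loc_opp (p : loc) := frac (- (repr p).1) (repr p).2.

Lemma loc_addE u s v t :
  loc_add (frac u s) (frac v t) = frac (sval t *: u + sval s *: v) (denom_mul s t).
Proof.
rewrite /loc_add.
have /fracP[a aS ea] := frac_repr (frac u s).
have /fracP[b bS eb] := frac_repr (frac v t).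
move: (repr (frac u s)) (repr (frac v t)) ea eb => [u' s'] [v' t'] /= ea eb.
apply/fracP; exists (a * b); first by rewrite rpredM.
rewrite /= !scalerDr; congr (_ + _).
  transitivity ((b * sval t * sval t') *: (a *: (sval s *: u'))).
    by rewrite !scalerA; congr (_ *: _); ring.
  by rewrite ea !scalerA; congr (_ *: _); ring.
transitivity ((a * sval s * sval s') *: (b *: (sval t *: v'))).
  by rewrite !scalerA; congr (_ *: _); ring.
by rewrite eb !scalerA; congr (_ *: _); ring.
Qed.

Lemma loc_oppE u s : loc_opp (frac u s) = frac (- u) s.
Proof.
have /fracP[a aS ea] := frac_repr (frac u s).
by apply/fracP; exists a; rewrite // !scalerN ea.
Qed.

Fact loc_addA : associative loc_add.
Proof.
elim/fracW=> u r; elim/fracW=> v s; elim/fracW=> w t.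
rewrite !loc_addE; apply: frac_eq.
by rewrite /= !scalerDr !addrA !scalerA; do 2?congr (_ + _);
  congr (_ *: _); ring.
Qed.
Fact loc_addC : commutative loc_add.
Proof.
elim/fracW=> u s; elim/fracW=> v t.
by rewrite !loc_addE; apply: frac_eq; rewrite addrC /= mulrC.
Qed.
Fact loc_add0 : left_id loc_zero loc_add.
Proof.
elim/fracW=> u s; rewrite loc_addE; apply: frac_eq.
by rewrite scaler0 add0r /= scale1r mul1r.
Qed.
Fact loc_addN : left_inverse loc_zero loc_opp loc_add.
Proof.
elim/fracW=> u s; rewrite loc_oppE loc_addE; apply: frac_eq.
by rewrite scalerN addNr !scaler0.
Qed.

HB.instance Definition _ :=
  GRing.isZmodule.Build loc loc_addA loc_addC loc_add0 loc_addN.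
End LocMod.

(* The localized ring has the fractions of the module [R^o] as elements. *)
Definition locring := loc R^o.
HB.instance Definition _ := GRing.Zmodule.copy locring (loc R^o).

Definition rfrac (a : R) (s : denom) : locring := frac (a : R^o) s.

Lemma rfracW (P : locring -> Prop) :
  (forall a s, P (rfrac a s)) -> forall c, P c.
Proof. by move=> H c; exact: (@fracW R^o P H c). Qed.

Lemma rfrac_eq a s b t : sval t * a = sval s * b -> rfrac a s = rfrac b t.
Proof. exact: (@frac_eq R^o a s b t). Qed.

Section LocScale.
Variable N : lmodType R.

Definition loc_scale (c : locring) (p : loc N) : loc N :=
  frac (((repr (c : loc R^o)).1 : R) *: (repr p).1)
       (denom_mul (repr (c : loc R^o)).2 (repr p).2).

Lemma loc_scaleE a s (u : N) t :
  loc_scale (rfrac a s) (frac u t) = frac (a *: u) (denom_mul s t).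
Proof.
rewrite /loc_scale.
have /fracP[c cS ec] := frac_repr (rfrac a s).
have /fracP[b bS eb] := frac_repr (frac u t).
move: (repr (rfrac a s : loc R^o)) (repr (frac u t)) ec eb.
move=> [a' s'] [u' t'] /= ec eb.
have {}ec : c * (sval s * a') = c * (sval s' * a) by exact: ec.
apply/fracP; exists (c * b); first by rewrite rpredM.
rewrite /=; transitivity ((c * (sval s * a')) *: (b *: (sval t *: u'))).
  by rewrite !scalerA; congr (_ *: _); ring.
by rewrite ec eb !scalerA; congr (_ *: _); ring.
Qed.
End LocScale.

Definition locring_mul (c d : locring) : locring := loc_scale c (d : loc R^o).
Definition locring_one : locring := rfrac 1 denom1.

Lemma locring_mulE a s b t :
  locring_mul (rfrac a s) (rfrac b t) = rfrac (a * b) (denom_mul s t).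
Proof. exact: loc_scaleE. Qed.

Lemma locring_addE a s b t :
  rfrac a s + rfrac b t = rfrac (sval t * a + sval s * b) (denom_mul s t).
Proof. exact: loc_addE. Qed.

Fact locring_mulA : associative locring_mul.
Proof.
elim/rfracW=> a r; elim/rfracW=> b s; elim/rfracW=> c t.
by rewrite !locring_mulE; apply: rfrac_eq => /=; ring.
Qed.
Fact locring_mulC : commutative locring_mul.
Proof.
elim/rfracW=> a r; elim/rfracW=> b s.
by rewrite !locring_mulE; apply: rfrac_eq => /=; ring.
Qed.
Fact locring_mul1 : left_id locring_one locring_mul.
Proof.
elim/rfracW=> a r.
by rewrite !locring_mulE; apply: rfrac_eq => /=; ring.
Qed.
Fact locring_mulDl : left_distributive locring_mul +%R.
Proof.
elim/rfracW=> a r; elim/rfracW=> b s; elim/rfracW=> c t.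
rewrite !(locring_mulE, locring_addE).
by apply: rfrac_eq => /=; ring.
Qed.

HB.instance Definition _ := GRing.Zmodule_isComPzRing.Build locring
  locring_mulA locring_mulC locring_mul1 locring_mulDl.

Definition to_loc (a : R^o) : locring := rfrac a denom1.

(* Restriction of scalars along [R -> S^-1 R]. *)
Definition locring_scale (a : R) (c : locring) : locring := to_loc a * c.

Lemma to_locD (a b : R) : to_loc (a + b) = to_loc a + to_loc b.
Proof. by rewrite /to_loc locring_addE; apply: rfrac_eq => /=; ring. Qed.

Lemma to_locM (a b : R) : to_loc (a * b) = to_loc a * to_loc b.
Proof. by rewrite /to_loc [RHS]locring_mulE; apply: rfrac_eq => /=; ring. Qed.

Fact locring_scaleA a b c :
  locring_scale a (locring_scale b c) = locring_scale (a * b) c.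
Proof. by rewrite /locring_scale to_locM mulrA. Qed.
Fact locring_scale1 : left_id 1 locring_scale.
Proof. by move=> c; rewrite /locring_scale mul1r. Qed.
Fact locring_scaleDr : right_distributive locring_scale +%R.
Proof. by move=> a c d; rewrite /locring_scale mulrDr. Qed.
Fact locring_scaleDl c : {morph locring_scale^~ c : a b / a + b}.
Proof. by move=> a b; rewrite /locring_scale to_locD mulrDl. Qed.

HB.instance Definition _ := GRing.Zmodule_isLmodule.Build R locring
  locring_scaleA locring_scale1 locring_scaleDr locring_scaleDl.

Fact to_loc_linear : linear to_loc.
Proof. by move=> a u v; rewrite to_locD; congr (_ + _); exact: to_locM. Qed.
HB.instance Definition _ :=
  GRing.isLinear.Build R R^o locring *:%R to_loc to_loc_linear.

Section LocLmod.
Variable N : lmodType R.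

Lemma fracD (u : N) s v t :
  frac u s + frac v t = frac (sval t *: u + sval s *: v) (denom_mul s t).
Proof. exact: loc_addE. Qed.

Fact loc_scaleA (c d : locring) (p : loc N) :
  loc_scale c (loc_scale d p) = loc_scale (c * d) p.
Proof.
elim/rfracW: c => a r; elim/rfracW: d => b s; elim/fracW: p => u t.
rewrite [rfrac a r * _]locring_mulE !loc_scaleE; apply: frac_eq.
by rewrite /= !scalerA; congr (_ *: _); ring.
Qed.
Fact loc_scale1 : left_id 1 (@loc_scale N).
Proof.
elim/fracW=> u s; rewrite -[1]/(rfrac 1 denom1) loc_scaleE; apply: frac_eq.
by rewrite /= !scalerA; congr (_ *: _); ring.
Qed.
Fact loc_scaleDr : right_distributive (@loc_scale N) +%R.
Proof.
elim/rfracW=> a r; elim/fracW=> u s; elim/fracW=> v t.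
rewrite !(fracD, loc_scaleE); apply: frac_eq.
by rewrite /= !scalerDr !scalerA; congr (_ *: _ + _ *: _); ring.
Qed.
Fact loc_scaleDl (p : loc N) : {morph (@loc_scale N)^~ p : c d / c + d}.
Proof.
elim/fracW: p => u t; elim/rfracW=> a r; elim/rfracW=> b s.
rewrite /= locring_addE !loc_scaleE fracD; apply: frac_eq.
by rewrite /= !scalerDr !scalerA -scalerDl; congr (_ *: _); ring.
Qed.

HB.instance Definition _ := GRing.Zmodule_isLmodule.Build locring (loc N)
  loc_scaleA loc_scale1 loc_scaleDr loc_scaleDl.
End LocLmod.
End Localization.

Section Tensor.
Variables (R : comPzRingType) (A B : lmodType R).

(* A list represents the formal sum of the pure tensors of its entries; scalar
   multiples are absorbed in the first factor. *)
Inductive tens_rel : seq (A * B) -> seq (A * B) -> Prop :=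
| tens_refl s : tens_rel s s
| tens_sym s t : tens_rel s t -> tens_rel t s
| tens_trans s t u : tens_rel s t -> tens_rel t u -> tens_rel s u
| tens_cat s s' t t' :
    tens_rel s s' -> tens_rel t t' -> tens_rel (s ++ t) (s' ++ t')
| tens_catC s t : tens_rel (s ++ t) (t ++ s)
| tens_addl a a' b : tens_rel [:: (a + a', b)] [:: (a, b); (a', b)]
| tens_addr a b b' : tens_rel [:: (a, b + b')] [:: (a, b); (a, b')]
| tens_scale r a b : tens_rel [:: (r *: a, b)] [:: (a, r *: b)]
| tens_zero b : tens_rel [:: (0, b)] [::].

Definition tens_relb s t := `[< tens_rel s t >].

Fact tens_rel_equiv : equiv_class_of tens_relb.
Proof.
split=> [s|s t|t s u].
- exact/asboolP/tens_refl.
- by apply/idP/idP => /asboolP h; apply/asboolP/tens_sym.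
- by move=> /asboolP h /asboolP k; apply/asboolP/(tens_trans h k).
Qed.

Canonical tens_equiv := EquivRelPack tens_rel_equiv.

Definition tensor := {eq_quot tens_relb}.
HB.instance Definition _ := Choice.on tensor.

Definition tens_sum (s : seq (A * B)) : tensor := \pi_tensor s.
Definition tens (a : A) (b : B) : tensor := tens_sum [:: (a, b)].

Lemma tens_sumE s t : tens_sum s = tens_sum t <-> tens_rel s t.
Proof. by split=> [/eqmodP/asboolP//|h]; apply/eqmodP/asboolP. Qed.

Lemma tens_sumW (P : tensor -> Prop) :
  (forall s, P (tens_sum s)) -> forall q, P q.
Proof. by move=> H q; elim/quotW: q. Qed.

Lemma tens_repr s : tens_rel (repr (tens_sum s)) s.
Proof. by apply/tens_sumE; rewrite /tens_sum reprK. Qed.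

Definition tens_scale_seq (r : R) (s : seq (A * B)) :=
  [seq (r *: p.1, p.2) | p <- s].

Lemma tens_scale_seq_rel r s t :
  tens_rel s t -> tens_rel (tens_scale_seq r s) (tens_scale_seq r t).
Proof.
elim=> {s t} [s|s t _ h|s t u _ h _ k|s s' t t' _ h _ k|s t|a a' b|a b b'|c a b|b].
- exact: tens_refl.
- exact: tens_sym.
- exact: tens_trans h k.
- by rewrite /tens_scale_seq !map_cat; apply: tens_cat.
- by rewrite /tens_scale_seq !map_cat; apply: tens_catC.
- by rewrite /= scalerDr; apply: tens_addl.
- exact: tens_addr.
- by rewrite /= scalerA mulrC -scalerA; apply: tens_scale.
- by rewrite /= scaler0; apply: tens_zero.
Qed.

Definition tens_addq (p q : tensor) := tens_sum (repr p ++ repr q).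
Definition tens_scaleq r (p : tensor) := tens_sum (tens_scale_seq r (repr p)).
Definition tens_zeroq := tens_sum [::].
Definition tens_oppq (p : tensor) := tens_scaleq (-1) p.

Lemma tens_addqE s t : tens_addq (tens_sum s) (tens_sum t) = tens_sum (s ++ t).
Proof. by apply/tens_sumE/tens_cat; apply: tens_repr. Qed.

Lemma tens_scaleqE r s :
  tens_scaleq r (tens_sum s) = tens_sum (tens_scale_seq r s).
Proof. exact/tens_sumE/tens_scale_seq_rel/tens_repr. Qed.

Fact tens_addqA : associative tens_addq.
Proof.
by elim/tens_sumW=> s; elim/tens_sumW=> t; elim/tens_sumW=> u;
  rewrite !tens_addqE catA.
Qed.
Fact tens_addqC : commutative tens_addq.
Proof.
elim/tens_sumW=> s; elim/tens_sumW=> t; rewrite !tens_addqE.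
exact/tens_sumE/tens_catC.
Qed.
Fact tens_add0q : left_id tens_zeroq tens_addq.
Proof. by elim/tens_sumW=> s; rewrite tens_addqE. Qed.

Lemma tens_scaleqDl (q : tensor) r r' :
  tens_scaleq (r + r') q = tens_addq (tens_scaleq r q) (tens_scaleq r' q).
Proof.
elim/tens_sumW: q => s; rewrite !tens_scaleqE tens_addqE.
elim: s => [|[a b] s IHs] //=.
have e p (t : seq (A * B)) : tens_sum (p :: t) = tens_addq (tens_sum [:: p]) (tens_sum t).
  by rewrite tens_addqE.
rewrite e IHs scalerDl; have /tens_sumE -> := tens_addl (r *: a) (r' *: a) b.
rewrite !tens_addqE; apply/tens_sumE; rewrite -cat1s -[_ :: _ ++ _]cat1s /=.
apply: (tens_cat (tens_refl [:: _])).
rewrite -[_ :: (_ ++ _)]cat1s -[(_, _) :: tens_scale_seq r' s]cat1s !catA.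
exact: (tens_cat (tens_catC _ _) (tens_refl _)).
Qed.

Lemma tens_scale0q (q : tensor) : tens_scaleq 0 q = tens_zeroq.
Proof.
elim/tens_sumW: q => s; rewrite tens_scaleqE; apply/tens_sumE.
elim: s => [|[a b] s IHs] /=; first exact: tens_refl.
rewrite scale0r -cat1s -[[::]]/([::] ++ [::]).
exact: tens_cat (tens_zero b) IHs.
Qed.

Fact tens_scale1q : left_id 1 tens_scaleq.
Proof.
elim/tens_sumW=> s; rewrite tens_scaleqE; congr tens_sum.
by elim: s => [|[a b] s IHs] //=; rewrite scale1r IHs.
Qed.
Fact tens_addNq : left_inverse tens_zeroq tens_oppq tens_addq.
Proof.
move=> q; rewrite -{2}[q]tens_scale1q -tens_scaleqDl addNr.
exact: tens_scale0q.
Qed.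

HB.instance Definition _ :=
  GRing.isZmodule.Build tensor tens_addqA tens_addqC tens_add0q tens_addNq.

Fact tens_scaleqA a b p : tens_scaleq a (tens_scaleq b p) = tens_scaleq (a * b) p.
Proof.
elim/tens_sumW: p => s; rewrite !tens_scaleqE /tens_scale_seq -map_comp.
by congr tens_sum; apply: eq_map => p /=; rewrite scalerA.
Qed.
Fact tens_scaleqDr : right_distributive tens_scaleq +%R.
Proof.
have DE (p q : tensor) : p + q = tens_addq p q by [].
move=> a; elim/tens_sumW=> s; elim/tens_sumW=> t.
by rewrite !DE !(tens_scaleqE, tens_addqE) /tens_scale_seq map_cat.
Qed.
Fact tens_scaleqD p : {morph tens_scaleq^~ p : a b / a + b}.
Proof. by move=> a b; apply: tens_scaleqDl. Qed.

HB.instance Definition _ := GRing.Zmodule_isLmodule.Build R tensor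
  tens_scaleqA tens_scale1q tens_scaleqDr tens_scaleqD.

Lemma tens_sum_cat s t : tens_sum (s ++ t) = tens_sum s + tens_sum t.
Proof. by rewrite -tens_addqE. Qed.

Lemma tens_sum_cons a b t : tens_sum ((a, b) :: t) = tens a b + tens_sum t.
Proof. by rewrite -tens_sum_cat. Qed.

Lemma tens_sum0 : tens_sum [::] = 0.
Proof. by []. Qed.

Lemma tens_sumZ r s : r *: tens_sum s = tens_sum (tens_scale_seq r s).
Proof. by rewrite -tens_scaleqE. Qed.

Lemma tensDl a a' b : tens (a + a') b = tens a b + tens a' b.
Proof. rewrite -tens_sum_cat; exact/tens_sumE/tens_addl. Qed.
Lemma tensDr a b b' : tens a (b + b') = tens a b + tens a b'.
Proof. rewrite -tens_sum_cat; exact/tens_sumE/tens_addr. Qed.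
Lemma tensZl r a b : tens (r *: a) b = r *: tens a b.
Proof. by rewrite tens_sumZ. Qed.
Lemma tensZr r a b : tens a (r *: b) = r *: tens a b.
Proof. by rewrite -tensZl; apply/esym/tens_sumE/tens_scale. Qed.

Lemma tensW (P : tensor -> Prop) :
  P 0 -> (forall a b, P (tens a b)) -> (forall p q, P p -> P q -> P (p + q)) ->
  forall q, P q.
Proof.
move=> P0 Pt PD; elim/tens_sumW; elim=> [|[a b] s IHs]; first exact: P0.
by rewrite tens_sum_cons; apply: PD.
Qed.
End Tensor.

Section TensorMap.
Variables (R : comPzRingType) (A B A' B' : lmodType R).
Variables (f : {linear A -> A'}) (g : {linear B -> B'}).

Definition tens_map_seq (s : seq (A * B)) := [seq (f p.1, g p.2) | p <- s].

Lemma tens_map_seq_rel s t :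
  tens_rel s t -> tens_rel (tens_map_seq s) (tens_map_seq t).
Proof.
elim=> {s t} [s|s t _ h|s t u _ h _ k|s s' t t' _ h _ k|s t|a a' b|a b b'|c a b|b].
- exact: tens_refl.
- exact: tens_sym.
- exact: tens_trans h k.
- by rewrite /tens_map_seq !map_cat; apply: tens_cat.
- by rewrite /tens_map_seq !map_cat; apply: tens_catC.
- by rewrite /= linearD; apply: tens_addl.
- by rewrite /= linearD; apply: tens_addr.
- by rewrite /= !linearZ; apply: tens_scale.
- by rewrite /= linear0; apply: tens_zero.
Qed.

Definition tens_map (p : tensor A B) : tensor A' B' :=
  tens_sum (tens_map_seq (repr p)).

Lemma tens_map_sumE s : tens_map (tens_sum s) = tens_sum (tens_map_seq s).
Proof. exact/tens_sumE/tens_map_seq_rel/tens_repr. Qed.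

Lemma tens_mapE a b : tens_map (tens a b) = tens (f a) (g b).
Proof. exact: tens_map_sumE. Qed.

Fact tens_map_linear : linear tens_map.
Proof.
move=> r; elim/tens_sumW=> s; elim/tens_sumW=> t.
rewrite tens_sumZ -tens_sum_cat !tens_map_sumE tens_sumZ -tens_sum_cat.
congr tens_sum; rewrite /tens_map_seq /tens_scale_seq map_cat -!map_comp.
by congr (_ ++ _); apply: eq_map => p /=; rewrite linearZ.
Qed.
HB.instance Definition _ :=
  GRing.isLinear.Build R (tensor A B) (tensor A' B') *:%R tens_map tens_map_linear.
End TensorMap.

Lemma tens_map_square (R : comPzRingType) (A B A1 B1 A2 B2 A' B' : lmodType R)
    (f1 : {linear A -> A1}) (g1 : {linear B -> B1})
    (f1' : {linear A1 -> A'}) (g1' : {linear B1 -> B'})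
    (f2 : {linear A -> A2}) (g2 : {linear B -> B2})
    (f2' : {linear A2 -> A'}) (g2' : {linear B2 -> B'}) p :
  f1' \o f1 =1 f2' \o f2 -> g1' \o g1 =1 g2' \o g2 ->
  tens_map f1' g1' (tens_map f1 g1 p) = tens_map f2' g2' (tens_map f2 g2 p).
Proof.
move=> ef eg; elim/tensW: p => [|a b|p q IHp IHq]; first by rewrite !linear0.
  by rewrite !tens_mapE [f1' _]ef [g1' _]eg.
by rewrite !linearD /= IHp IHq.
Qed.

Lemma tens_map0r (R : comPzRingType) (A B A1 B1 A' B' : lmodType R)
    (f : {linear A -> A1}) (f' : {linear A1 -> A'}) (g : {linear B -> B1})
    (g' : {linear B1 -> B'}) p :
  (forall b, g' (g b) = 0) -> tens_map f' g' (tens_map f g p) = 0.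
Proof.
move=> e; elim/tensW: p => [|a b|p q IHp IHq]; first by rewrite !linear0.
  by rewrite !tens_mapE e -(scale0r 0) tensZr scale0r.
by rewrite !linearD /= IHp IHq addr0.
Qed.

(* Chain complexes have homological degrees [n : nat], cochain complexes
   cohomological ones; all other degrees are zero. *)
Record chain_complex (R : comPzRingType) := ChainComplex {
  chain_obj :> nat -> lmodType R;
  chain_d : forall n, {linear chain_obj n.+1 -> chain_obj n};
  chain_dd : forall n u, chain_d n (chain_d n.+1 u) = 0 }.

Record cochain_complex (R : comPzRingType) := CochainComplex {
  cochain_obj :> nat -> lmodType R;
  cochain_d : forall n, {linear cochain_obj n -> cochain_obj n.+1};
  cochain_dd : forall n u, cochain_d n.+1 (cochain_d n u) = 0 }.

Record chain_map (R : comPzRingType) (C D : chain_complex R) := ChainMap {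
  chain_map_val :> forall n, {linear C n -> D n};
  chain_mapP : forall n u,
    chain_map_val n (chain_d C n u) = chain_d D n (chain_map_val n.+1 u) }.

Section LinearSets.
Variables (R : pzRingType) (A B : lmodType R) (f : {linear A -> B}).

Definition lin_ker : {pred A} := fun u => f u == 0.
Definition lin_range : {pred B} := fun v => `[< range f v >].

Fact lin_ker_closed : submod_closed lin_ker.
Proof.
split=> [|a u v]; rewrite !unfold_in ?linear0 // linearP => /eqP-> /eqP->.
by rewrite scaler0 addr0.
Qed.
Fact lin_range_closed : submod_closed lin_range.
Proof.
split=> [|a u v /asboolP[u' _ <-] /asboolP[v' _ <-]]; apply/asboolP.
  by exists 0; rewrite ?linear0.
by exists (a *: u' + v'); rewrite ?linearP.
Qed.
HB.instance Definition _ := GRing.isSubmodClosed.Build R A lin_ker lin_ker_closed.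
HB.instance Definition _ :=
  GRing.isSubmodClosed.Build R B lin_range lin_range_closed.
End LinearSets.

Section SubQuot.
Variables (R : pzRingType) (N : lmodType R) (Z B : submodClosed N).

Definition restrict : {pred submod_type Z} := fun u => val u \in B.
Fact restrict_closed : submod_closed restrict.
Proof.
have E w : (w \in restrict) = (val w \in B) by [].
split=> [|a u v]; rewrite !E ?rpred0 // => uB vB.
by rewrite linearP rpredD ?rpredZ.
Qed.
HB.instance Definition _ :=
  GRing.isSubmodClosed.Build R (submod_type Z) restrict restrict_closed.

(* [Z / B] when [B] is contained in [Z] *)
Definition subquot : lmodType R := quotmod restrict.
End SubQuot.
Arguments restrict {R N} Z B _.

(* The differential leaving degree 0 of a chain complex and the one entering
   degree 0 of a cochain complex are zero. *)
Section Homology.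
Variables (R : comPzRingType) (C : chain_complex R).

Definition cycles (n : nat) : submodClosed (C n) :=
  match n with
  | 0 => lin_ker (\0 : {linear C 0%N -> C 0%N})
  | m.+1 => lin_ker (chain_d C m)
  end.

Definition homology (n : nat) : lmodType R :=
  subquot (cycles n) (lin_range (chain_d C n)).
End Homology.

Section HomologyMap.
Variables (R : comPzRingType) (C D : chain_complex R) (f : chain_map C D).
Variable n : nat.

Fact cycles_map (z : submod_type (cycles C n)) : f n (val z) \in cycles D n.
Proof.
case: z => z /=; case: n z => [|m] z; rewrite !unfold_in //= => /eqP zZ.
by rewrite -chain_mapP zZ linear0.
Qed.

Definition homology_map (h : homology C n) : homology D n :=
  let z : submod_type (cycles C n) := repr h in
  quot_class _ (Sub (f n (val z)) (cycles_map z)).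

Lemma homology_mapE (z : submod_type (cycles C n)) :
  homology_map (quot_class _ z) = quot_class _ (Sub (f n (val z)) (cycles_map z)).
Proof.
apply/quot_classE.
have : repr (quot_class (restrict (cycles C n) (lin_range (chain_d C n))) z) - z
    \in restrict (cycles C n) (lin_range (chain_d C n)) by exact: quot_repr.
case/asboolP => c _ e; apply/asboolP; exists (f n.+1 c) => //.
by rewrite -chain_mapP e !linearB.
Qed.
End HomologyMap.

Section Cohomology.
Variables (R : comPzRingType) (C : cochain_complex R).

Definition coboundaries (n : nat) : submodClosed (C n) :=
  match n with
  | 0 => lin_range (\0 : {linear C 0%N -> C 0%N})
  | m.+1 => lin_range (cochain_d C m)
  end.

Definition cohomology (n : nat) : lmodType R :=
  subquot (lin_ker (cochain_d C n)) (coboundaries n).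
End Cohomology.

Section InDegree0.
Variables (R : comPzRingType) (M : lmodType R).

Definition deg0_obj (n : nat) : lmodType R :=
  match n with 0 => M | _.+1 => 'rV[R]_0 end.

Definition chain_deg0 : chain_complex R :=
  @ChainComplex R deg0_obj (fun n => \0) (fun n u => erefl).
Definition cochain_deg0 : cochain_complex R :=
  @CochainComplex R deg0_obj (fun n => \0) (fun n u => erefl).
End InDegree0.

Lemma pair_linE (R : pzRingType) (A B : lmodType R) (a : R) (u v : A * B) :
  a *: u + v = (a *: u.1 + v.1, a *: u.2 + v.2).
Proof. by []. Qed.

(* Tensor product of the complex [0 -> P -> Q -> 0], with [P] in degree 1 and
   [Q] in degree 0, and the complex [C]: in degree [n.+1] the total complex is
   [(Q (x) C_n.+1) (+) (P (x) C_n)], with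
   [d (p (x) c) = f p (x) c - p (x) d c]. *)
Section ChainTensor.
Variables (R : comPzRingType) (P Q : lmodType R) (f : {linear P -> Q}).
Variable C : chain_complex R.

Definition chain_tens_obj (n : nat) : lmodType R :=
  match n with
  | 0 => tensor Q (C 0%N)
  | m.+1 => (tensor Q (C m.+1) * tensor P (C m))%type
  end.

Definition chain_tens_d (n : nat) :
    chain_tens_obj n.+1 -> chain_tens_obj n :=
  match n with
  | 0 => fun u => tens_map idfun (chain_d C 0) u.1 + tens_map f idfun u.2
  | m.+1 => fun u =>
      (tens_map idfun (chain_d C m.+1) u.1 + tens_map f idfun u.2,
       - tens_map idfun (chain_d C m) u.2)
  end.

Fact chain_tens_d_linear n : linear (@chain_tens_d n).
Proof.
case: n => [|n] a [u1 u2] [v1 v2] /=.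
  by rewrite !linearP /= scalerDr addrACA.
by rewrite pair_linE !linearP /= scalerDr addrACA.
Qed.
HB.instance Definition _ n := GRing.isLinear.Build R
  (chain_tens_obj n.+1) (chain_tens_obj n) *:%R (@chain_tens_d n)
  (@chain_tens_d_linear n).

Fact chain_tens_dd n u : @chain_tens_d n (@chain_tens_d n.+1 u) = 0.
Proof.
have sq m (t : tensor P (C m.+1)) :
    tens_map idfun (chain_d C m) (tens_map f idfun t) =
    tens_map f idfun (tens_map idfun (chain_d C m) t) :> tensor Q (C m).
  exact: tens_map_square.
case: n u => [|n] [u1 u2] /=.
  rewrite linearD /= tens_map0r ?add0r; last exact: chain_dd.
  by rewrite sq linearN /= subrr.
rewrite linearD /= tens_map0r ?add0r; last exact: chain_dd.
rewrite sq !linearN /= subrr tens_map0r ?oppr0 //; exact: chain_dd.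
Qed.

Definition chain_tens : chain_complex R := ChainComplex chain_tens_dd.
End ChainTensor.

(* The chain map [(p, q) (x) g], where [(p, q)] is a map of complexes from
   [P -> Q] to [P' -> Q']. *)
Section ChainTensorMap.
Variables (R : comPzRingType) (P Q P' Q' : lmodType R).
Variables (f : {linear P -> Q}) (f' : {linear P' -> Q'}).
Variables (p : {linear P -> P'}) (q : {linear Q -> Q'}).
Hypothesis pqP : forall a, q (f a) = f' (p a).
Variables (C C' : chain_complex R) (g : chain_map C C').

Definition chain_tens_map_fun (n : nat) :
    chain_tens f C n -> chain_tens f' C' n :=
  match n with
  | 0 => tens_map q (g 0%N)
  | m.+1 => fun u => (tens_map q (g m.+1) u.1, tens_map p (g m) u.2)
  end.

Fact chain_tens_map_linear n : linear (@chain_tens_map_fun n).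
Proof.
case: n => [|n] a u v /=; first exact: linearP.
by rewrite pair_linE !linearP.
Qed.
HB.instance Definition _ n := GRing.isLinear.Build R
  (chain_tens f C n) (chain_tens f' C' n) *:%R (@chain_tens_map_fun n)
  (@chain_tens_map_linear n).

Fact chain_tens_mapP n u :
  @chain_tens_map_fun n (chain_d (chain_tens f C) n u) =
  chain_d (chain_tens f' C') n (@chain_tens_map_fun n.+1 u).
Proof.
have sqQ m (t : tensor Q (C m.+1)) :
    tens_map q (g m) (tens_map idfun (chain_d C m) t) =
    tens_map idfun (chain_d C' m) (tens_map q (g m.+1) t).
  by apply: tens_map_square => // a; apply: chain_mapP.
have sqP m (t : tensor P (C m.+1)) :
    tens_map p (g m) (tens_map idfun (chain_d C m) t) =
    tens_map idfun (chain_d C' m) (tens_map p (g m.+1) t).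
  by apply: tens_map_square => // a; apply: chain_mapP.
have sqf m (t : tensor P (C m)) :
    tens_map q (g m) (tens_map f idfun t) =
    tens_map f' idfun (tens_map p (g m) t).
  by apply: tens_map_square => // a; apply: pqP.
case: n u => [|n] [u1 u2] /=; first by rewrite linearD /= sqQ sqf.
by rewrite linearD linearN /= sqQ sqf sqP.
Qed.

Definition chain_tens_map : chain_map (chain_tens f C) (chain_tens f' C') :=
  ChainMap chain_tens_mapP.
End ChainTensorMap.

(* Tensor product of the complex [0 -> P -> Q -> 0], with [P] in degree 0 and
   [Q] in degree 1, and the complex [C]: in degree [n.+1] the total complex is
   [(P (x) C^n.+1) (+) (Q (x) C^n)], with
   [d (p (x) c) = f p (x) c + p (x) d c] and [d (q (x) c) = - q (x) d c]. *)
Section CochainTensor.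
Variables (R : comPzRingType) (P Q : lmodType R) (f : {linear P -> Q}).
Variable C : cochain_complex R.

Definition cochain_tens_obj (n : nat) : lmodType R :=
  match n with
  | 0 => tensor P (C 0%N)
  | m.+1 => (tensor P (C m.+1) * tensor Q (C m))%type
  end.

Definition cochain_tens_d (n : nat) :
    cochain_tens_obj n -> cochain_tens_obj n.+1 :=
  match n with
  | 0 => fun u => (tens_map idfun (cochain_d C 0) u, tens_map f idfun u)
  | m.+1 => fun u =>
      (tens_map idfun (cochain_d C m.+1) u.1,
       tens_map f idfun u.1 - tens_map idfun (cochain_d C m) u.2)
  end.

Fact cochain_tens_d_linear n : linear (@cochain_tens_d n).
Proof.
case: n => [|n] a u v /=; rewrite pair_linE !linearP //=.
by rewrite scalerDr addrACA.
Qed.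
HB.instance Definition _ n := GRing.isLinear.Build R
  (cochain_tens_obj n) (cochain_tens_obj n.+1) *:%R (@cochain_tens_d n)
  (@cochain_tens_d_linear n).

Fact cochain_tens_dd n u : @cochain_tens_d n.+1 (@cochain_tens_d n u) = 0.
Proof.
have sq m (t : tensor P (C m)) :
    tens_map f idfun (tens_map idfun (cochain_d C m) t) =
    tens_map idfun (cochain_d C m) (tens_map f idfun t) :> tensor Q (C m.+1).
  exact: tens_map_square.
case: n u => [|n] u /=.
  by rewrite sq subrr tens_map0r //; apply: cochain_dd.
rewrite tens_map0r; last exact: cochain_dd.
rewrite linearB /= sq (@tens_map0r _ _ _ _ _ _ _ idfun idfun); last exact: cochain_dd.
by rewrite subr0 subrr.
Qed.

Definition cochain_tens : cochain_complex R := CochainComplex cochain_tens_dd.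
End CochainTensor.

Section Koszul.
Variables (R : comPzRingType) (M : lmodType R).

(* [K(x_1) (x) (K(x_2) (x) (... (x) M))] *)
Fixpoint koszul (x : seq R) : chain_complex R :=
  match x with
  | [::] => chain_deg0 M
  | a :: y => chain_tens ( *:%R a : {linear R^o -> R^o}) (koszul y)
  end.

Definition seq_pow (m : nat) (x : seq R) := [seq a ^+ m | a <- x].

Fact koszul_map_square (m n : nat) (nm : (n <= m)%N) (a : R) (b : R^o) :
  idfun (a ^+ m *: b) = a ^+ n *: (a ^+ (m - n) *: b).
Proof. by rewrite scalerA -exprD subnKC. Qed.

Definition chain_id (C : chain_complex R) : chain_map C C :=
  @ChainMap R C C (fun n => idfun) (fun n u => erefl).

Fixpoint koszul_map (m n : nat) (nm : (n <= m)%N) (x : seq R) :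
    chain_map (koszul (seq_pow m x)) (koszul (seq_pow n x)) :=
  match x with
  | [::] => chain_id (chain_deg0 M)
  | a :: y =>
      @chain_tens_map R R^o R^o R^o R^o
        ( *:%R (a ^+ m)) ( *:%R (a ^+ n)) ( *:%R (a ^+ (m - n))) idfun
        (koszul_map_square nm a) _ _ (koszul_map nm y)
  end.

Definition weakly_proregular (x : seq R) :=
  forall n : nat, exists (m : nat) (nm : (n <= m)%N),
    forall (i : nat) (h : homology (koszul (seq_pow m x)) i), (0 < i)%N ->
      homology_map (koszul_map nm x) h = 0.
End Koszul.

Section Cech.
Variables (R : comPzRingType).

Definition powers (a : R) : {pred R} := fun b => `[< exists n, b = a ^+ n >].
Fact powers_closed a : mulr_closed (powers a).
Proof.
split=> [|b c /asboolP[m ->] /asboolP[n ->]]; apply/asboolP.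
  by exists 0%N.
by exists (m + n)%N; rewrite exprD.
Qed.
HB.instance Definition _ a :=
  GRing.isMulClosed.Build R (powers a) (powers_closed a).

(* [C(x_1) (x) (C(x_2) (x) (... (x) M))] *)
Fixpoint cech (M : lmodType R) (x : seq R) : cochain_complex R :=
  match x with
  | [::] => cochain_deg0 M
  | a :: y =>
      cochain_tens (to_loc (powers a) : {linear R^o -> locring (powers a)})
        (cech M y)
  end.
End Cech.

Section PrimeLoc.
Variables (R : comPzRingType) (p : prime_ideal R).

Definition prime_compl : {pred R} := fun a => (a : R^o) \notin p.
Fact prime_compl_closed : mulr_closed prime_compl.
Proof.
split=> [|a b]; first exact: prime_ideal_proper.
rewrite !unfold_in => aS bS; apply/negP => /prime_ideal_prime[].
- exact/negP.
- exact/negP.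
Qed.
HB.instance Definition _ :=
  GRing.isMulClosed.Build R prime_compl prime_compl_closed.
End PrimeLoc.

Notation local_ring p := (locring (prime_compl p)).
Notation local_module p M := (loc (prime_compl p) M).

Definition supp (R : comPzRingType) (M : lmodType R) (p : prime_ideal R) :=
  exists u : local_module p M, u <> 0.

(* The supremum of the lengths of the chains of primes in the support; it is
   [-oo] for the zero module. As all subsets of [\bar int] have a supremum and
   an infimum, the default values of [supremum] and [infimum] are only used for
   the empty set. *)
Definition krull_dim (R : comPzRingType) (M : lmodType R) : \bar int :=
  supremum -oo%E [set (n%:Z)%:E | n in [set n : nat |
    exists c : nat -> prime_ideal R,
      (forall i, (i <= n)%N -> supp M (c i)) /\
      (forall i, (i < n)%N -> [set` c i] `<` [set` c i.+1])]].

Definition prime_height (R : comPzRingType) (M : lmodType R)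
    (p : prime_ideal R) : \bar int :=
  @krull_dim (local_ring p) (local_module p M).

Definition height (R : comPzRingType) (M : lmodType R) (I : ideal R) : \bar int :=
  infimum +oo%E [set h | exists p : prime_ideal R,
    [/\ supp M p, forall a : R^o, a \in I -> a \in p & h = prime_height M p]].

Definition parameter_sequence (R : comPzRingType) (M : lmodType R) (x : seq R) :=
  [/\ weakly_proregular M x,
      ~ (forall v : M, v \in seq_mul x M) &
      forall p : prime_ideal R, supp (quotmod (seq_mul x M)) p ->
        exists u : local_module p (cohomology (cech M x) (size x)), u <> 0].

(* Main.v *)
From HB Require Import structures.
From mathcomp Require Import all_boot all_order all_algebra ring.
From mathcomp Require Import boolp classical_sets functions constructive_ereal.
Require Import Defs.

(* (1) If dim M_p < l, the Coquand-Lombardi collapse of the elements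
   x_1^n, ..., x_l^n gives (x_1 ... x_l)^k M_p <= (x_1^(n+k), ..., x_l^(n+k)) M_p
   for some k, that is, H^l_x(M)_p = 0.

   (2) For R Noetherian everything reduces to one fact about a local ring R
   whose maximal ideal is minimal over the ideal of x: the cohomological
   dimension c(R/I), the top degree in which some quotient of R/I has nonzero
   cohomology with respect to x, drops when a prime I is replaced by I + a R,
   a not in I. As c <= l, chains of primes have length at most l (Krull), and
   if there is one of length l starting at P then H^l_x(R/P) <> 0
   (Grothendieck); the latter passes to M because a nonzero ideal of R/P is a
   quotient of M. Cohomology is computed as a limit of Koszul cohomology, so
   that cochains of R/I are vectors over R taken modulo I. *)

Set Implicit Arguments.
Unset Strict Implicit.
Unset Printing Implicit Defensive.

Import Order.TTheory GRing.Theory Num.Theory.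
Local Open Scope ring_scope.

(** * Linear combinations *)

(** Ideals are predicates on one ring, subquotients are pairs of predicates on one module, and
    congruences replace quotient rings. The long exact sequences of
    [0 -> R/(I:a) -> R/I -> R/(I+a) -> 0] thus become computations with representatives. The drop of
    the cohomological dimension rests on two finiteness facts. The cohomology of each [R/I] has to
    be Artinian, so that some [a] outside the prime realizes a smallest multiple of it; and between
    primes two steps apart there has to be a prime avoiding that [a]. The principal ideal theorem is
    proved for the second purpose: Krull's height theorem is not deduced from it by the usual
    induction, but comes out of the cohomology. Weak proregularity is a separate matter: over a
    Noetherian ring every finite sequence has it on a finitely generated module, by induction on the
    sequence and the chain condition on [M]. *)

Section LinearExpressions.
Variable R : comPzRingType.

Inductive linexp :=
  | LVar of nat | LZero | LAdd of linexp & linexp | LOpp of linexp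
  | LScale of R & linexp.

(** Indices are compared with [Nat.eqb] because [cbn] evaluates it on numerals; what [lin] leaves to
    [ring] is then free of indices. *)
Fixpoint lin_coef (i : nat) (e : linexp) : R :=
  match e with
  | LVar j => if Nat.eqb i j then 1 else 0
  | LZero => 0
  | LAdd e f => lin_coef i e + lin_coef i f
  | LOpp e => - lin_coef i e
  | LScale a e => a * lin_coef i e
  end.

Fixpoint lin_eval (V : lmodType R) (env : seq V) (e : linexp) : V :=
  match e with
  | LVar j => nth 0 env j
  | LZero => 0
  | LAdd e f => lin_eval env e + lin_eval env f
  | LOpp e => - lin_eval env e
  | LScale a e => a *: lin_eval env e
  end.

Fixpoint lin_eq_coefs (n : nat) (e f : linexp) : Prop :=
  match n with
  | 0 => True
  | m.+1 => lin_coef m e = lin_coef m f /\ lin_eq_coefs m e f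
  end.

Lemma lin_evalE (V : lmodType R) (env : seq V) e :
  lin_eval env e = \sum_(i < size env) lin_coef i e *: nth 0 env i.
Proof.
elim: e => [j||e IHe f IHf|e IHe|a e IHe] /=.
- case: (ltnP j (size env)) => [jn|nj]; last first.
    rewrite nth_default // big1 // => i _; case: PeanoNat.Nat.eqb_spec => [ij|_].
      by have := ltn_ord i; rewrite ij ltnNge nj.
    by rewrite scale0r.
  rewrite (bigD1 (Ordinal jn)) //= PeanoNat.Nat.eqb_refl scale1r big1 ?addr0 //.
  move=> i ij; case: PeanoNat.Nat.eqb_spec => [e|_]; last by rewrite scale0r.
  by case/eqP: ij; apply: val_inj.
- by rewrite big1 // => i _; rewrite scale0r.
- by rewrite IHe IHf -big_split; apply: eq_bigr => i _; rewrite [RHS]scalerDl.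
- by rewrite IHe -sumrN; apply: eq_bigr => i _; rewrite scaleNr.
- by rewrite IHe scaler_sumr; apply: eq_bigr => i _; rewrite scalerA.
Qed.

Lemma lin_eqP (V : lmodType R) (env : seq V) e f :
  lin_eq_coefs (size env) e f -> lin_eval env e = lin_eval env f.
Proof.
rewrite !lin_evalE => H; apply: eq_bigr => i _; congr (_ *: _).
have: (i < size env)%N by [].
elim: (size env) H (nat_of_ord i) => //= n IHn [e1 H] j; rewrite ltnS leq_eqVlt.
by case/orP=> [/eqP->|/(IHn H)].
Qed.
End LinearExpressions.

(* Atoms are compared up to conversion. *)
Ltac lin_index x env :=
  match env with
  | ?y :: _ => let _ := match goal with _ => unify x y end in constr:(0%nat)
  | _ :: ?env' => let n := lin_index x env' in constr:(S n)
  end.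

Ltac lin_collect t env :=
  lazymatch t with
  | (?a + ?b)%R => let env := lin_collect a env in lin_collect b env
  | (- ?a)%R => lin_collect a env
  | (_ *: ?a)%R => lin_collect a env
  | 0%R => env
  | _ => match env with
         | _ => let n := lin_index t env in env
         | _ => constr:(t :: env)
         end
  end.

Ltac lin_reify t env :=
  lazymatch t with
  | (?a + ?b)%R =>
      let a := lin_reify a env in let b := lin_reify b env in open_constr:(LAdd a b)
  | (- ?a)%R => let a := lin_reify a env in open_constr:(LOpp a)
  | (?r *: ?a)%R => let a := lin_reify a env in open_constr:(LScale r a)
  | 0%R => open_constr:(LZero _)
  | _ => let n := lin_index t env in open_constr:(LVar _ n)
  end.

(* Decides equalities between linear combinations of vectors, up to ring
   identities between the coefficients. *)
Ltac lin :=
  match goal with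
  | |- @eq ?T ?a ?b =>
    let env := lin_collect a (@nil T) in
    let env := lin_collect b env in
    let a' := lin_reify a env in
    let b' := lin_reify b env in
    refine (@lin_eqP _ _ env a' b' _);
    cbn [lin_eq_coefs lin_coef size Nat.eqb];
    repeat split; try ring
  end.

Section Submodules.
Variables (R : comPzRingType) (N : lmodType R).

(** A bare predicate rather than a bundled structure: most submodules below are existential formulas
    written inside a proof. *)
Definition is_submodule (U : N -> Prop) :=
  U 0 /\ forall a u v, U u -> U v -> U (a *: u + v).

Variables (U : N -> Prop) (hU : is_submodule U).

Lemma sbm0 : U 0. Proof. by case: hU. Qed.
Lemma sbmD u v : U u -> U v -> U (u + v).
Proof. by case: hU => _ h uU vU; rewrite -[u]scale1r; apply: h. Qed.
Lemma sbmZ a u : U u -> U (a *: u).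
Proof. by case: hU => h0 h uU; rewrite -[_ *: _]addr0; apply: h. Qed.
Lemma sbmN u : U u -> U (- u).
Proof. by move=> uU; rewrite -scaleN1r; apply: sbmZ. Qed.
Lemma sbmB u v : U u -> U v -> U (u - v).
Proof. by move=> uU vU; apply: sbmD => //; apply: sbmN. Qed.
Lemma sbm_subr u v : U (u - v) -> U v -> U u.
Proof. by move=> uv vU; rewrite -[u](subrK v); apply: sbmD. Qed.
Lemma sbm_subl u v : U (u - v) -> U u -> U v.
Proof. by move=> uv uU; rewrite -[v](subKr u); apply: sbmB. Qed.
End Submodules.

(** * Ideals and primes *)

Section Ideals.
Variable R : comPzRingType.
Implicit Types (I J P : R -> Prop) (a b r s : R).

Definition is_ideal I := I 0 /\ forall a u v, I u -> I v -> I (a * u + v).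

Definition is_prime P :=
  [/\ is_ideal P, ~ P 1 & forall a b, P (a * b) -> P a \/ P b].

Definition add_elt I a : R -> Prop := fun r => exists2 e, I e & exists s, r = e + s * a.
Definition colon I a : R -> Prop := fun r => I (r * a).

Section IdealOps.
Variables (I : R -> Prop) (hI : is_ideal I).

Lemma idl_sbm : @is_submodule R R^o I. Proof. exact: hI. Qed.
Lemma idl0 : I 0. Proof. exact: sbm0 idl_sbm. Qed.
Lemma idlD r s : I r -> I s -> I (r + s). Proof. exact: (sbmD idl_sbm). Qed.
Lemma idlM a r : I r -> I (a * r). Proof. exact: (sbmZ idl_sbm). Qed.
Lemma idlMr a r : I r -> I (r * a). Proof. by rewrite mulrC; apply: idlM. Qed.
Lemma idlN r : I r -> I (- r). Proof. exact: (sbmN idl_sbm). Qed.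
Lemma idlB r s : I r -> I s -> I (r - s). Proof. exact: (sbmB idl_sbm). Qed.
Lemma idl_subr r s : I (r - s) -> I s -> I r. Proof. exact: (sbm_subr idl_sbm). Qed.
Lemma idl1 r : I 1 -> I r. Proof. by move/(idlM r); rewrite mulr1. Qed.

Lemma idl_add a : is_ideal (add_elt I a).
Proof.
split=> [|b u v [e eI [s ->]] [f fI [t ->]]].
  by exists 0; [exact: idl0 | exists 0; rewrite mul0r addr0].
exists (b * e + f); first by apply: idlD => //; apply: idlM.
by exists (b * s + t); ring.
Qed.

Lemma idl_colon a : is_ideal (colon I a).
Proof.
split=> [|b u v]; rewrite /colon ?mul0r; first exact: idl0.
by move=> uI vI; rewrite mulrDl -mulrA; apply: idlD => //; apply: idlM.
Qed.

Lemma add_eltW a r : I r -> add_elt I a r.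
Proof. by exists r => //; exists 0; rewrite mul0r addr0. Qed.

Lemma add_elt_self a : add_elt I a a.
Proof. by exists 0; [exact: idl0 | exists 1; rewrite add0r mul1r]. Qed.

Lemma add_elt_min J a : is_ideal J -> (forall r, I r -> J r) -> J a ->
  forall r, add_elt I a r -> J r.
Proof.
move=> hJ IJ aJ r [e /IJ eJ [s ->]]; rewrite addrC.
by case: hJ => _; apply.
Qed.

Lemma colonW a r : I r -> colon I a r. Proof. exact: idlMr. Qed.
End IdealOps.

Lemma prime_idl P : is_prime P -> is_ideal P. Proof. by case. Qed.

Lemma prime_colon P a : is_prime P -> ~ P a -> colon P a = P.
Proof.
case=> hP _ pP naP; apply/funext => r; apply/propext; split=> [/pP[]//|].
exact: colonW.
Qed.

Lemma prime_exp P a n : is_prime P -> P (a ^+ n) -> P a.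
Proof.
case=> _ n1 pP; elim: n => [|n IHn]; first by rewrite expr0 => /n1.
by rewrite exprS => /pP[|/IHn].
Qed.

Definition powers_of a s := exists n, s = a ^+ n.

(** An ideal maximal among those that contain [I] and miss the multiplicative set [S] is prime:
    adjoining either of two elements outside it captures a member of [S], and the product of these
    two members would lie in the ideal if the product of the elements did. *)
Lemma prime_avoiding I (S : R -> Prop) : is_ideal I -> S 1 ->
  (forall a b, S a -> S b -> S (a * b)) -> (forall s, I s -> ~ S s) ->
  exists P, [/\ is_prime P, forall r, I r -> P r & forall s, P s -> ~ S s].
Proof.
move=> hI S1 SM IS.
(* Adjoining [I] to [A] makes the empty set a member of [F], as the union over the empty chain has
   to be. *)
pose F : set (set R) := fun A => is_ideal (fun r => I r \/ A r) /\ forall s, A s -> ~ S s.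
have [|A [[hA AS] maxA]] := @Zorn_bigcup R F.
  move=> G GF totG; split=> [|s [B GB Bs]]; last by case: (GF B GB) => _; apply.
  split=> [|a u v]; first by left; exact: idl0.
  have H B : G B -> I u \/ B u -> I v \/ B v -> I (a * u + v) \/ (\bigcup_(X in G) X)%classic (a * u + v).
    move=> GB uB vB; case: (GF B GB) => [[_ h] _].
    by case: (h a u v uB vB) => [|Bu]; [left | right; exists B].
  case=> [uI|[B GB Bu]] [vI|[C GC Cv]].
  - by left; case: hI => _; apply.
  - by apply: (H C) => //; [left|right].
  - by apply: (H B) => //; [right|left].
  - case: (totG B C GB GC) => s.
      by apply: (H C) => //; right => //; apply: s.
    by apply: (H B) => //; right => //; apply: s.
pose P r := I r \/ A r.
have PS s : P s -> ~ S s by case; [apply: IS | apply: AS].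
have maxP a : ~ P a -> exists2 s, add_elt P a s & S s.
  move=> nPa; apply: contrapT => H; apply: (maxA (add_elt P a)); split.
  - by move=> r Ar; apply: add_eltW; right.
  - by move=> h; apply: nPa; right; apply: h; exact: (add_elt_self hA).
  - have -> : (fun r => I r \/ add_elt P a r) = add_elt P a.
      apply/funext => r; apply/propext; split=> [[Ir|//]|]; last by right.
      by apply: add_eltW; left.
    exact: idl_add.
  - by move=> s sa Ss; apply: H; exists s.
exists P; split=> //; last by move=> r; left.
split=> // [P1|a b Pab]; first exact: (PS 1).
apply: contrapT => /not_orP[/maxP[s [e eP [c ->]] sS] /maxP[t [f fP [d ->]] tS]].
apply: (PS _ _ (SM _ _ sS tS)).
have -> : (e + c * a) * (f + d * b) = f * e + ((c * a) * f + ((d * b) * e + (c * d) * (a * b))) - 0 by ring.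
rewrite subr0; do 3! (apply: (idlD hA); first exact: (idlM hA)).
exact: (idlM hA).
Qed.

Lemma prime_over I : is_ideal I -> ~ I 1 -> exists2 P, is_prime P & forall r, I r -> P r.
Proof.
move=> hI n1; have [||s|P [pP IP _]] := @prime_avoiding I (fun s => s = 1) hI.
- by [].
- by move=> _ _ -> ->; rewrite mulr1.
- by move=> sI s1; apply: n1; rewrite -s1.
- by exists P.
Qed.

Lemma prime_not_mem I a : is_ideal I -> (forall n, ~ I (a ^+ n)) ->
  exists P, [/\ is_prime P, forall r, I r -> P r & ~ P a].
Proof.
move=> hI nI; have [||s sI [n e]|P [pP IP nP]] := @prime_avoiding I (powers_of a) hI.
- by exists 0%N.
- by move=> _ _ [n ->] [m ->]; exists (n + m)%N; rewrite exprD.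
- by apply: (nI n); rewrite -e.
- by exists P; split=> // Pa; apply: (nP _ Pa); exists 1%N; rewrite expr1.
Qed.

Definition acc :=
  forall I : nat -> R -> Prop, (forall n, is_ideal (I n)) ->
    (forall n r, I n r -> I n.+1 r) -> exists N, forall n r, I n r -> I N r.

Lemma noeth_ind (Pr : (R -> Prop) -> Prop) : acc ->
  (forall I, is_ideal I -> (forall J, is_ideal J -> (forall r, I r -> J r) ->
     (exists2 r, J r & ~ I r) -> Pr J) -> Pr I) ->
  forall I, is_ideal I -> Pr I.
Proof.
move=> hacc H I hI; apply: contrapT => nI.
pose T := {J : R -> Prop | is_ideal J /\ ~ Pr J}.
have step (J : T) : exists J' : T, (forall r, sval J r -> sval J' r) /\
    exists2 r, sval J' r & ~ sval J r.
  case: J => J [hJ nJ] /=; apply: contrapT => nex; apply: nJ; apply: H => // J' hJ' JJ' ex.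
  by apply: contrapT => nJ'; apply: nex; exists (exist _ J' (conj hJ' nJ')).
have [f hf] := choice step.
pose c n := iter n f (exist _ I (conj hI nI)).
have [||N hN] := hacc (fun n => sval (c n)).
- by move=> n; case: (svalP (c n)).
- by move=> n r; apply: (hf (c n)).1.
- have [_ [r r1 r0]] := hf (c N); apply: r0; exact: (hN N.+1).
Qed.

(* Every ideal is reached from prime ideals through the exact sequences
   [0 -> R/(I:a) -> R/I -> R/(I+a) -> 0]. *)
Lemma devissage (Pr : (R -> Prop) -> Prop) Q : acc -> is_ideal Q ->
  (forall I, is_ideal I -> I 1 -> Pr I) ->
  (forall P, is_prime P -> (forall r, Q r -> P r) ->
     (forall a, ~ P a -> Pr (add_elt P a)) -> Pr P) ->
  (forall I a, is_ideal I -> (forall r, Q r -> I r) ->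
     Pr (colon I a) -> Pr (add_elt I a) -> Pr I) ->
  forall I, is_ideal I -> (forall r, Q r -> I r) -> Pr I.
Proof.
move=> hacc hQ H1 HP HE; apply: (noeth_ind hacc) => I hI IH QI.
have IH' J r : is_ideal J -> (forall s, I s -> J s) -> J r -> ~ I r -> Pr J.
  move=> hJ IJ rJ rI; apply: IH => // [|s /QI /IJ//]; by exists r.
have [I1|nI1] := pselect (I 1); first exact: H1.
have [pI|npI] := pselect (is_prime I).
  apply: HP => // a nIa; apply: (IH' _ a) => //; first exact: idl_add.
    exact: add_eltW.
  exact: add_elt_self.
(* Both [(I : a)], which contains [b], and [I + R a] are strictly larger than [I]. *)
have [a [b [ab nIa nIb]]] : exists a b, [/\ I (a * b), ~ I a & ~ I b].
  apply: contrapT => H; apply: npI; split=> // a b ab; apply: contrapT.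
  by move=> /not_orP[na nb]; apply: H; exists a, b.
apply: (HE I a) => //.
- apply: (IH' _ b) => //; [exact: idl_colon | exact: colonW |].
  by rewrite /colon mulrC.
- apply: (IH' _ a) => //; [exact: idl_add | exact: add_eltW | exact: add_elt_self].
Qed.
End Ideals.

Lemma span_min (R : pzRingType) (N : lmodType R) (T : set N) (A : N -> Prop) :
  A 0 -> (forall a u v, A u -> A v -> A (a *: u + v)) ->
  (forall v, T v -> A v) -> forall v, v \in span T -> A v.
Proof.
move=> A0 AL TA v /asboolP/(_ A); apply; split=> //; split.
  exact/asboolP.
by move=> a u w /asboolP uA /asboolP wA; apply/asboolP/AL.
Qed.

Lemma span_gen (R : pzRingType) (N : lmodType R) (T : set N) v :
  T v -> v \in span T.
Proof. by move=> Tv; apply/asboolP => A [_]; apply. Qed.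

Lemma sbm_mem (R : comPzRingType) (N : lmodType R) (U : submodClosed N) :
  is_submodule (fun v => v \in U).
Proof. by split=> [|a u v uU vU]; rewrite ?rpred0 // rpredD ?rpredZ. Qed.

Lemma idl_mem (R : comPzRingType) (I : ideal R) : is_ideal (fun r : R => (r : R^o) \in I).
Proof. exact: (sbm_mem I). Qed.

Lemma noetherian_acc (R : comPzRingType) : noetherian R -> acc R.
Proof.
move=> noe I hI inc.
have mono n m r : (n <= m)%N -> I n r -> I m r.
  by move=> /subnKC <-; elim: (m - n)%N => [|k IHk]; rewrite ?addn0 // addnS => /IHk /inc.
pose U : set R^o := fun r => exists n, I n r.
have UE (r : R^o) : r \in span U <-> U r.
  split; last exact: span_gen.
  apply: span_min => // [|a u v [n un] [m vm]]; first by exists 0%N; exact: idl0 (hI 0%N).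
  exists (maxn n m); case: (hI (maxn n m)) => _; apply.
    by apply: mono un; exact: leq_maxl.
  by apply: mono vm; exact: leq_maxr.
have [s hs] := noe (span U).
have [N hN] : exists N, forall r, r \in s -> I N r.
  have: forall r : R^o, r \in s -> U r by move=> r rs; apply/UE; rewrite hs; exact: span_gen.
  elim: s {hs} => [|r s IHs] H; first by exists 0%N.
  have [n rn] := H r (mem_head _ _).
  have [|m hm] := IHs; first by move=> t ts; apply: H; rewrite inE ts orbT.
  exists (maxn n m) => t; rewrite inE => /orP[/eqP->|/hm tm]; [apply: mono rn | apply: mono tm].
    exact: leq_maxl.
  exact: leq_maxr.
exists N => n r rn; have: (r : R^o) \in span U by apply/UE; exists n.
rewrite hs; apply: span_min => // [|a u v uI vI]; first exact: idl0 (hI N).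
by case: (hI N) => _; apply.
Qed.

(** * Artinian subquotients *)

Section ArtinianSubquotients.
Variable R : comPzRingType.

(** The descending chain condition for [Z / B], read on the submodules between [B] and [Z]; the
    quotient is never formed. *)
Definition artinian (N : lmodType R) (Z B : N -> Prop) :=
  forall P : nat -> N -> Prop, (forall t, is_submodule (P t)) ->
    (forall t u, B u -> P t u) -> (forall t u, P t u -> Z u) ->
    (forall t u, P t.+1 u -> P t u) -> exists T, forall t u, P T u -> P t u.

Lemma decr_le (N : Type) (P : nat -> N -> Prop) : (forall t u, P t.+1 u -> P t u) ->
  forall s t u, (s <= t)%N -> P t u -> P s u.
Proof.
by move=> dec s t u /subnKC <-; elim: (t - s)%N => [|k IHk]; rewrite ?addn0 // addnS => /dec.
Qed.

Lemma art_trivial (N : lmodType R) (Z B : N -> Prop) :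
  (forall u, Z u -> B u) -> artinian Z B.
Proof. by move=> ZB P hP BP PZ dec; exists 0%N => t u /PZ /ZB /BP. Qed.

(** Every element of [Z] outside [B] generates [Z] modulo [B], so a member of the chain that misses
    part of [Z] is already [B]. *)
Lemma art_simple (N : lmodType R) (Z B : N -> Prop) :
  (forall u v, Z u -> Z v -> ~ B u -> exists a, B (v - a *: u)) -> artinian Z B.
Proof.
move=> simp P hP BP PZ dec.
have [[T [u uZ nu]]|H] := pselect (exists T, exists2 u, Z u & ~ P T u); last first.
  exists 0%N => t u /PZ uZ; apply: contrapT => nu; apply: H; by exists t, u.
exists T => t v vT; apply: (BP t); apply: contrapT => nBv; apply: nu.
have [a] := simp v u (PZ _ _ vT) uZ nBv => /(BP T) h.
by apply: (sbm_subr (hP T) h); apply: (sbmZ (hP T)).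
Qed.

(** Read backwards, [rho] is a linear map from a part of [Z' / B'] onto [Z / B]. This treats
    submodules and quotients alike, and it suits connecting maps, which involve choices of lifts. *)
Lemma art_transfer (N N' : lmodType R) (Z B : N -> Prop) (Z' B' : N' -> Prop)
    (rho : N -> N' -> Prop) :
  is_submodule Z' -> is_submodule B' -> (forall u, B' u -> Z' u) ->
  rho 0 0 ->
  (forall a u u' v v', rho u u' -> rho v v' -> rho (a *: u + v) (a *: u' + v')) ->
  (forall u, Z u -> exists2 u', Z' u' & rho u u') ->
  (forall u u', Z u -> rho u u' -> B' u' -> B u) ->
  artinian Z' B' -> is_submodule Z -> artinian Z B.
Proof.
move=> hZ' hB' BZ' rho0 rhoL tot inj hart hZ P hP BP PZ dec.
have rhoB u u' v v' : rho u u' -> rho v v' -> rho (u - v) (u' - v').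
  by move=> h k; have := rhoL (-1) _ _ _ _ k h; rewrite !scaleN1r ![- _ + _]addrC.
pose P' t u' := Z' u' /\ exists u u'', [/\ P t u, B' u'' & rho u (u' - u'')].
have [|||t u [uZ [v [w [vP wB r]]]]|T hT] := hart P'.
- move=> t; split.
    split; first exact: sbm0.
    by exists 0, 0; split; rewrite ?subr0 //; exact: sbm0.
  move=> a u v [uZ [u1 [u2 [h1 h2 h3]]]] [vZ [v1 [v2 [k1 k2 k3]]]]; split.
    by case: hZ' => _; apply.
  exists (a *: u1 + v1), (a *: u2 + v2); split.
  + by case: (hP t) => _; apply.
  + by case: hB' => _; apply.
  + have -> : a *: u + v - (a *: u2 + v2) = a *: (u - u2) + (v - v2) by lin.
    exact: rhoL.
- move=> t u uB; split; first exact: BZ'.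
  by exists 0, u; split=> //; rewrite ?subrr //; exact: sbm0.
- by move=> t u [].
- by split=> //; exists v, w; split=> //; apply: dec.
exists T => t u uT; have [u' u'Z r] := tot u (PZ _ _ uT).
have [_ [v [w [vP wB r']]]] : P' t u'.
  apply: hT; split=> //; exists u, 0; split; rewrite ?subr0 //; exact: sbm0.
have := rhoB _ _ _ _ r r'; rewrite subKr => r''.
apply: (sbm_subr (hP t) _ vP); apply: BP; apply: (inj _ _ _ r'') => //.
by apply: (sbmB hZ); apply: PZ; eassumption.
Qed.

Lemma art_ext (N : lmodType R) (Z Y B : N -> Prop) :
  is_submodule Z -> is_submodule Y -> (forall u, B u -> Y u) -> (forall u, Y u -> Z u) ->
  artinian Z Y -> artinian Y B -> artinian Z B.
Proof.
move=> hZ hY BY YZ artZ artY P hP BP PZ dec.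
pose P1 t u := exists2 v, P t v & Y (u - v).
have [|||t u [v vP uv]|T1 hT1] := artZ P1.
- move=> t; split; first by exists 0; rewrite ?subrr; [exact: sbm0 | exact: sbm0].
  move=> a u v [u1 u1P uu] [v1 v1P vv]; exists (a *: u1 + v1).
    by case: (hP t) => _; apply.
  have -> : a *: u + v - (a *: u1 + v1) = a *: (u - u1) + (v - v1) by lin.
  by case: hY => _; apply.
- by move=> t u uY; exists 0; rewrite ?subr0 //; exact: sbm0.
- by move=> t u [v /PZ vZ /YZ uv]; exact: (sbm_subr hZ uv).
- by exists v => //; apply: dec.
pose P2 t u := P t u /\ Y u.
have [|||t u [uP uY]|T2 hT2] := artY P2.
- move=> t; split=> [|a u v [uP uY] [vP vY]]; first by split; exact: sbm0.
  by split; [case: (hP t) => _ | case: hY => _]; apply.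
- by move=> t u uB; split; [exact: BP | exact: BY].
- by move=> t u [].
- by split=> //; apply: dec.
exists (maxn T1 T2) => t u uP.
have [tm|mt] := leqP t (maxn T1 T2); first exact: (decr_le dec tm).
have [v vP uv] : P1 t u.
  apply: hT1; exists u; last by rewrite subrr; exact: sbm0.
  by apply: (decr_le dec _ uP); exact: leq_maxl.
have [|] := hT2 t (u - v).
  split=> //; apply: (decr_le dec (leq_maxr T1 T2)).
  by apply: (sbmB (hP _) uP); apply: (decr_le dec (ltnW mt)).
by move=> h _; exact: (sbm_subr (hP t) h).
Qed.

(* A [c]-torsion module whose submodule killed by [c] is Artinian is Artinian
   (Melkersson). *)
Lemma art_torsion (N : lmodType R) (Z B : N -> Prop) (c : R) :
  is_submodule Z -> is_submodule B -> (forall u, B u -> Z u) ->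
  (forall u, Z u -> exists n, B (c ^+ n *: u)) ->
  artinian (fun u => Z u /\ B (c *: u)) B -> artinian Z B.
Proof.
move=> hZ hB BZ tors hart P hP BP PZ dec.
pose C s t u := exists2 v, P t v & B (u - c ^+ s *: v).
have hC s t : is_submodule (C s t).
  split; first by exists 0; [exact: sbm0 | rewrite scaler0 subrr; exact: sbm0].
  move=> a u v [u1 u1P uu] [v1 v1P vv]; exists (a *: u1 + v1).
    by case: (hP t) => _; apply.
  have -> : a *: u + v - c ^+ s *: (a *: u1 + v1) =
    a *: (u - c ^+ s *: u1) + (v - c ^+ s *: v1) by lin.
  by case: hB => _; apply.
have CB s t u : B u -> C s t u.
  by exists 0; [exact: sbm0 | rewrite scaler0 subr0].
have Ct s t t' u : (t <= t')%N -> C s t' u -> C s t u.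
  by move=> tt [v vP uv]; exists v => //; apply: (decr_le dec tt).
have Cs s s' t u : (s <= s')%N -> C s' t u -> C s t u.
  move=> ss [v vP uv]; exists (c ^+ (s' - s) *: v); first exact: sbmZ.
  by rewrite scalerA -exprD subnKC.
pose K u := Z u /\ B (c *: u).
have hK : is_submodule K.
  split=> [|a u v [uZ uB] [vZ vB]]; first by split; rewrite ?scaler0; exact: sbm0.
  split; first by case: hZ => _; apply.
  have -> : c *: (a *: u + v) = a *: (c *: u) + c *: v by lin.
  by case: hB => _; apply.
have KB u : B u -> K u by move=> uB; split; [exact: BZ | exact: sbmZ].
have artK f : (forall t u, C (f t.+1) t.+1 u -> C (f t) t u) ->
    exists T, forall t u, C (f T) T u -> K u -> C (f t) t u.
  move=> fdec; have [|||t u [uC uK]|T hT] := hart (fun t u => C (f t) t u /\ K u).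
  - move=> t; split=> [|a u v [uC uK] [vC vK]]; first by split; exact: sbm0.
    by split; [case: (hC (f t) t) => _ | case: hK => _]; apply.
  - by move=> t u uB; split; [exact: CB | exact: KB].
  - by move=> t u [].
  - by split=> //; apply: fdec.
  - by exists T => t u uT uK; case: (hT t u).
have [T0 hT0] := artK id (fun t u h => Cs _ _ _ _ (leqnSn t) (Ct _ _ _ _ (leqnSn t) h)).
have [Ts hTs] := choice (fun s => artK (fun=> s) (fun t u => Ct s t t.+1 u (leqnSn t))).
(* Only the finitely many rows [s < T0] have to become stationary one by one; from [T0] on, the
   diagonal chain [C t t] controls all rows. *)
pose T := maxn T0 (\max_(s < T0) Ts s).
have claim s t u : C s T u -> K u -> C s t u.
  move=> uC uK; have [sT|Ts'] := ltnP s T0.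
    apply: (hTs s t u) => //; apply: Ct uC.
    by rewrite leq_max (leq_bigmax (Ordinal sT)) orbT.
  apply: (Ct s t (maxn s t)); first exact: leq_maxr.
  apply: (Cs s (maxn s t)); first exact: leq_maxl.
  apply: hT0 => //; apply: (Cs _ s) => //; apply: Ct uC; exact: leq_maxl.
exists T => t u uT; have [n] := tors u (PZ _ _ uT).
have [tT|Tt] := leqP t T; first by move=> _; apply: (decr_le dec tT).
(* If [c ^+ n.+1] kills [u] modulo [B], then [c ^+ n *: u] is in [K], hence equal to [c ^+ n *: v]
   modulo [B] for some [v] in [P t]; the difference [u - v] is killed by the smaller power. *)
elim: n u uT => [|n IHn] u uT; first by rewrite expr0 scale1r; apply: BP.
rewrite exprS -scalerA => uB.
have [||v vP uv] := claim n t (c ^+ n *: u).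
- by exists u; rewrite ?subrr //; exact: sbm0.
- by split=> //; apply: sbmZ => //; apply: PZ uT.
apply: (sbm_subr (hP t) _ vP); apply: IHn; last by rewrite scalerBr.
by apply: (sbmB (hP T) uT); apply: (decr_le dec (ltnW Tt)).
Qed.

(** Otherwise, choosing again and again a factor [b] for which [a b Z + B] is smaller than [a Z + B]
    would produce an endless strictly descending chain. *)
Lemma art_min_multiple (N : lmodType R) (Z B : N -> Prop) (S : R -> Prop) :
  is_submodule Z -> is_submodule B -> (forall u, B u -> Z u) -> artinian Z B ->
  S 1 -> (forall a b, S a -> S b -> S (a * b)) ->
  exists2 a, S a & forall b u, S b -> Z u ->
    exists2 v, Z v & B (a *: u - (a * b) *: v).
Proof.
move=> hZ hB BZ hart S1 SM; apply: contrapT => H.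
pose im a u := exists2 v, Z v & B (u - a *: v).
have step (a : {a | S a}) : exists b : {a | S a},
    (exists2 u, Z u & ~ im (sval a * sval b) (sval a *: u)).
  case: a => a Sa /=; apply: contrapT => nex; apply: H; exists a => // b u Sb uZ.
  by apply: contrapT => nv; apply: nex; exists (exist _ b Sb), u.
have [f hf] := choice step.
pose g (a : {a | S a}) : {a | S a} := exist _ (sval a * sval (f a)) (SM _ _ (svalP a) (svalP (f a))).
pose c n := iter n g (exist _ 1 S1).
have [|||t u [v vZ uv]|T hT] := hart (fun t => im (sval (c t))).
- move=> t; split; first by exists 0; rewrite ?scaler0 ?subrr; exact: sbm0.
  move=> a u v [u1 u1P uu] [v1 v1P vv]; exists (a *: u1 + v1).
    by case: hZ => _; apply.
  have -> : a *: u + v - sval (c t) *: (a *: u1 + v1) =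
    a *: (u - sval (c t) *: u1) + (v - sval (c t) *: v1) by lin.
  by case: hB => _; apply.
- by move=> t u uB; exists 0; rewrite ?scaler0 ?subr0 //; exact: sbm0.
- by move=> t u [v vZ /BZ uv]; apply: (sbm_subr hZ uv); exact: sbmZ.
- exists (sval (f (c t)) *: v); first exact: sbmZ.
  by rewrite scalerA; exact: uv.
have [u uZ] := hf (c T); apply; apply: (hT T.+1).
by exists u => //; rewrite subrr; exact: sbm0.
Qed.
End ArtinianSubquotients.

(** * Limits of Koszul cohomology *)

Section KoszulCochains.
Variable R : comPzRingType.
Implicit Types (x y : seq R) (I J : R -> Prop) (a b r : R).

(** All cohomological degrees at once, a free module of rank [2 ^ size x]: the first component omits
    the generator of the head entry, the second one contains it. Keeping the degree as the predicate
    [khomog] avoids a dependent family of modules. *)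
Fixpoint kz x : lmodType R :=
  match x with
  | [::] => R^o
  | _ :: y => (kz y * kz y)%type
  end.

Fixpoint kd x (n : nat) : kz x -> kz x :=
  match x with
  | [::] => fun _ => 0
  | a :: y => fun u => (kd n u.1, a ^+ n *: u.1 - kd n u.2)
  end.

(** The transition map from the [n]-th to the [(n + k)]-th powers, whatever [n] is; it is dual to
    the maps [koszul_map] between Koszul chain complexes. *)
Fixpoint ktau x (k : nat) : kz x -> kz x :=
  match x with
  | [::] => id
  | a :: y => fun u => (ktau k u.1, a ^+ k *: ktau k u.2)
  end.

(* Degrees are shifted by one: [khomog 1] is the cohomological degree 0, and
   [khomog 0] is the zero module. *)
Fixpoint khomog x (j : nat) : kz x -> Prop :=
  match x with
  | [::] => fun u => j = 1%N \/ u = 0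
  | a :: y => fun u => khomog j u.1 /\ khomog j.-1 u.2
  end.

Fixpoint kin x I : kz x -> Prop :=
  match x with
  | [::] => I
  | a :: y => fun u => kin I u.1 /\ kin I u.2
  end.

Fixpoint kone x : kz x :=
  match x with [::] => (1 : R) | a :: y => (kone y, 0) end.

Fixpoint ktop x r : kz x :=
  match x with [::] => r | a :: y => (0, ktop y r) end.

Lemma pair_eq (U V : Type) (u v : U * V) : u.1 = v.1 -> u.2 = v.2 -> u = v.
Proof. by case: u v => [? ?] [? ?] /= -> ->. Qed.

Fact kd_linear x n : linear (@kd x n).
Proof.
elim: x => [|a y IHy] r u v /=; first by rewrite scaler0 addr0.
by apply: pair_eq; rewrite /= !IHy //; lin.
Qed.
HB.instance Definition _ x n :=
  GRing.isLinear.Build R (kz x) (kz x) *:%R (@kd x n) (@kd_linear x n).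

Fact ktau_linear x k : linear (@ktau x k).
Proof.
elim: x => [|a y IHy] r u v //=.
by apply: pair_eq; rewrite /= !IHy //; lin.
Qed.
HB.instance Definition _ x k :=
  GRing.isLinear.Build R (kz x) (kz x) *:%R (@ktau x k) (@ktau_linear x k).

Lemma kdd x n (u : kz x) : kd n (kd n u) = 0.
Proof.
elim: x u => [|a y IHy] //= u; rewrite !linearB linearZ /= !IHy.
by apply: pair_eq => //=; lin.
Qed.

Lemma ktau_kd x n k (u : kz x) : ktau k (kd n u) = kd (n + k) (ktau k u).
Proof.
elim: x u => [|a y IHy] //= u.
by rewrite !linearB !linearZ /= !IHy exprD; apply: pair_eq => //=; lin.
Qed.

Lemma ktauD x k l (u : kz x) : ktau k (ktau l u) = ktau (l + k) u.
Proof.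
elim: x u => [|a y IHy] //= u.
by rewrite linearZ /= !IHy exprD; apply: pair_eq => //=; lin.
Qed.

Lemma ktau0 x (u : kz x) : ktau 0 u = u.
Proof. by elim: x u => [|a y IHy] //= u; rewrite !IHy scale1r; apply: pair_eq. Qed.

Lemma khomog_sbm x j : is_submodule (@khomog x j).
Proof.
elim: x j => [|a y IHy] j /=.
  split=> [|r u v]; first by right.
  by move=> [->|->]; [left | move=> [->|->]; [left | right; rewrite scaler0 addr0]].
split=> [|r u v [u1 u2] [v1 v2]]; first by split; exact: sbm0.
by split; [case: (IHy j) | case: (IHy j.-1)] => _; apply.
Qed.

Lemma khomog0 x (u : kz x) : khomog 0 u -> u = 0.
Proof. by elim: x u => [|a y IHy] u /=; [case | case=> /IHy u1 /IHy u2; apply: pair_eq]. Qed.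

Lemma khomog_big x j (u : kz x) : ((size x).+1 < j)%N -> khomog j u -> u = 0.
Proof.
elim: x j u => [|a y IHy] j u /=; first by case: j => [|[|]] // j _ [].
move=> sj [/IHy u1 /IHy u2]; apply: pair_eq; first by apply: u1; apply: ltnW.
by apply: u2; case: j sj {u1}.
Qed.

Lemma khomog_kd x n j (u : kz x) : khomog j u -> khomog j.+1 (kd n u).
Proof.
elim: x j u => [|a y IHy] j u /=; first by right.
case=> u1 u2; split; first exact: IHy.
apply: (sbmB (khomog_sbm _ _)); first exact: (sbmZ (khomog_sbm _ _)).
case: j u1 u2 => [|j] _ u2; last exact: IHy.
by rewrite (khomog0 u2) linear0; exact: sbm0 (khomog_sbm _ _).
Qed.

Lemma khomog_ktau x k j (u : kz x) : khomog j u -> khomog j (ktau k u).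
Proof.
elim: x j u => [|a y IHy] j u //= [u1 u2]; split; first exact: IHy.
by apply: (sbmZ (khomog_sbm _ _)); apply: IHy.
Qed.

Lemma kin_sbm x I (hI : is_ideal I) : is_submodule (@kin x I).
Proof.
elim: x => [|a y IHy] //=.
split=> [|r u v [u1 u2] [v1 v2]]; first by split; exact: sbm0.
by split; case: IHy => _; apply.
Qed.

Lemma kin_mono x I J (u : kz x) : (forall r, I r -> J r) -> kin I u -> kin J u.
Proof.
move=> IJ; elim: x u => [|a y IHy] u /=; first exact: IJ.
by case=> u1 u2; split; apply: IHy.
Qed.

Lemma kin_kd x I n (u : kz x) : is_ideal I -> kin I u -> kin I (kd n u).
Proof.
move=> hI; elim: x u => [|a y IHy] u /=; first by move=> _; exact: idl0.
case=> u1 u2; split; first exact: IHy.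
by apply: (sbmB (kin_sbm _ hI)); [apply: (sbmZ (kin_sbm _ hI)) | apply: IHy].
Qed.

Lemma kin_ktau x I k (u : kz x) : is_ideal I -> kin I u -> kin I (ktau k u).
Proof.
move=> hI; elim: x u => [|a y IHy] u //= [u1 u2]; split; first exact: IHy.
by apply: (sbmZ (kin_sbm _ hI)); apply: IHy.
Qed.

Lemma kin_scale x I r (u : kz x) : is_ideal I -> I r -> kin I (r *: u).
Proof.
move=> hI Ir; elim: x u => [|a y IHy] u /=; last by split; apply: IHy.
exact: (@idlMr R I hI u r Ir).
Qed.

Lemma kin_colon x I a (u : kz x) : kin I (a *: u) <-> kin (colon I a) u.
Proof.
elim: x u => [|b y IHy] u /=; last by split=> -[/IHy ? /IHy ?].
by rewrite /colon mulrC.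
Qed.

Lemma kin_add x I a j (u : kz x) : is_ideal I -> kin (add_elt I a) u -> khomog j u ->
  exists2 w, khomog j w & kin I (u - a *: w).
Proof.
move=> hI; elim: x j u => [|b y IHy] j u /=.
  move=> [e eI [s ->]] [->|->].
    exists s; first by left.
    by change (I (e + s * a - a * s)); rewrite (mulrC s) addrK.
  exists 0; first by right.
  by rewrite scaler0 subrr; exact: idl0.
move=> [u1 u2] [h1 h2]; have [w1 w1h w1I] := IHy _ _ u1 h1.
by have [w2 w2h w2I] := IHy _ _ u2 h2; exists (w1, w2).
Qed.

Lemma linear_0 (U V : lmodType R) (f : U -> V) : linear f -> f 0 = 0.
Proof. by move=> fl; have := fl (-1) 0 0; rewrite scaler0 addr0 scaleN1r addNr. Qed.

Lemma linear_ZB (U V : lmodType R) (f : U -> V) r u v : linear f ->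
  f (r *: u - v) = r *: f u - f v.
Proof.
move=> fl; rewrite fl -[- v]addr0 -[- v]scaleN1r fl (linear_0 fl); lin.
Qed.

(* Multiplication by [b ^+ n] is null-homotopic on the Koszul complex of the
   [n]-th powers, for each entry [b] of the sequence. *)
Lemma khomotopy x b n : b \in x -> exists s : kz x -> kz x,
  [/\ linear s, forall j u, khomog j u -> khomog j.-1 (s u),
      forall I u, is_ideal I -> kin I u -> kin I (s u) &
      forall u, kd n (s u) + s (kd n u) = b ^+ n *: u].
Proof.
elim: x => [//|a y IHy]; rewrite inE => /orP[/eqP->|/IHy[s [sl sh sI sE]]].
  (* Contraction against the generator of the head entry; for an entry of the tail, the homotopy of
     the tail is extended with the Koszul sign. *)
  exists (fun u : kz y * kz y => (u.2, 0)); split=> [r u v|j u [_ u2]|I u hI [_ u2]|u] /=.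
  - by apply: pair_eq => //=; lin.
  - by split=> //; exact: sbm0 (khomog_sbm _ _).
  - by split=> //; exact: sbm0 (kin_sbm _ hI).
  - by apply: pair_eq; rewrite /= ?linear0; lin.
exists (fun u : kz y * kz y => (s u.1, - s u.2)).
split=> [r u v|j u [/sh u1 /sh u2]|I u hI [/sI u1 /sI u2]|u] /=.
- by apply: pair_eq; rewrite /= !sl //; lin.
- by split=> //; exact: (sbmN (khomog_sbm _ _)).
- by split; [exact: u1 | apply: (sbmN (kin_sbm _ hI)); exact: u2].
- apply: pair_eq; rewrite /= ?sE // (linear_ZB _ _ _ sl) linearN /= -(sE u.2); lin.
Qed.

Lemma kd_max x I n (u : kz x) : is_ideal I -> {in x, forall a, I a} -> (0 < n)%N ->
  kin I (kd n u).
Proof.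
move=> hI xI n0; elim: x xI u => [|a y IHy] xI u /=; first exact: idl0.
have yI : {in y, forall b, I b} by move=> b by_; apply: xI; rewrite inE by_ orbT.
split; first exact: IHy.
apply: (sbmB (kin_sbm _ hI)); last exact: IHy.
apply: kin_scale => //; case: n n0 {IHy} => // n _.
by rewrite exprS; apply: idlMr => //; apply: xI; exact: mem_head.
Qed.

(** By the shift, [1 < j] means positive cohomological degree, where each component picks up a
    factor [a ^+ k]. Hence [R / I] has limit cohomology in degree 0 only when [I] contains all
    entries of [x]. *)
Lemma ktau_max x I k j (u : kz x) : is_ideal I -> {in x, forall a, I a} -> (0 < k)%N ->
  (1 < j)%N -> khomog j u -> kin I (ktau k u).
Proof.
move=> hI xI k0; elim: x xI j u => [|a y IHy] xI j u j1 /=.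
  by case=> [e|->]; [move: j1; rewrite e | exact: idl0].
have yI : {in y, forall b, I b} by move=> b by_; apply: xI; rewrite inE by_ orbT.
case=> u1 u2; split; first exact: IHy u1.
apply: kin_scale => //; case: k k0 {IHy} => // k _.
by rewrite exprS; apply: idlMr => //; apply: xI; exact: mem_head.
Qed.

Lemma khomog_kone x : khomog 1 (kone x).
Proof. by elim: x => [|a y IHy] /=; [left | split=> //; exact: sbm0 (khomog_sbm _ _)]. Qed.

Lemma khomog1 x (u : kz x) : khomog 1 u -> exists r, u = r *: kone x.
Proof.
elim: x u => [|a y IHy] u /=; first by exists u; rewrite -[_ *: _]/(_ * _) mulr1.
case=> /IHy[r e] /khomog0 u2; exists r; apply: pair_eq => //=.
by rewrite scaler0.
Qed.

Lemma kin_kone x I r : is_ideal I -> kin I (r *: kone x) <-> I r.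
Proof.
move=> hI; elim: x => [|a y IHy] /=; first by rewrite -[_ *: _]/(_ * _) mulr1.
split=> [[/IHy]|/IHy rI] //; split=> //; rewrite scaler0.
exact: sbm0 (kin_sbm _ hI).
Qed.

Lemma ktau_kone x k : ktau k (kone x) = kone x.
Proof. by elim: x => [|a y IHy] //=; rewrite IHy linear0 scaler0. Qed.

Lemma ktop_lin x a r s : ktop x (a * r + s) = a *: ktop x r + ktop x s.
Proof. by elim: x => [|b y IHy] //=; rewrite IHy; apply: pair_eq => //=; lin. Qed.

Lemma ktop0 x : ktop x 0 = 0.
Proof. by elim: x => [|b y IHy] //=; rewrite IHy. Qed.

Lemma ktopZ x a r : ktop x (a * r) = a *: ktop x r.
Proof. by rewrite -[a * r]addr0 ktop_lin ktop0 addr0. Qed.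

Lemma ktopB x r s : ktop x (r - s) = ktop x r - ktop x s.
Proof. by rewrite addrC -[- s]mulN1r ktop_lin scaleN1r addrC. Qed.

Lemma khomog_ktop x r : khomog (size x).+1 (ktop x r).
Proof. by elim: x => [|a y IHy] /=; [left | split=> //; exact: sbm0 (khomog_sbm _ _)]. Qed.

Lemma khomog_top x (u : kz x) : khomog (size x).+1 u -> exists r, u = ktop x r.
Proof.
elim: x u => [|a y IHy] u /=; first by exists u.
case=> u1 /IHy[r e]; exists r; apply: pair_eq => //=; exact: khomog_big u1.
Qed.

Lemma kin_ktop x I r : is_ideal I -> I r -> kin I (ktop x r).
Proof. by move=> hI Ir; rewrite -[r]mulr1 ktopZ; exact: kin_scale. Qed.

Lemma ktau_ktop x k r : ktau k (ktop x r) = ktop x ((\prod_(a <- x) a) ^+ k * r).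
Proof.
elim: x => [|a y IHy] /=; first by rewrite big_nil expr1n mul1r.
rewrite IHy linear0 -ktopZ big_cons exprMn; apply: pair_eq => //=.
by congr ktop; ring.
Qed.

(** The homotopy for an entry [d] exhibits [d ^+ n *: ktop x c] as a boundary, since [ktop x c] is
    closed for reasons of degree. *)
Lemma ktop_boundary x n (v : R^o) : v \in seq_mul (seq_pow n x) R^o ->
  exists2 w, khomog (size x) w & kd n w = ktop x v.
Proof.
pose A (v : R^o) := exists2 w, khomog (size x) w & kd n w = ktop x v.
apply: (@span_min R R^o _ A) => [|a u w [u' uh uE] [w' wh wE]|u [b bx [c ->]]].
- by exists 0; [exact: sbm0 (khomog_sbm _ _) | rewrite linear0 ktop0].
- exists (a *: u' + w'); first by case: (khomog_sbm x (size x)) => _; apply.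
  by rewrite kd_linear uE wE -ktop_lin.
- have /mapP[d dx e] := bx; have [s [sl sh _ sE]] := khomotopy n dx.
  exists (s (ktop x c)); first exact: (sh (size x).+1 _ (khomog_ktop _ _)).
  have := sE (ktop x c).
  rewrite [kd _ (ktop x c)](khomog_big _ (khomog_kd n (khomog_ktop x c))) //.
  by rewrite (linear_0 sl) addr0 e ktopZ.
Qed.
End KoszulCochains.

Section Eventually.
Definition eventually (P : nat -> Prop) := exists N, forall n, (N <= n)%N -> P n.

Lemma eventually_all (P : nat -> Prop) : (forall n, P n) -> eventually P.
Proof. by exists 0%N. Qed.

Lemma eventually2 (P Q S : nat -> Prop) :
  (forall n, P n -> Q n -> S n) -> eventually P -> eventually Q -> eventually S.
Proof.
move=> PQ [N hN] [M hM]; exists (maxn N M) => n; rewrite geq_max => /andP[/hN ? /hM ?].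
exact: PQ.
Qed.

Lemma eventually1 (P S : nat -> Prop) : (forall n, P n -> S n) -> eventually P -> eventually S.
Proof. by move=> PS [N hN]; exists N => n /hN /PS. Qed.
End Eventually.

(* The direct limit over [n] of the cohomology of the Koszul complexes of
   [x ^ n] on [R / I], computed with sequences of cochains which are
   eventually compatible with the transition maps [ktau]. *)
Section LimitCohomology.
Variables (R : comPzRingType) (x : seq R).
Implicit Types (I J : R -> Prop) (u v w : nat -> kz x).

Definition homog (j : nat) (u : nat -> kz x) :=
  eventually (fun n => khomog j (u n) /\ u n.+1 = ktau 1 (u n)).
Definition inI I (u : nat -> kz x) := eventually (fun n => kin I (u n)).
Definition diff (u : nat -> kz x) : nat -> kz x := fun n => kd n (u n).
(** The element of the limit represented by [c] at level [N]; the zeros below [N] are fillers, as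
    only the eventual values count. *)
Definition emb (N : nat) (c : kz x) : nat -> kz x :=
  fun n => if (N <= n)%N then ktau (n - N) c else 0.

Definition cocycle j I u := homog j u /\ inI I (diff u).
Definition coboundary j I u := homog j u /\ exists2 w, homog j.-1 w & inI I (u - diff w).
Definition vanish j I := forall u, cocycle j I u -> coboundary j I u.

Lemma df_lin a u v : diff (a *: u + v) = a *: diff u + diff v.
Proof. by apply/funext => n; exact: kd_linear. Qed.
Lemma df0 : diff 0 = 0.
Proof. by apply/funext => n; exact: linear0. Qed.
Lemma dfZ a u : diff (a *: u) = a *: diff u.
Proof. by rewrite -[a *: u]addr0 df_lin df0 addr0. Qed.
Lemma dfB u v : diff (u - v) = diff u - diff v.
Proof. by apply/funext => n; exact: linearB. Qed.
Lemma dff u : diff (diff u) = 0.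
Proof. by apply/funext => n; exact: kdd. Qed.

Lemma homog_sbm j : is_submodule (homog j).
Proof.
split=> [|a u v].
  by apply: eventually_all => n; split; [exact: sbm0 (khomog_sbm _ _) | rewrite linear0].
apply: eventually2 => n [u1 u2] [v1 v2]; split.
  by case: (khomog_sbm x j) => _; apply.
by rewrite [RHS]ktau_linear -u2 -v2.
Qed.

Lemma inI_sbm I : is_ideal I -> is_submodule (inI I).
Proof.
move=> hI; split=> [|a u v].
  by apply: eventually_all => n; exact: sbm0 (kin_sbm _ hI).
by apply: eventually2 => n un vn; case: (kin_sbm x hI) => _; apply.
Qed.

Lemma inI_mono I J u : (forall r, I r -> J r) -> inI I u -> inI J u.
Proof. by move=> IJ; apply: eventually1 => n; exact: kin_mono. Qed.

Lemma inI_df I u : is_ideal I -> inI I u -> inI I (diff u).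
Proof. by move=> hI; apply: eventually1 => n; exact: kin_kd. Qed.

Lemma inI_scale I r u : is_ideal I -> I r -> inI I (r *: u).
Proof. by move=> hI Ir; apply: eventually_all => n; exact: kin_scale. Qed.

Lemma inI_colon I a u : inI I (a *: u) <-> inI (colon I a) u.
Proof. by split; apply: eventually1 => n /kin_colon. Qed.

Lemma inI_top I u : is_ideal I -> I 1 -> inI I u.
Proof. by move=> hI I1; rewrite -[u]scale1r; exact: inI_scale. Qed.

Lemma homog_df j u : homog j u -> homog j.+1 (diff u).
Proof.
apply: eventually1 => n [u1 u2]; split; first exact: khomog_kd.
by rewrite /diff u2 -[n.+1]addn1 ktau_kd.
Qed.

Lemma homog_pred_df j u : homog j.-1 u -> homog j (diff u).
Proof.
case: j => [|j]; last exact: homog_df.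
apply: eventually1 => n /= [u1 u2]; rewrite /diff u2 (khomog0 u1) !linear0.
by split=> //; exact: sbm0 (khomog_sbm _ _).
Qed.

Lemma homog_compat j u : homog j u -> exists N, forall n, (N <= n)%N ->
  khomog j (u n) /\ u n = ktau (n - N) (u N).
Proof.
move=> [N hN]; exists N => n Nn; split; first by case: (hN n Nn).
rewrite -(subnKC Nn) addKn; elim: (n - N)%N => [|k IHk]; first by rewrite addn0 ktau0.
by rewrite addnS (hN _ (leq_addr _ _)).2 IHk ktauD addn1.
Qed.

Lemma homog_emb j N c : khomog j c -> homog j (emb N c).
Proof.
move=> hc; exists N => n Nn; rewrite /emb Nn (leqW Nn) ktauD; split.
  exact: khomog_ktau.
by rewrite subSn // addn1.
Qed.

Lemma inI_add I a j u : is_ideal I -> homog j u -> inI (add_elt I a) u ->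
  exists2 w, homog j w & inI I (u - a *: w).
Proof.
move=> hI hu [M hM]; have [N hN] := homog_compat hu.
(* The lift is chosen at the single level [L] and transported upwards by [ktau], which keeps it
   compatible. *)
set L := maxn M N.
have [w wh wI] := kin_add hI (hM L (leq_maxl _ _)) (hN L (leq_maxr _ _)).1.
have hw := homog_emb L wh; exists (emb L w) => //.
exists L => n Ln.
have -> : (u - a *: emb L w) n = u n - a *: emb L w n by [].
rewrite /emb Ln (hN n (leq_trans (leq_maxr _ _) Ln)).2.
have -> : (n - N)%N = ((L - N) + (n - L))%N by rewrite addnC addnBA ?leq_maxr // subnK.
rewrite -ktauD -(hN L (leq_maxr _ _)).2 -linearZ -linearB; exact: kin_ktau.
Qed.

Lemma homog0_inI I u : is_ideal I -> homog 0 u -> inI I u.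
Proof.
by move=> hI; apply: eventually1 => n [/khomog0-> _]; exact: sbm0 (kin_sbm _ hI).
Qed.

Lemma homog_big_inI I j u : is_ideal I -> ((size x).+1 < j)%N -> homog j u -> inI I u.
Proof.
move=> hI sj; apply: eventually1 => n [/(khomog_big sj)-> _]; exact: sbm0 (kin_sbm _ hI).
Qed.

Lemma cocycle_sbm j I : is_ideal I -> is_submodule (cocycle j I).
Proof.
move=> hI; split=> [|a u v [u1 u2] [v1 v2]].
  by split; rewrite ?df0; [exact: sbm0 (homog_sbm j) | exact: sbm0 (inI_sbm hI)].
split; first by case: (homog_sbm j) => _; apply.
by rewrite df_lin; case: (inI_sbm hI) => _; apply.
Qed.

Lemma coboundary_sbm j I : is_ideal I -> is_submodule (coboundary j I).
Proof.
move=> hI; split=> [|a u v [u1 [u2 u3 u4]] [v1 [v2 v3 v4]]].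
  split; first exact: sbm0 (homog_sbm j).
  by exists 0; rewrite ?df0 ?subr0; [exact: sbm0 (homog_sbm _) | exact: sbm0 (inI_sbm hI)].
split; first by case: (homog_sbm j) => _; apply.
exists (a *: u2 + v2); first by case: (homog_sbm j.-1) => _; apply.
have -> : a *: u + v - diff (a *: u2 + v2) = a *: (u - diff u2) + (v - diff v2).
  by rewrite df_lin; lin.
by case: (inI_sbm hI) => _; apply.
Qed.

Lemma coboundary_Zc j I u : is_ideal I -> coboundary j I u -> cocycle j I u.
Proof.
move=> hI [hu [w _ uw]]; split=> //.
by rewrite -[diff u]subr0 -(dff w) -dfB; exact: inI_df.
Qed.

Lemma coboundary_inI j I u : is_ideal I -> homog j u -> inI I u -> coboundary j I u.
Proof.
move=> hI hu uI; split=> //; exists 0; first exact: sbm0 (homog_sbm _).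
by rewrite df0 subr0.
Qed.

Lemma cocycle_mono j I J u : (forall r, I r -> J r) -> cocycle j I u -> cocycle j J u.
Proof. by move=> IJ [hu uI]; split=> //; exact: inI_mono uI. Qed.

Lemma coboundary_mono j I J u : (forall r, I r -> J r) -> coboundary j I u -> coboundary j J u.
Proof. by move=> IJ [hu [w hw uw]]; split=> //; exists w => //; exact: inI_mono uw. Qed.

(* H^(j-1)(R/(I:a)) -> H^(j-1)(R/I) -> H^(j-1)(R/(I+a)) is exact. *)
Lemma exact_mid j I a u : is_ideal I -> cocycle j I u -> coboundary j (add_elt I a) u ->
  exists2 v, cocycle j (colon I a) v & coboundary j I (u - a *: v).
Proof.
move=> hI [hu uI] [_ [w hw uw]].
have hdw := homog_pred_df hw.
have [v hv uv] := inI_add hI (sbmB (homog_sbm j) hu hdw) uw.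
exists v; last first.
  split; first by apply: (sbmB (homog_sbm j)) => //; exact: (sbmZ (homog_sbm j)).
  exists w => //; have -> : u - a *: v - diff w = u - diff w - a *: v by lin.
  exact: uv.
split=> //; apply/inI_colon.
have := inI_df hI uv; rewrite !dfB dff dfZ subr0 => h.
exact: (sbm_subl (inI_sbm hI) h).
Qed.

(* H^(j-2)(R/(I+a)) -> H^(j-1)(R/(I:a)) -> H^(j-1)(R/I) is exact. *)
Lemma exact_left j I a v : is_ideal I -> cocycle j (colon I a) v -> coboundary j I (a *: v) ->
  exists2 w, cocycle j.-1 (add_elt I a) w & inI I (a *: v - diff w).
Proof.
move=> hI [hv vI] [_ [w hw vw]]; exists w => //; split=> //.
have hIa := idl_add hI a.
apply: (sbm_subl (inI_sbm hIa) (inI_mono _ vw)) => [r|]; first exact: add_eltW.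
by apply: inI_scale => //; exact: add_elt_self.
Qed.

(** [a *: v - diff w] being in [I] means that the connecting map sends the class of [w] to that of
    [v]. Its being well defined is the injectivity that [art_transfer] asks of the converse
    relation. *)
Lemma connecting_inj j I a v w : is_ideal I -> homog j v -> inI I (a *: v - diff w) ->
  coboundary j.-1 (add_elt I a) w -> coboundary j (colon I a) v.
Proof.
move=> hI hv vw [hw [w1 hw1 ww1]]; split=> //.
have hdw1 : homog j.-1 (diff w1) by exact: homog_pred_df.
have [w2 hw2 ww2] := inI_add hI (sbmB (homog_sbm _) hw hdw1) ww1.
exists w2 => //; apply/inI_colon.
have := inI_df hI ww2; rewrite !dfB dff dfZ subr0 => h.
have -> : a *: (v - diff w2) = (a *: v - diff w) + (diff w - a *: diff w2) by lin.
exact: (sbmD (inI_sbm hI)).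
Qed.

Lemma vanish_left j I a v : is_ideal I -> vanish j.-1 (add_elt I a) ->
  cocycle j (colon I a) v -> coboundary j I (a *: v) -> coboundary j (colon I a) v.
Proof.
move=> hI van vZ /(exact_left hI vZ)[w /van wB vw].
by apply: (connecting_inj hI _ vw wB); case: vZ.
Qed.

Lemma vanish_mid j I a : is_ideal I -> vanish j (colon I a) -> vanish j (add_elt I a) ->
  vanish j I.
Proof.
move=> hI van1 van2 u uZ.
have uB : coboundary j (add_elt I a) u by apply/van2/(cocycle_mono _ uZ) => r; exact: add_eltW.
have [v /van1[hv [w hw vw]] uv] := exact_mid hI uZ uB.
apply: (sbm_subr (coboundary_sbm j hI) uv); split; first exact: (sbmZ (homog_sbm j)).
exists (a *: w); first exact: (sbmZ (homog_sbm _)).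
by rewrite dfZ -scalerBr; apply/inI_colon.
Qed.

(* H^(j-1)(R/I) -> H^(j-1)(R/(I+a)) -> H^j(R/(I:a)) is exact. *)
Lemma vanish_right j I a u : is_ideal I -> vanish j.+1 (colon I a) -> cocycle j (add_elt I a) u ->
  exists2 v, cocycle j I v & coboundary j (add_elt I a) (u - v).
Proof.
move=> hI van [hu uI]; have hIa := idl_add hI a.
have [w hw uw] := inI_add hI (homog_df hu) uI.
have wZ : cocycle j.+1 (colon I a) w.
  split=> //; apply/inI_colon; have := inI_df hI uw.
  by rewrite dfB dff sub0r dfZ => /(sbmN (inI_sbm hI)); rewrite opprK.
have [_ [/= w1 hw1 /inI_colon ww1]] := van w wZ.
exists (u - a *: w1); last first.
  have -> : u - (u - a *: w1) = a *: w1 by lin.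
  apply: coboundary_inI => //; first exact: (sbmZ (homog_sbm j)).
  by apply: inI_scale => //; exact: add_elt_self.
split; first by apply: (sbmB (homog_sbm j)) => //; exact: (sbmZ (homog_sbm j)).
rewrite dfB dfZ.
have -> : diff u - a *: diff w1 = (diff u - a *: w) + a *: (w - diff w1) by lin.
exact: (sbmD (inI_sbm hI)).
Qed.

(** Cohomology is right exact below a vanishing degree: [J] is approached from [I] by adjoining one
    element at a time, and each obstruction to lifting lies in degree [j.+1] of some [R / (I' : a)]
    with [I'] above [I]. *)
Lemma vanish_surj j I J u : acc R -> is_ideal I -> is_ideal J -> (forall r, I r -> J r) ->
  (forall I', is_ideal I' -> (forall r, I r -> I' r) -> vanish j.+1 I') ->
  cocycle j J u -> exists2 v, cocycle j I v & coboundary j J (u - v).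
Proof.
move=> hacc hI hJ IJ van uZ.
move: I hI IJ van; apply: (noeth_ind hacc) => I hI IH IJ van.
have [JI|] := pselect (forall r, J r -> I r).
  exists u; first exact: cocycle_mono uZ.
  by rewrite subrr; exact: sbm0 (coboundary_sbm j hJ).
move=> /existsNP[a /not_implyP[Ja nIa]].
have hIa := idl_add hI a.
have IaJ := add_elt_min hJ IJ Ja.
have [|||||v vZ uv] := IH (add_elt I a).
- exact: hIa.
- by move=> r; exact: add_eltW.
- by exists a => //; exact: add_elt_self.
- exact: IaJ.
- by move=> I' hI' II'; apply: van => // r Ir; apply/II'/add_eltW.
have [|v' vZ' vv'] := vanish_right hI _ vZ.
  by apply: van; [exact: idl_colon | move=> r; exact: colonW].
exists v' => //; have -> : u - v' = (u - v) + (v - v') by lin.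
by apply: (sbmD (coboundary_sbm j hJ) uv); exact: coboundary_mono vv'.
Qed.

Lemma vanish_devissage j Q : acc R -> is_ideal Q ->
  (forall P, is_prime P -> (forall r, Q r -> P r) -> vanish j P) -> vanish j Q.
Proof.
move=> hacc hQ H.
apply: (@devissage R (vanish j) Q hacc hQ) => // [I hI I1 u [hu _]|P pP QP _|I a hI _].
- by apply: coboundary_inI => //; exact: inI_top.
- exact: H.
- exact: vanish_mid.
Qed.

(** The exponent is a level [L] from which [u] is a compatible cocycle: there [b ^+ L] is
    null-homotopic, and the homotopy applied to [u L] bounds [b ^+ L *: u] at all later levels. *)
Lemma entry_torsion j I b u : is_ideal I -> b \in x -> cocycle j I u ->
  exists n, coboundary j I (b ^+ n *: u).
Proof.
move=> hI bx [hu [M hM]]; have [N hN] := homog_compat hu.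
set L := maxn M N; exists L.
have [s [sl sh sI sE]] := khomotopy L bx.
have hbu : homog j (b ^+ L *: u) by exact: (sbmZ (homog_sbm j)).
have hs : homog j.-1 (emb L (s (u L))).
  by apply: homog_emb; apply: sh; case: (hN L (leq_maxr _ _)).
split=> //; exists (emb L (s (u L))) => //; exists L => n Ln.
have -> : (b ^+ L *: u - diff (emb L (s (u L)))) n = b ^+ L *: u n - kd n (emb L (s (u L)) n) by [].
rewrite /emb Ln.
have -> : u n = ktau (n - L) (u L).
  rewrite (hN n (leq_trans (leq_maxr _ _) Ln)).2 (hN L (leq_maxr _ _)).2 ktauD.
  by congr ktau; rewrite addnC addnBA ?leq_maxr // subnK.
have := ktau_kd L (n - L) (s (u L)); rewrite subnKC // => <-.
rewrite -linearZ -linearB -sE addrC addKr.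
apply: kin_ktau => //; apply: sI => //; apply: hM; exact: leq_maxl.
Qed.

Lemma homog_max_inI I j u : is_ideal I -> {in x, forall a, I a} -> (1 < j)%N -> homog j u -> inI I u.
Proof.
move=> hI xI j1 [N hN]; exists N.+1 => -[//|n]; rewrite ltnS => /hN[un ->].
exact: ktau_max un.
Qed.

Lemma df_max I u : is_ideal I -> {in x, forall a, I a} -> inI I (diff u).
Proof. by move=> hI xI; exists 1%N => n n0; exact: kd_max. Qed.

Lemma homog1 u : homog 1 u -> exists r, inI (fun r => r = 0) (u - r *: (fun=> kone x)).
Proof.
move=> /homog_compat[N hN]; have [r e] := khomog1 (hN N (leqnn N)).1.
exists r, N => n Nn.
have -> : (u - r *: (fun=> kone x)) n = u n - r *: kone x by [].
rewrite (hN n Nn).2 e linearZ /= ktau_kone subrr.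
apply: (sbm0 (kin_sbm _ _)); split=> // a s t -> ->.
by rewrite mulr0 addr0.
Qed.

Lemma homog_one : homog 1 (fun=> kone x).
Proof. by apply: eventually_all => n; split; [exact: khomog_kone | rewrite ktau_kone]. Qed.

Lemma inI_one I r : is_ideal I -> inI I (r *: (fun=> kone x)) <-> I r.
Proof.
move=> hI; split=> [[N /(_ N (leqnn N))]|Ir]; first exact: (kin_kone x r hI).1.
by apply: eventually_all => n; exact: (kin_kone x r hI).2.
Qed.

(** A top class is one element [r] at one level [N], and membership of [(\prod x)^k c r] in
    [(x^(N+k)) + I] makes its multiple by [c] vanish on [R / I]. Both [N] and [r] are chosen before
    [I] and [c]. *)
Lemma homog_top u : homog (size x).+1 u -> exists N r, forall I c, is_ideal I ->
  (exists k, exists2 v : R^o, v \in seq_mul (seq_pow (N + k) x) R^o &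
     I ((\prod_(a <- x) a) ^+ k * (c * r) - v)) -> coboundary (size x).+1 I (c *: u).
Proof.
move=> hu; have [N hN] := homog_compat hu.
have [r e] := khomog_top (hN N (leqnn N)).1.
exists N, r => I c hI [k [v vx vI]].
have [w hw wE] := ktop_boundary vx.
split; first exact: (sbmZ (homog_sbm _)).
exists (emb (N + k) w); first exact: homog_emb.
exists (N + k)%N => n kn.
have -> : (c *: u - diff (emb (N + k) w)) n = c *: u n - kd n (emb (N + k) w n) by [].
rewrite /emb kn (hN n (leq_trans (leq_addr _ _) kn)).2 e.
have -> : (n - N)%N = (k + (n - (N + k)))%N by rewrite subnDA subnKC // leq_subRL // (leq_trans _ kn) // leq_addr.
have := ktau_kd (N + k) (n - (N + k)) w; rewrite subnKC // => <-.
rewrite -ktauD ktau_ktop wE -linearZ -linearB /=.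
apply: kin_ktau => //.
rewrite -ktopZ mulrCA -ktopB.
exact: kin_ktop.
Qed.
End LimitCohomology.

(** * Minimal primes and the principal ideal theorem *)

Section MinimalPrimes.
Variables (R : comPzRingType) (hacc : acc R).
Implicit Types (I J P Q : R -> Prop).

(** A prime over [I] contains [I + R a] or, if it omits [a], contains [(I : a)]; dévissage thus
    yields a finite list, possibly with primes that are not minimal. *)
Lemma finite_prime_cover I : is_ideal I -> exists n (f : nat -> R -> Prop),
  (forall i, (i < n)%N -> is_prime (f i) /\ forall r, I r -> f i r) /\
  forall P, is_prime P -> (forall r, I r -> P r) ->
    exists2 i, (i < n)%N & forall r, f i r -> P r.
Proof.
move=> hI; pose fin I := exists n (f : nat -> R -> Prop),
  (forall i, (i < n)%N -> is_prime (f i) /\ forall r, I r -> f i r) /\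
  forall P, is_prime P -> (forall r, I r -> P r) ->
    exists2 i, (i < n)%N & forall r, f i r -> P r.
apply: (@devissage R fin I hacc hI) => // {I hI} [I hI I1|P pP _ _|I a hI _].
- exists 0%N, (fun=> I); split=> // P [_ P1 _] IP; by case: P1; apply: IP.
- by exists 1%N, (fun=> P); split=> // P' _ PP'; exists 0%N.
move=> [n [f [fI fP]]] [m [g [gI gP]]].
exists (n + m)%N, (fun i => if (i < n)%N then f i else g (i - n)%N); split.
  move=> i im; case: (ltnP i n) => ni.
    have [pf If] := fI i ni.
    by split=> // r Ir; apply: If; exact: colonW.
  have [|pg Ig] := gI (i - n)%N; first by rewrite ltn_subLR.
  by split=> // r Ir; apply: Ig; exact: add_eltW.
move=> P pP IP; have [Pa|nPa] := pselect (P a).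
  have [i im giP] := gP P pP (add_elt_min (prime_idl pP) IP Pa).
  by exists (n + i)%N; rewrite ?ltn_add2l // ltnNge leq_addr /= addKn.
have [|i ni fiP] := fP P pP.
  by move=> r; rewrite /colon => /IP; case: pP => _ _ h /h[].
by exists i; rewrite ?ni // ltn_addr.
Qed.

Lemma minimal_prime I P : is_ideal I -> is_prime P -> (forall r, I r -> P r) ->
  exists Q, [/\ is_prime Q, forall r, I r -> Q r, forall r, Q r -> P r &
    forall Q', is_prime Q' -> (forall r, I r -> Q' r) -> (forall r, Q' r -> Q r) ->
      forall r, Q r -> Q' r].
Proof.
move=> hI pP IP; have [n [f [fI fP]]] := finite_prime_cover hI.
have [i0 i0n i0P] := fP P pP IP.
pose c (i : 'I_n) := `[< forall r, f i r -> P r >].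
(* The number of members contained in [f i] is a rank for inclusion: among the members inside [P],
   one of least rank is minimal. *)
pose M (i : 'I_n) := #|[pred j : 'I_n | `[< forall r, f j r -> f i r >]]|.
have ci0 : c (Ordinal i0n) by apply/asboolP.
case: (arg_minnP M ci0) => i /asboolP iP imin.
exists (f i); have [pfi Ifi] := fI i (ltn_ord i); split=> // Q' pQ' IQ' Q'i.
have [j jn jQ'] := fP Q' pQ' IQ'.
have ji r : f j r -> f i r by move/jQ'/Q'i.
have /imin Mij : c (Ordinal jn) by apply/asboolP => r /ji /iP.
move=> r fir; apply/jQ'; apply: contrapT => nfjr.
have: (M (Ordinal jn) < M i)%N.
  apply: proper_card; apply/properP; split.
    by apply/fintype.subsetP => k kj; apply: asboolT => s ks; exact: (ji s (asboolW kj s ks)).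
  exists i; first exact: asboolT.
  by apply/negP => /asboolW /(_ r fir).
by rewrite ltnNge Mij.
Qed.

(** If no smaller subfamily suffices, each [f k] has an element [b k] of [Q] that lies in no other
    member; then the sum of [b ord_max] and the product of the others lies in no member at all. *)
Lemma prime_avoidance Q n (f : nat -> R -> Prop) : is_ideal Q -> (0 < n)%N ->
  (forall i, (i < n)%N -> is_prime (f i)) ->
  (forall b, Q b -> exists2 i, (i < n)%N & f i b) ->
  exists2 i, (i < n)%N & forall r, Q r -> f i r.
Proof.
move=> hQ; elim: n f => // -[|n] IHn f _ fP fQ.
  by exists 0%N => // r /fQ[[]].
apply: contrapT => H.
have bumpn k i : (i < n.+1)%N -> (bump k i < n.+2)%N.
  by move=> ni; apply: (@leq_ltn_trans i.+1); rewrite // /bump -add1n leq_add2r leq_b1.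
have ex (k : 'I_n.+2) : exists b, Q b /\ forall i : 'I_n.+2, f i b -> i = k.
  apply: contrapT => Hk; apply: H.
  have [||b Qb|i ni iQ] := IHn (fun i => f (bump k i)).
  - by [].
  - by move=> i ni; apply/fP/bumpn.
  - apply: contrapT => Hb; apply: Hk; exists b; split=> // i fib.
    apply: contrapT => /eqP ik; apply: Hb.
    have [j ij|ik'] := unliftP k i; last by rewrite ik' eqxx in ik.
    exists j; first exact: ltn_ord.
    by move: fib; rewrite ij.
  - by exists (bump k i) => //; apply: bumpn.
have [b hb] := choice ex.
have prodP (F : 'I_n.+1 -> R) P : is_prime P -> P (\prod_i F i) -> exists i, P (F i).
  case=> _ n1 pP; elim/big_rec: _ => [/n1//|i r _ IH /pP[]//]; by exists i.
pose F (i : 'I_n.+1) := b (widen_ord (leqnSn _) i).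
have QF : Q (\prod_i F i).
  by rewrite big_ord_recl; apply: idlMr => //; case: (hb (widen_ord (leqnSn _) ord0)).
have Fi (i : 'I_n.+2) P : (i < n.+1)%N -> is_prime P -> P (b i) -> P (\prod_i F i).
  move=> ni pP Pb; rewrite (bigD1 (Ordinal ni)) //=; apply: (idlMr (prime_idl pP)).
  by rewrite /F; have -> : widen_ord (leqnSn n.+1) (Ordinal ni) = i by apply: val_inj.
have [i ni] := fQ _ (idlD hQ (hb ord_max).1 QF).
set o := Ordinal ni; rewrite -[i]/(val o); move: o => o {i ni} fio.
have pfo := fP o (ltn_ord o).
have covers : f o (b o).
  have [j nj fj] := fQ _ (hb o).1.
  by rewrite -{1}((hb o).2 (Ordinal nj) fj).
have [on|no] := ltnP o n.+1.
  have : f o (b ord_max).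
    rewrite -[b ord_max](addrK (\prod_i F i)); apply: (idlB (prime_idl pfo)) => //.
    exact: (Fi o (f o) on pfo covers).
  by move/((hb ord_max).2 o) => e; move: on; rewrite e ltnn.
have e : o = ord_max by apply: val_inj; apply/eqP; rewrite eqn_leq no -ltnS ltn_ord.
have [i] : exists i, f o (F i).
  apply: prodP => //; rewrite -[\prod_i _](addKr (b ord_max)).
  by apply: (idlD (prime_idl pfo)) => //; apply: (idlN (prime_idl pfo)); rewrite -e.
move/(hb _).2 => /(congr1 val); rewrite e /= => ni.
by have := ltn_ord i; rewrite -ni ltnn.
Qed.
End MinimalPrimes.

(** * Noetherian local rings *)

Definition local_max (R : comPzRingType) (m : R -> Prop) :=
  is_prime m /\ forall r, ~ m r -> exists s, r * s = 1.

Section LocalRings.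
Variables (R : comPzRingType) (hacc : acc R) (m : R -> Prop) (hm : local_max m).
Implicit Types (I J P Q : R -> Prop).

Lemma local_sub I r : is_ideal I -> ~ I 1 -> I r -> m r.
Proof.
move=> hI I1 Ir; apply: contrapT => /(hm.2)[s e]; apply: I1.
by rewrite -e; apply: idlMr.
Qed.

Lemma local_prime_sub P r : is_prime P -> P r -> m r.
Proof. by case=> hP P1 _; exact: local_sub. Qed.

Lemma local_unit b c : m b -> exists s, (1 - c * b) * s = 1.
Proof.
move=> mb; apply: hm.2 => h; have [hI m1 _] := hm.1; apply: m1.
by apply: (idl_subr hI h); exact: idlM.
Qed.

(** Noetherian induction on ideals [K] over [J'] takes the place of generators: if [v] in [J] were
    outside [K], then [J] would lie in [K + R v], and writing [v = r' + s * b] with [s = k + c * v]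
    puts [(1 - c * b) * v] in [K]. *)
Lemma nakayama_acc J J' b : is_ideal J -> is_ideal J' -> m b ->
  (forall r, J r -> exists r' s, [/\ J' r', J s & r = r' + s * b]) ->
  forall r, J r -> J' r.
Proof.
move=> hJ hJ' mb H; pose Pr (K : R -> Prop) := (forall r, J' r -> K r) -> forall r, J r -> K r.
have step K : is_ideal K -> Pr K.
  move: K; apply: (@noeth_ind R Pr hacc) => K hK IH J'K.
  apply: contrapT => /existsNP[v /not_implyP[Jv nKv]].
  have [r' [s [J'r' Js e]]] := H v Jv.
  have JKv : Pr (add_elt K v).
    apply: IH; [exact: idl_add | by move=> r; exact: add_eltW |].
    by exists v => //; exact: add_elt_self.
  have [k Kk [c sE]] := JKv (fun r h => add_eltW v (J'K r h)) s Js.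
  have [t tE] := local_unit c mb.
  apply: nKv; rewrite -[v]mul1r -tE.
  have -> : (1 - c * b) * t * v = t * (v - c * v * b) by ring.
  apply: idlM => //; rewrite {1}e sE.
  have -> : r' + (k + c * v) * b - c * v * b = r' + k * b by ring.
  by apply: (idlD hK); [exact: J'K | exact: idlMr].
exact: step.
Qed.

(** Dévissage with [(I + R a) / I] isomorphic to [R / (I : a)]: the only prime quotient that occurs
    is the residue field, which is simple. *)
Lemma art_quotient Q : is_ideal Q ->
  (forall P, is_prime P -> (forall r, Q r -> P r) -> forall r, m r -> P r) ->
  artinian (fun=> True) (Q : R^o -> Prop).
Proof.
move=> hQ onlym.
apply: (@devissage R (fun I => artinian (fun=> True) (I : R^o -> Prop)) Q hacc hQ) => //.
- by move=> I hI I1; apply: art_trivial => r _; exact: idl1.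
- move=> P pP QP _; apply: art_simple => u v _ _ nPu.
  have [|w uw] := hm.2 u; first by move/(onlym P pP QP).
  exists (v * w); rewrite -[_ *: _]/(v * w * u).
  by rewrite -mulrA (mulrC w) uw mulr1 subrr; exact: idl0 (prime_idl pP).
move=> I a hI _ art1 art2; have hIa := idl_add hI a.
apply: (@art_ext R R^o (fun=> True) (add_elt I a) I) => //.
  by move=> r; exact: add_eltW.
apply: (@art_transfer R R^o R^o (add_elt I a) I (fun=> True) (colon I a)
  (fun u u' => I (u - u' * a))) => //.
- exact: idl_colon.
- by rewrite mul0r subrr; exact: idl0.
- move=> c u u' v v' h k; case: hI => _ hI.
  have -> : c *: u + v - (c *: u' + v') * a = c * (u - u' * a) + (v - v' * a).
    by rewrite -[c *: u]/(c * u) -[c *: u']/(c * u'); ring.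
  exact: hI.
- by move=> u [e Ie [s ->]]; exists s => //; rewrite addrK.
- by move=> u u' _ h k; exact: (idl_subr hI h).
Qed.

(* Krull's principal ideal theorem. The ideals [(a^n + Q0 : b^oo)] become
   stationary modulo [b], hence stationary by Nakayama's lemma, although
   [b ^+ t * a ^+ n] lies in [a^(n+1) R + Q0] for no [t]. *)
Lemma principal_ideal_local Q0 Q1 b :
  is_prime Q0 -> is_prime Q1 -> m b ->
  (forall P, is_prime P -> (forall r, Q0 r -> P r) -> P b -> forall r, m r -> P r) ->
  (forall r, Q0 r -> Q1 r) -> (exists2 a, Q1 a & ~ Q0 a) ->
  forall r, m r -> Q1 r.
Proof.
move=> pQ0 pQ1 mb onlym Q01 [a Q1a nQ0a].
apply: contrapT => nmQ1.
have nQ1b : ~ Q1 b by move=> Q1b; apply: nmQ1; exact: onlym.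
have [hQ0 hQ1] := (prime_idl pQ0, prime_idl pQ1).
pose J n r := exists t s, Q0 (b ^+ t * r - s * a ^+ n).
have hJ n : is_ideal (J n).
  split=> [|c u v [t [s us]] [t' [s' vs]]].
    by exists 0%N, 0; rewrite mulr0 mul0r subrr; exact: idl0.
  exists (t + t')%N, (c * b ^+ t' * s + b ^+ t * s').
  have -> : b ^+ (t + t') * (c * u + v) - (c * b ^+ t' * s + b ^+ t * s') * a ^+ n =
    (c * b ^+ t') * (b ^+ t * u - s * a ^+ n) + b ^+ t * (b ^+ t' * v - s' * a ^+ n).
    by rewrite exprD; ring.
  by apply: (idlD hQ0); exact: idlM.
have Jb n r : J n (r * b) -> J n r.
  by move=> [t [s h]]; exists t.+1, s; rewrite exprSr -mulrA (mulrC b).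
have Jdec n r : J n.+1 r -> J n r.
  by move=> [t [s h]]; exists t, (s * a); rewrite -mulrA -exprS.
have QJ n r : Q0 r -> J n r.
  by move=> Qr; exists 0%N, 0; rewrite mul1r mul0r subr0.
have hart := @art_quotient (add_elt Q0 b) (idl_add hQ0 b).
have [P pP QP|||||T hT] := hart _ (fun n => add_elt (J n) b).
- apply: onlym => //; first by move=> r Qr; apply/QP/add_eltW.
  exact/QP/add_elt_self.
- by move=> t; exact: idl_add (hJ t) _.
- by move=> t; apply: add_elt_min; [exact: idl_add (hJ t) _ | by move=> r /(QJ t); exact: add_eltW | exact: add_elt_self (hJ t) _].
- by [].
- by move=> t r [e /Jdec eJ [s ->]]; exists e => //; exists s.
have stat r : J T r -> J T.+1 r.
  apply: (nakayama_acc (hJ T) (hJ T.+1) mb) => {}r JTr.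
  have [r' Jr' [s e]] := hT T.+1 r (add_eltW b JTr).
  exists r', s; split=> //; apply: Jb.
  have -> : s * b = r - r' by rewrite e; ring.
  by apply: (idlB (hJ T)) => //; exact: Jdec.
have [|t [s]] := stat (a ^+ T); first by exists 0%N, 1; rewrite !mul1r subrr; exact: idl0.
have -> : b ^+ t * a ^+ T - s * a ^+ T.+1 = a ^+ T * (b ^+ t - s * a) by rewrite exprS; ring.
have [_ _ primeQ0] := pQ0; case/primeQ0 => [h|/Q01 h].
  by apply: nQ0a; exact: (prime_exp pQ0 h).
apply: nQ1b; apply: (prime_exp pQ1 (n := t)); apply: (idl_subr hQ1 h); exact: idlM.
Qed.
End LocalRings.

(** * Localization at a prime *)

Lemma of_primeP (R : comPzRingType) (p : prime_ideal R) :
  is_prime (fun r : R => (r : R^o) \in p).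
Proof.
split; [exact: idl_mem | exact/negP/prime_ideal_proper |].
exact: prime_ideal_prime.
Qed.

Section ToPrime.
Variables (R : comPzRingType) (P : R -> Prop) (pP : is_prime P).

Lemma mem_span_prime (r : R^o) : r \in span (P : set R^o) <-> P r.
Proof.
have [hP] := prime_idl pP => hPl; split; last exact: span_gen.
by apply: span_min.
Qed.

Fact to_prime_proper : (1 : R^o) \notin span (P : set R^o).
Proof. by case: pP => _ P1 _; apply/negP => /mem_span_prime. Qed.

Fact to_prime_prime (a b : R) : (a * b : R^o) \in span (P : set R^o) ->
  (a : R^o) \in span (P : set R^o) \/ (b : R^o) \in span (P : set R^o).
Proof.
by case: pP => _ _ h /mem_span_prime/h[] ?; [left | right]; apply/mem_span_prime.
Qed.

Definition to_prime : prime_ideal R := PrimeIdeal to_prime_proper to_prime_prime.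

Lemma mem_to_prime (r : R) : (r : R^o) \in to_prime <-> P r.
Proof. exact: mem_span_prime. Qed.
End ToPrime.

Notation lring p := (locring (prime_compl p)).
Notation lmod p N := (loc (prime_compl p) N).
Notation den p := (denom (prime_compl p)).

Section LocalizedRing.
Variables (R : comPzRingType) (p : prime_ideal R).
Implicit Types (I Q : R -> Prop) (J : lring p -> Prop).

Lemma den_notin (s : den p) : ~ (sval s : R^o) \in p.
Proof. by apply/negP; exact: (svalP s). Qed.

Definition to_den (s : R) (h : ~ (s : R^o) \in p) : den p := exist _ s (introN idP h).

Lemma rfrac_den (a : R) (s : den p) : rfrac a s * to_loc (prime_compl p) (sval s) = to_loc (prime_compl p) a.
Proof. by rewrite /to_loc [LHS]locring_mulE; apply: rfrac_eq => /=; ring. Qed.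

Lemma rfracE (a : R) (s : den p) : rfrac a s = to_loc (prime_compl p) a * rfrac 1 s.
Proof. by rewrite /to_loc [RHS]locring_mulE; apply: rfrac_eq => /=; ring. Qed.

Lemma den_unit (s : den p) : to_loc (prime_compl p) (sval s) * rfrac 1 s = 1.
Proof. by rewrite -rfracE; apply: rfrac_eq => /=; ring. Qed.

Lemma rfrac_eqP (a b : R) (s t : den p) : rfrac a s = rfrac b t <->
  exists2 r : den p, True & sval r * (sval t * a) = sval r * (sval s * b).
Proof.
split=> [/fracP[r rS e]|[r _ e]]; first by exists (exist _ r rS).
by apply/fracP; exists (sval r); [exact: (svalP r) |].
Qed.

Definition contraction J : R -> Prop := fun a => J (to_loc (prime_compl p) a).
Definition extension I : lring p -> Prop :=
  fun z => exists a s, I a /\ z = rfrac a s.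

Lemma con_rfrac J a s : is_ideal J -> J (rfrac a s) <-> contraction J a.
Proof.
move=> hJ; rewrite /contraction; split=> [h|h]; first by rewrite -(rfrac_den a s); exact: idlMr.
by rewrite rfracE; exact: idlMr.
Qed.

Lemma idl_con J : is_ideal J -> is_ideal (contraction J).
Proof.
move=> hJ; split=> [|a u v uJ vJ]; rewrite /contraction.
  have -> : to_loc (prime_compl p) 0 = 0 by [].
  exact: idl0.
rewrite to_locD to_locM; exact: (idlD hJ (idlM hJ _ uJ)).
Qed.

Lemma idl_ext I : is_ideal I -> is_ideal (extension I).
Proof.
move=> hI; split=> [|z u v [a [s [aI ->]]] [b [t [bI ->]]]].
  by exists 0, (denom1 _); split; [exact: idl0|].
elim/rfracW: z => c r.
exists (sval t * (c * a) + sval (denom_mul r s) * b), (denom_mul (denom_mul r s) t); split.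
  by apply: (idlD hI); apply: (idlM hI) => //; apply: (idlM hI).
by rewrite [rfrac c r * _]locring_mulE locring_addE.
Qed.

Lemma ext_rfrac I a s : is_ideal I -> extension I (rfrac a s) <-> exists2 t, ~ (t : R^o) \in p & I (t * a).
Proof.
move=> hI; split=> [[b [t [bI /rfrac_eqP[r _ e]]]]|[t tp taI]].
  exists (sval r * sval t); last by rewrite -mulrA e; do 2! apply: idlM => //.
  exact: (@den_notin (denom_mul r t)).
exists (t * a), (denom_mul (to_den tp) s); split=> //.
by apply: rfrac_eq => /=; ring.
Qed.

Lemma loc_mono J J' : is_ideal J -> is_ideal J' -> (forall a, contraction J a -> contraction J' a) ->
  forall z, J z -> J' z.
Proof.
by move=> hJ hJ' JJ'; elim/rfracW=> a s /(con_rfrac _ _ hJ)/JJ' h; apply/con_rfrac.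
Qed.

Lemma con_prime J : is_prime J -> is_prime (contraction J).
Proof.
move=> [hJ J1 pJ]; split; [exact: idl_con | exact: J1 |].
by move=> a b; rewrite /contraction to_locM => /pJ.
Qed.

Lemma con_sub J a : is_prime J -> contraction J a -> (a : R^o) \in p.
Proof.
move=> [hJ J1 pJ] aJ; apply: contrapT => ap; apply: J1.
by rewrite -(den_unit (to_den ap)); apply: idlMr.
Qed.

Lemma ext_con I a : is_prime I -> (forall r, I r -> (r : R^o) \in p) ->
  contraction (extension I) a <-> I a.
Proof.
move=> [hI I1 pI] Ip; rewrite /contraction /to_loc (ext_rfrac _ _ hI); split=> [[t tp /pI[/Ip|]]//|aI].
exists 1; last by rewrite mul1r.
exact/negP/prime_ideal_proper.
Qed.

Lemma ext_prime I : is_prime I -> (forall r, I r -> (r : R^o) \in p) -> is_prime (extension I).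
Proof.
move=> pI' Ip; have [hI I1 pI] := pI'; have hE := idl_ext hI.
split=> //; first by move/(ext_con 1 pI' Ip).
elim/rfracW=> a s; elim/rfracW=> b t; rewrite [rfrac a s * _]locring_mulE.
move=> /(con_rfrac _ _ hE)/(ext_con _ pI' Ip)/pI[h|h]; [left | right];
  by apply/(con_rfrac _ _ hE)/(ext_con _ pI' Ip).
Qed.

Lemma loc_acc : acc R -> acc (lring p).
Proof.
move=> hacc J hJ inc.
have [||N hN] := hacc (fun n => contraction (J n)).
- by move=> n; exact: idl_con.
- by move=> n r; exact: inc.
- by exists N => n; apply: loc_mono => // a; exact: hN.
Qed.

Definition maxloc : lring p -> Prop := extension (fun r => (r : R^o) \in p).

Lemma con_maxloc a : contraction maxloc a <-> (a : R^o) \in p.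
Proof. exact: (ext_con a (of_primeP p)). Qed.

Lemma loc_local : local_max maxloc.
Proof.
split; first exact: (ext_prime (of_primeP p)).
elim/rfracW=> a s h.
have ap : ~ (a : R^o) \in p by move=> ap; apply: h; exists a, s.
exists (rfrac (sval s) (to_den ap)).
by rewrite [LHS]locring_mulE; apply: rfrac_eq => /=; ring.
Qed.
End LocalizedRing.

Section PrincipalIdeal.
Variables (R : comPzRingType) (hacc : acc R).
Implicit Types (P Q : R -> Prop).

(** After localization at [P], the local version says that [P] cannot be minimal over [Q0 + R b]
    once [Q1] lies properly in between. *)
Lemma principal_ideal P Q0 Q1 b : is_prime P -> is_prime Q0 -> is_prime Q1 -> P b ->
  (forall r, Q0 r -> Q1 r) -> (exists2 a, Q1 a & ~ Q0 a) ->
  (forall r, Q1 r -> P r) -> (exists2 a, P a & ~ Q1 a) ->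
  exists P', [/\ is_prime P', forall r, Q0 r -> P' r, P' b,
    forall r, P' r -> P r & exists2 a, P a & ~ P' a].
Proof.
move=> pP pQ0 pQ1 Pb Q01 [a Q1a nQ0a] Q1P [c Pc nQ1c]; apply: contrapT => H.
pose p := to_prime pP.
have inp Q : (forall r, Q r -> P r) -> forall r, Q r -> (r : R^o) \in p.
  by move=> QP r /QP Pr; apply/mem_to_prime.
have pP' : forall r, (r : R^o) \in p -> P r by move=> r /mem_to_prime.
have Q0p := inp _ (fun r h => Q1P r (Q01 r h)); have Q1p := inp _ Q1P.
have := @principal_ideal_local _ (loc_acc (p := p) hacc) _ (loc_local p) (extension (p := p) Q0) (extension (p := p) Q1)
  (to_loc _ b) (ext_prime pQ0 Q0p) (ext_prime pQ1 Q1p).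
move=> K; apply: nQ1c; apply/(ext_con c pQ1 Q1p); rewrite /contraction; apply: K.
- by apply/con_maxloc/mem_to_prime.
- move=> J pJ QJ Jb; apply: loc_mono => [||r /con_maxloc/pP' Pr].
  + exact: prime_idl (loc_local p).1.
  + exact: prime_idl.
  apply: contrapT => nJr; apply: H; exists (contraction J); split.
  + exact: con_prime.
  + by move=> s Qs; apply: QJ; apply/(ext_con s pQ0 Q0p).
  + exact: Jb.
  + by move=> s /(con_sub pJ)/pP'.
  + by exists r.
- apply: loc_mono; [exact: (idl_ext _ (prime_idl pQ0)) | exact: (idl_ext _ (prime_idl pQ1)) |].
  by move=> r /(ext_con _ pQ0 Q0p)/Q01 h; apply/(ext_con _ pQ1 Q1p).
- exists (to_loc _ a); first by apply/(ext_con a pQ1 Q1p).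
  by move/(ext_con a pQ0 Q0p).
- by apply/con_maxloc/mem_to_prime.
Qed.

(** Suppose all primes strictly between contain [a]. By the principal ideal theorem, each [b] in
    [Q2] outside [Q0] lies in a prime [P] properly inside [Q2] and minimal over [Q0 + R b]; it
    contains [a], and a second use of the theorem shows that it belongs to a finite list of primes
    over [Q0 + R a]. So finitely many primes properly inside [Q2] would cover [Q2]. *)
Lemma prime_between Q0 Q1 Q2 a : is_prime Q0 -> is_prime Q1 -> is_prime Q2 ->
  (forall r, Q0 r -> Q1 r) -> (exists2 c, Q1 c & ~ Q0 c) ->
  (forall r, Q1 r -> Q2 r) -> (exists2 c, Q2 c & ~ Q1 c) -> ~ Q0 a ->
  exists P, [/\ is_prime P, forall r, Q0 r -> P r, exists2 c, P c & ~ Q0 c,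
    forall r, P r -> Q2 r & (exists2 c, Q2 c & ~ P c) /\ ~ P a].
Proof.
move=> pQ0 pQ1 pQ2 Q01 ex01 Q12 ex12 nQ0a; apply: contrapT => H.
have hQ0a := idl_add (prime_idl pQ0) a.
have [n [f [fI fP]]] := finite_prime_cover hacc hQ0a.
have Q0f i : (i < n)%N -> forall r, Q0 r -> f i r.
  by move=> ni r Qr; apply: (fI i ni).2; exact: add_eltW.
have cover b : Q2 b -> ~ Q0 b ->
    exists i, [/\ (i < n)%N, f i b, forall r, f i r -> Q2 r & exists2 c, Q2 c & ~ f i c].
  move=> Q2b nQ0b.
  have [P' [pP' Q0P' P'b P'Q2 [c Q2c nP'c]]] :=
    principal_ideal pQ2 pQ0 pQ1 Q2b Q01 ex01 Q12 ex12.
  have hQ0b := idl_add (prime_idl pQ0) b.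
  have [P [pP Q0P PP' minP]] := minimal_prime hacc hQ0b pP' (add_elt_min (prime_idl pP') Q0P' P'b).
  have Q0P1 r : Q0 r -> P r by move=> h; apply: Q0P; exact: add_eltW.
  have Pb : P b by apply: Q0P; exact: add_elt_self (prime_idl pQ0) b.
  have Pa : P a.
    apply: contrapT => nPa; apply: H; exists P; split=> //; first by exists b.
      by move=> r /PP' /P'Q2.
    by split=> //; exists c => // /PP'.
  have [i ni fiP] := fP P pP (add_elt_min (prime_idl pP) Q0P1 Pa).
  have Pfi r : P r -> f i r.
    move=> Pr; apply: contrapT => nfr.
    have [||P2 [pP2 Q0P2 P2b P2P [d Pd nP2d]]] :=
        principal_ideal pP pQ0 (fI i ni).1 Pb (Q0f i ni) _ fiP.
    - by exists a => //; apply: (fI i ni).2; exact: add_elt_self (prime_idl pQ0) a.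
    - by exists r.
    - by apply: nP2d; apply: minP P2P _ Pd => //; apply: add_elt_min Q0P2 P2b; exact: prime_idl.
  exists i; split=> //; first exact: Pfi.
    by move=> r /fiP /PP' /P'Q2.
  by exists c => // /fiP /PP'.
(* Members of the list not properly inside [Q2] are replaced by [Q0], so that avoidance yields a
   contradiction for each index. *)
pose g i := if `[< (forall r, f i r -> Q2 r) /\ exists2 c, Q2 c & ~ f i c >] then f i else Q0.
have [c2 Q2c2 nQ1c2] := ex12.
have pg i : (i < n)%N -> is_prime (g i) by move=> ni; rewrite /g; case: ifP => // _; exact: (fI i ni).1.
have [i0 [i0n _ _ _]] : exists i, [/\ (i < n)%N, f i c2, forall r, f i r -> Q2 r & exists2 c, Q2 c & ~ f i c].
  by apply: cover => // /Q01.
have [||i ni Q2g] := @prime_avoidance R Q2 n g (prime_idl pQ2) _ pg.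
- exact: leq_ltn_trans i0n.
- move=> b Q2b; have [Q0b|nQ0b] := pselect (Q0 b).
    exists i0 => //; rewrite /g; case: ifP => // _; exact: Q0f.
  have [i [ni fib fiQ2 fic]] := cover b Q2b nQ0b.
  by exists i => //; rewrite /g asboolT.
move: Q2g; rewrite /g; case: asboolP => [[_ [c Q2c nfc]]|_] h.
  exact: nfc (h c Q2c).
exact: nQ1c2 (Q01 _ (h c2 Q2c2)).
Qed.
End PrincipalIdeal.

(** * Cohomological dimension *)

Section CohomologicalDimension.
Variables (R : comPzRingType) (hacc : acc R) (m : R -> Prop) (hm : local_max m).
Variables (x : seq R) (Q : R -> Prop) (hQ : is_ideal Q) (xm : {in x, forall a, m a}).
Hypothesis onlym : forall P, is_prime P -> (forall r, Q r -> P r) ->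
  {in x, forall a, P a} -> forall r, m r -> P r.
Implicit Types (I J P : R -> Prop).
Local Notation cocycle := (@cocycle R x).
Local Notation coboundary := (@coboundary R x).
Local Notation vanish := (@vanish R x).

(** The annihilator of the class of [u] contains [Q] and a power of each entry of [x], so every
    prime over it contains [m]; none omits [c]. *)
Lemma max_torsion j I c u : is_ideal I -> (forall r, Q r -> I r) -> m c -> cocycle j I u ->
  exists n, coboundary j I (c ^+ n *: u).
Proof.
move=> hI QI mc uZ; apply: contrapT => H.
have hB := coboundary_sbm x j hI.
have hA : is_ideal (fun r => coboundary j I (r *: u)).
  split=> [|a r s hr hs]; first by rewrite scale0r; exact: sbm0 hB.
  by rewrite scalerDl -scalerA; case: hB => _; apply.
have [|P [pP AP nPc]] := prime_not_mem (a := c) hA.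
  by move=> n h; apply: H; exists n.
apply: nPc; apply: onlym => // [r Qr|b bx].
  apply/AP/coboundary_inI => //; first by apply: (sbmZ (homog_sbm x j)); case: uZ.
  by apply: inI_scale => //; exact: QI.
by have [n /AP] := entry_torsion hI bx uZ; exact: prime_exp.
Qed.

Lemma coboundary_colon_scale j I a v : is_ideal I -> coboundary j (colon I a) v -> coboundary j I (a *: v).
Proof.
move=> hI [hv [w hw vw]]; split; first exact: (sbmZ (homog_sbm x j)).
exists (a *: w); first exact: (sbmZ (homog_sbm x _)).
by rewrite dfZ -scalerBr; apply/inI_colon.
Qed.

(** For a prime [P] omitting some [c] of [m], Melkersson's criterion leaves the classes killed by
    [c], which the connecting map obtains from [R / (P + R c)]; if [P] contains [m], only the
    residue field in degree 0 remains. Other ideals are extensions through the exact sequence. *)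
Lemma art_cohomology j I : is_ideal I -> (forall r, Q r -> I r) -> artinian (cocycle j I) (coboundary j I).
Proof.
move=> hI QI; move: j.
apply: (@devissage R (fun I => forall j, artinian (cocycle j I) (coboundary j I)) Q hacc hQ) => // {I hI QI}.
- move=> I hI I1 j; apply: art_trivial => u [hu _].
  by apply: coboundary_inI => //; exact: inI_top.
- move=> P pP QP IH j; have hP := prime_idl pP.
  have [mP|/existsNP[c /not_implyP[mc nPc]]] := pselect (forall r, m r -> P r).
    have xP : {in x, forall a, P a} by move=> a /xm /mP.
    case: j => [|[|j]].
    + by apply: art_trivial => u [hu _]; apply: coboundary_inI => //; exact: homog0_inI.
    + apply: art_simple => u v [hu _] [hv _] nBu.
      have [r ur] := homog1 hu; have [s vs] := homog1 hv.
      have zP t : t = 0 -> P t by move=> ->; exact: idl0.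
      have {}ur := inI_mono zP ur; have {}vs := inI_mono zP vs.
      have [|t rt] := hm.2 r.
        move=> /mP Pr; apply: nBu; apply: coboundary_inI => //.
        apply: (sbm_subr (inI_sbm x hP) ur); exact: inI_scale.
      exists (s * t); apply: coboundary_inI => //.
        by apply: (sbmB (homog_sbm x 1)) => //; exact: (sbmZ (homog_sbm x 1)).
      set one := (fun=> kone x) : nat -> kz x.
      have -> : v - (s * t) *: u = (v - s *: one) - (s * t) *: (u - r *: one).
        transitivity ((v - s *: one) - (s * t) *: (u - r *: one) + (s - s * (r * t)) *: one).
          by lin.
        by rewrite rt mulr1 subrr scale0r addr0.
      by apply: (sbmB (inI_sbm x hP) vs); apply: (sbmZ (inI_sbm x hP)).
    + by apply: art_trivial => u [hu _]; apply: coboundary_inI => //; exact: homog_max_inI hu.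
  have cP := prime_colon pP nPc.
  have [hZ hB] := (cocycle_sbm x j hP, coboundary_sbm x j hP).
  apply: (art_torsion (c := c)) => //; first by move=> u; exact: coboundary_Zc.
    by move=> u; exact: max_torsion.
  have hPc := idl_add hP c.
  apply: (@art_transfer R _ _ (fun u => cocycle j P u /\ coboundary j P (c *: u)) (coboundary j P)
    (cocycle j.-1 (add_elt P c)) (coboundary j.-1 (add_elt P c))
    (fun v w => inI P (c *: v - diff w))) => //.
  + exact: cocycle_sbm.
  + exact: coboundary_sbm.
  + by move=> u; exact: coboundary_Zc.
  + by rewrite scaler0 df0 subr0; exact: sbm0 (inI_sbm x hP).
  + move=> a u u' v v' h k.
    have -> : c *: (a *: u + v) - diff (a *: u' + v') = a *: (c *: u - diff u') + (c *: v - diff v').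
      by rewrite df_lin; lin.
    by case: (inI_sbm x hP) => _; apply.
  + by move=> u [uZ cu]; have [|w wZ uw] := exact_left hP _ cu; [rewrite cP | exists w].
  + move=> u w [[hu _] _] uw wB; rewrite -cP; exact: connecting_inj hP hu uw wB.
  + exact: IH.
  + split=> [|a u v [u1 u2] [v1 v2]]; first by rewrite scaler0; split; [exact: sbm0 hZ | exact: sbm0 hB].
    split; first by case: hZ => _; apply.
    have -> : c *: (a *: u + v) = a *: (c *: u) + c *: v by lin.
    by case: hB => _; apply.
move=> I a hI QI IH1 IH2 j; have hIa := idl_add hI a; have hIc := idl_colon hI a.
have [hZ hB] := (cocycle_sbm x j hI, coboundary_sbm x j hI).
have hBa := coboundary_sbm x j hIa.
have hY : is_submodule (fun u => cocycle j I u /\ coboundary j (add_elt I a) u).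
  split=> [|b u v [u1 u2] [v1 v2]]; first by split; [exact: sbm0 hZ | exact: sbm0 hBa].
  by split; [case: hZ => _ | case: hBa => _]; apply.
apply: (@art_ext R _ (cocycle j I) (fun u => cocycle j I u /\ coboundary j (add_elt I a) u) (coboundary j I)) => //.
- move=> u uB; split; first exact: coboundary_Zc.
  by apply: coboundary_mono uB => r; exact: add_eltW.
- by move=> u [].
- apply: (@art_transfer R _ _ (cocycle j I) _ (cocycle j (add_elt I a)) (coboundary j (add_elt I a)) (fun u u' => u = u')) => //.
  + exact: cocycle_sbm.
  + by move=> u; exact: coboundary_Zc.
  + by move=> b u u' v v' -> ->.
  + by move=> u uZ; exists u => //; apply: cocycle_mono uZ => r; exact: add_eltW.
  + by move=> u u' uZ <-.
- apply: (@art_transfer R _ _ (fun u => cocycle j I u /\ coboundary j (add_elt I a) u) _ (cocycle j (colon I a)) (coboundary j (colon I a))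
    (fun u v => coboundary j I (u - a *: v))) => //.
  + exact: cocycle_sbm.
  + exact: coboundary_sbm.
  + by move=> u; exact: coboundary_Zc.
  + by rewrite scaler0 subr0; exact: sbm0.
  + move=> b u u' v v' h k.
    have -> : b *: u + v - a *: (b *: u' + v') = b *: (u - a *: u') + (v - a *: v') by lin.
    by case: hB => _; apply.
  + by move=> u [uZ uB]; have [v vZ uv] := exact_mid hI uZ uB; exists v.
  + move=> u v _ uv /(coboundary_colon_scale hI) vB; exact: (sbm_subr hB uv vB).
Qed.

(* The cohomological dimension of [R / I] is less than [k - 1]. *)
Definition vanish_from I k :=
  forall J, is_ideal J -> (forall r, I r -> J r) -> forall j, (k <= j)%N -> vanish j J.

Lemma vanish_fromW I J k l : (forall r, I r -> J r) -> (k <= l)%N ->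
  vanish_from I k -> vanish_from J l.
Proof.
move=> IJ kl H K hK JK j lj; apply: H => // [r /IJ /JK //|].
exact: leq_trans lj.
Qed.

Lemma vanish_fromPn I k : ~ vanish_from I k -> exists P j,
  [/\ is_prime P, forall r, I r -> P r, (k <= j)%N & ~ vanish j P].
Proof.
move=> H; apply: contrapT => H'; apply: H => J hJ IJ j kj.
apply: (vanish_devissage hacc hJ) => P pP JP; apply: contrapT => nv.
by apply: H'; exists P, j; split=> // r /IJ /JP.
Qed.

Lemma vanish_quotient I J j : is_ideal I -> is_ideal J -> (forall r, I r -> J r) ->
  vanish_from I j.+1 -> vanish j I -> vanish j J.
Proof.
move=> hI hJ IJ vI vj u uZ.
have [|v /vj vB uv] := vanish_surj hacc hI hJ IJ _ uZ.
  by move=> I' hI' II'; apply: vI.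
by apply: (sbm_subr (coboundary_sbm x j hJ) uv); exact: coboundary_mono vB.
Qed.

Lemma max_nonvanish : ~ vanish 1 m.
Proof.
have [hI m1 _] := hm.1.
move=> /(_ (fun=> kone x))[|_ [w hw]].
  by split; [exact: homog_one | exact: df_max].
move=> /(sbm_subr (inI_sbm x hI)) h; apply: m1; apply/(inI_one x _ hI).
by rewrite scale1r; apply: h; apply: inI_df => //; exact: homog0_inI.
Qed.

(** Index 1 is degree 0: a class there is an element of the domain [R / P] killed by a power of [c],
    hence zero. *)
Lemma vanish1_prime P c : is_prime P -> (forall r, Q r -> P r) -> m c -> ~ P c -> vanish 1 P.
Proof.
move=> pP QP mc nPc u uZ; have hP := prime_idl pP.
have [n [_ [w hw uw]]] := max_torsion hP QP mc uZ.
have nPcn : ~ P (c ^+ n) by move/(prime_exp pP).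
apply: coboundary_inI => //; first by case: uZ.
rewrite -(prime_colon pP nPcn); apply/inI_colon.
apply: (sbm_subr (inI_sbm x hP) uw); apply: inI_df => //; exact: homog0_inI.
Qed.

(** Vanishing on [R / (P + R b)] one degree lower makes [b] injective on a [b]-torsion module. *)
Lemma vanish_torsion j P b : is_prime P -> (forall r, Q r -> P r) -> m b -> ~ P b ->
  vanish j.-1 (add_elt P b) -> vanish j P.
Proof.
move=> pP QP mb nPb van u uZ; have hP := prime_idl pP.
have [n] := max_torsion hP QP mb uZ.
elim: n => [|n IHn]; first by rewrite expr0 scale1r.
rewrite exprS -scalerA => h; apply: IHn.
rewrite -(prime_colon pP nPb); apply: (vanish_left hP) => //.
by rewrite (prime_colon pP nPb); exact: (sbmZ (cocycle_sbm x j hP)).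
Qed.

(* The cohomological dimension drops on proper quotients of [R / P]. Let [k]
   be the top degree for [R / P] and suppose that it is also reached on a prime
   [q1] above [P]. The degree [k - 1] is reached on some prime [q2] above [q1],
   hence [k] on every prime strictly between [P] and [q2]. Let [a] generate
   a minimal multiple of the Artinian module [H^k(R/P)]; then [a] kills
   [H^k(R/P')] for all [P'] strictly above [P], whereas it acts surjectively
   if [P'] does not contain [a]. *)
Lemma vanish_from_step P k a : is_prime P -> (forall r, Q r -> P r) ->
  vanish_from P k.+2 -> ~ P a -> vanish_from (add_elt P a) k.+1.
Proof.
move=> pP; move: (pP) k a; apply: (@noeth_ind R (fun P => is_prime P -> forall k a,
  (forall r, Q r -> P r) -> vanish_from P k.+2 -> ~ P a ->
  vanish_from (add_elt P a) k.+1) hacc _ P (prime_idl pP)) => {pP}P hP IH pP k a0 QP vP nPa0.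
apply: contrapT => /vanish_fromPn[q1 [j [pq1 Pq1 kj nv1]]].
have Pq1' r : P r -> q1 r by move=> Pr; apply: Pq1; exact: add_eltW.
have q1a0 : q1 a0 by apply: Pq1; exact: add_elt_self.
have hq1 := prime_idl pq1.
have ej : j = k.+1.
  apply/eqP; rewrite eqn_leq kj andbT leqNgt; apply/negP => jk.
  by apply: nv1; exact: vP.
subst j => {kj}.
have nvP : ~ vanish k.+1 P by move=> v; apply: nv1; exact: vanish_quotient vP v.
have q1m := local_prime_sub hm pq1.
case: k vP nv1 nvP => [|k] vP nv1 nvP.
  by apply: nvP; exact: (vanish1_prime pP QP (q1m _ q1a0)).
have [mq1|/existsNP[b /not_implyP[mb nq1b]]] := pselect (forall r, m r -> q1 r).
  apply: nv1 => u [hu _]; apply: coboundary_inI => //.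
  by apply: (homog_max_inI hq1 _ _ hu) => // r /xm /mq1.
have Qq1 r : Q r -> q1 r by move/QP/Pq1'.
have [q2 [pq2 q1q2 nv2]] : exists q2, [/\ is_prime q2, forall r, add_elt q1 b r -> q2 r & ~ vanish k.+1 q2].
  apply: contrapT => H; apply: nv1; apply: (vanish_torsion pq1 Qq1 mb nq1b).
  apply: (vanish_devissage hacc (idl_add hq1 b)) => q2 pq2 q1q2.
  by apply: contrapT => nv; apply: H; exists q2.
have [hZ hB] := (cocycle_sbm x k.+2 hP, coboundary_sbm x k.+2 hP).
have [|||a nPa amin] := art_min_multiple (S := fun a => ~ P a) hZ hB _ (art_cohomology hP QP).
- by move=> u; exact: coboundary_Zc.
- by case: pP.
- by move=> c d nc nd; case: pP => _ _ h /h[].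
have [|||P' [pP' PP' [b' P'b' nPb'] P'q2 [[c q2c nP'c] nP'a]]] :=
  prime_between hacc pP pq1 pq2 Pq1' _ _ _ nPa.
- by exists a0.
- by move=> r q1r; apply: q1q2; exact: add_eltW.
- by exists b => //; apply: q1q2; exact: add_elt_self.
have hP' := prime_idl pP'; have QP' r : Q r -> P' r by move/QP/PP'.
have IHP' := IH P' hP' PP' (ex_intro2 _ _ b' P'b' nPb') pP'.
have vP' : vanish_from P' k.+3 by exact: vanish_fromW vP.
(* Otherwise the induction hypothesis for [P'] and the element [c] of [q2] would make index [k.+1]
   vanish on [R / q2], against the choice of [q2]. *)
have : ~ vanish_from P' k.+2.
  move=> /(IHP' k c QP') /(_ nP'c) h; apply: nv2; apply: h => //; first exact: prime_idl.
  by apply: add_elt_min => //; exact: prime_idl.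
apply => J hJ P'J j kj.
have [jk|jk] := leqP k.+3 j; first exact: vP'.
have -> : j = k.+2 by apply/eqP; rewrite eqn_leq kj andbT.
apply: (vanish_quotient hP' hJ P'J vP') => u uZ.
(* Lifted to [R / P], the class [a *: v] is a multiple of [a * b'] by minimality, and [b'] lies in
   [P']. *)
have kill v : cocycle k.+2 P' v -> coboundary k.+2 P' (a *: v).
  move=> vZ; have hB' := coboundary_sbm x k.+2 hP'.
  have [|v1 v1Z vv1] := vanish_surj hacc hP hP' PP' _ vZ.
    by move=> I' hI' PI'; exact: vP.
  have [v2 v2Z v12] := amin b' v1 nPb' v1Z.
  have -> : a *: v = a *: (v - v1) + (a *: v1 - (a * b') *: v2) + (a * b') *: v2 by lin.
  apply: (sbmD hB'); first apply: (sbmD hB'); first exact: (sbmZ hB').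
    exact: coboundary_mono v12.
  apply: coboundary_inI => //; first by apply: (sbmZ (homog_sbm x _)); case: v2Z.
  by apply: inI_scale => //; exact: idlM.
have vPa := IHP' k.+1 a QP' vP' nP'a.
have uB : coboundary k.+2 (add_elt P' a) u.
  by apply: vPa => //; [exact: idl_add | apply: cocycle_mono uZ => r; exact: add_eltW].
have [v] := exact_mid hP' uZ uB; rewrite (prime_colon pP' nP'a) => /kill vB uv.
exact: (sbm_subr (coboundary_sbm x _ hP') uv).
Qed.

Lemma vanish_from_size P : vanish_from P (size x).+2.
Proof.
move=> J hJ PJ j sj u [hu _]; apply: coboundary_inI => //; exact: homog_big_inI hu.
Qed.

(** Each strict inclusion lowers the bound by one, down to [R / m], which has cohomology in degree
    0. The two extra units in [n.+2] are the shift of degrees and the strictness of the bound in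
    [vanish_from]. *)
Lemma chain_vanish n (c : nat -> R -> Prop) k :
  (forall i, (i <= n)%N -> is_prime (c i)) -> (forall r, Q r -> c 0%N r) ->
  (forall i, (i < n)%N -> (forall r, c i r -> c i.+1 r) /\ exists2 r, c i.+1 r & ~ c i r) ->
  vanish_from (c 0%N) k -> (n.+2 <= k)%N.
Proof.
elim: n c k => [|n IHn] c k pc Qc inc vc.
  rewrite leqNgt; apply/negP => k2; apply: max_nonvanish; apply: vc => //.
    by case: hm => -[].
  by move=> r; exact: (local_prime_sub hm (pc 0%N _)).
have k2 : (2 <= k)%N.
  rewrite leqNgt; apply/negP => k2; apply: max_nonvanish; apply: vc => //.
    by case: hm => -[].
  by move=> r; exact: (local_prime_sub hm (pc 0%N _)).
case: k k2 vc => [|[|k]] // _ vc; rewrite ltnS.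
have [c01 [a c1a nc0a]] := inc 0%N isT.
apply: (IHn (fun i => c i.+1)).
- by move=> i ni; apply: pc.
- by move=> r /Qc /c01.
- by move=> i ni; apply: inc.
- apply: (vanish_fromW _ (leqnn _) (vanish_from_step (pc 0%N isT) Qc vc nc0a)).
  by apply: add_elt_min => //; exact: prime_idl (pc 1%N isT).
Qed.

(* Krull's height theorem. *)
Lemma chain_length n (c : nat -> R -> Prop) :
  (forall i, (i <= n)%N -> is_prime (c i)) -> (forall r, Q r -> c 0%N r) ->
  (forall i, (i < n)%N -> (forall r, c i r -> c i.+1 r) /\ exists2 r, c i.+1 r & ~ c i r) ->
  (n <= size x)%N.
Proof.
by move=> pc Qc inc; have := chain_vanish pc Qc inc (@vanish_from_size _).
Qed.

(* Grothendieck's nonvanishing theorem. *)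
Lemma top_nonvanish (c : nat -> R -> Prop) a :
  (forall i, (i <= size x)%N -> is_prime (c i)) -> (forall r, Q r -> c 0%N r) ->
  (forall i, (i < size x)%N -> (forall r, c i r -> c i.+1 r) /\ exists2 r, c i.+1 r & ~ c i r) ->
  ~ c 0%N a -> exists n r, forall k (v : R^o), v \in seq_mul (seq_pow (n + k) x) R^o ->
    ~ c 0%N ((\prod_(b <- x) b) ^+ k * (a * r) - v).
Proof.
move=> pc Qc inc nca; apply: contrapT => H.
have pc0 := pc 0%N isT; have hc0 := prime_idl pc0.
suff v0 : vanish (size x).+1 (c 0%N).
  have := chain_vanish pc Qc inc (k := (size x).+1); rewrite ltnn => h.
  suff: false by []; apply: h => J hJ cJ j sj.
  have [jk|jk] := leqP (size x).+2 j; first exact: (@vanish_from_size (c 0%N)).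
  have -> : j = (size x).+1 by apply/eqP; rewrite eqn_leq sj andbT.
  exact: (vanish_quotient hc0 hJ cJ (@vanish_from_size _)).
move=> u uZ.
(* By the assumption to be refuted, [a] annihilates the top cohomology of [R / c 0]; but
   multiplication by [a] is also onto there, as the top cohomology of [R / (c 0 + R a)] vanishes. *)
have kill v : cocycle (size x).+1 (c 0%N) v -> coboundary (size x).+1 (c 0%N) (a *: v).
  move=> [hv _]; have [N [r h]] := homog_top hv; apply: h => //.
  apply: contrapT => H'; apply: H; exists N, r => k w wx cw; apply: H'.
  by exists k, w.
have va := vanish_from_step pc0 Qc (@vanish_from_size _) nca.
have uB : coboundary (size x).+1 (add_elt (c 0%N) a) u.
  by apply: va => //; [exact: idl_add | apply: cocycle_mono uZ => r; exact: add_eltW].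
have [v] := exact_mid hc0 uZ uB; rewrite (prime_colon pc0 nca) => /kill vB uv.
exact: (sbm_subr (coboundary_sbm x _ hc0) uv).
Qed.
End CohomologicalDimension.

(** * Collapsing sequences and supports *)

Section SeqMul.
Variable R : comPzRingType.
Implicit Types (x y : seq R) (N : lmodType R).

Lemma seq_mul_gen y N a (v : N) : a \in y -> a *: v \in seq_mul y N.
Proof. by move=> ay; apply: span_gen; exists a => //; exists v. Qed.

Lemma seq_mul_min y N (A : N -> Prop) : is_submodule A -> (forall a v, a \in y -> A (a *: v)) ->
  forall v, v \in seq_mul y N -> A v.
Proof.
by move=> [A0 AL] Ay; apply: span_min => // _ [a ay [v ->]]; exact: Ay.
Qed.

Lemma seq_mul_sbm y N : is_submodule (fun v : N => v \in seq_mul y N).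
Proof. exact: sbm_mem. Qed.

Lemma seq_mul_scale y N (a : R^o) (v : N) : a \in seq_mul y R^o -> a *: v \in seq_mul y N.
Proof.
apply: (@seq_mul_min y R^o (fun a => a *: v \in seq_mul y N)) => [|b c /(seq_mul_gen (c *: v))].
  split=> [|b c d hc hd]; first by rewrite scale0r; exact: sbm0 (seq_mul_sbm _ _).
  rewrite scalerDl -[(b *: c) *: v]/((b * c) *: v) -scalerA.
  by apply: (sbmD (seq_mul_sbm _ _)) => //; apply: (sbmZ (seq_mul_sbm _ _)).
by rewrite scalerA.
Qed.

Lemma seq_powM n k x : seq_pow n (seq_pow k x) = seq_pow (k * n) x.
Proof. by rewrite /seq_pow -map_comp; apply: eq_map => a /=; rewrite exprM. Qed.

Lemma prod_seq_pow n x : \prod_(a <- seq_pow n x) a = (\prod_(a <- x) a) ^+ n.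
Proof. by rewrite big_map prodrXl. Qed.

Lemma seq_mul_pow_mono m n x N (v : N) : (n <= m)%N ->
  v \in seq_mul (seq_pow m x) N -> v \in seq_mul (seq_pow n x) N.
Proof.
move=> nm; apply: (@seq_mul_min _ N (fun v => v \in seq_mul (seq_pow n x) N)).
  exact: seq_mul_sbm.
move=> _ w /mapP[a ax ->]; rewrite -(subnKC nm) exprD -scalerA.
by apply: seq_mul_gen; exact: map_f.
Qed.

Lemma seq_mul_pow_prod k n x N (v : N) : v \in seq_mul (seq_pow n x) N ->
  (\prod_(a <- x) a) ^+ k *: v \in seq_mul (seq_pow (n + k) x) N.
Proof.
pose A (v : N) := (\prod_(a <- x) a) ^+ k *: v \in seq_mul (seq_pow (n + k) x) N.
apply: (@seq_mul_min _ _ A).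
  split=> [|a u w hu hw]; rewrite /A ?scaler0; first exact: sbm0 (seq_mul_sbm _ _).
  have -> : (\prod_(a <- x) a) ^+ k *: (a *: u + w) =
    a *: ((\prod_(a <- x) a) ^+ k *: u) + (\prod_(a <- x) a) ^+ k *: w by lin.
  by apply: (sbmD (seq_mul_sbm _ _)) => //; apply: (sbmZ (seq_mul_sbm _ _)).
move=> _ w /mapP[a ax ->]; rewrite /A (big_rem a ax) /= exprMn.
have -> : (a ^+ k * (\prod_(b <- rem a x) b) ^+ k) *: (a ^+ n *: w) =
    a ^+ (n + k) *: ((\prod_(b <- rem a x) b) ^+ k *: w).
  by rewrite exprD; lin.
by apply: seq_mul_gen; exact: map_f.
Qed.

(* Equivalent to the vanishing of the top Cech cohomology of [N] with respect
   to [x]. *)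
Definition top_vanish x N := forall n (u : N), exists k,
  (\prod_(a <- x) a) ^+ k *: u \in seq_mul (seq_pow (n + k) x) N.

(** The elements [x_1^n_1 (x_2^n_2 (... x_l^n_l (1 + b_l x_l) ... + b_2 x_2) + b_1 x_1)], the
    multiplicative set that meets the zero ideal whenever the Krull dimension is less than [l]. *)
Fixpoint collapsing x (r : R) : Prop :=
  match x with
  | [::] => r = 1
  | a :: y => exists n s b, collapsing y s /\ r = a ^+ n * (s + b * a)
  end.

Lemma collapsing1 x : collapsing x 1.
Proof.
elim: x => [|a y IHy] //=; exists 0%N, 1, 0; split=> //.
by rewrite mul0r addr0 mul1r.
Qed.

Lemma collapsingM x r s : collapsing x r -> collapsing x s -> collapsing x (r * s).
Proof.
elim: x r s => [|a y IHy] r s /=; first by move=> -> ->; rewrite mulr1.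
move=> [n [u [b [hu ->]]]] [k [v [c [hv ->]]]].
exists (n + k)%N, (u * v), (u * c + b * v + b * c * a); split; first exact: IHy.
by rewrite exprD; ring.
Qed.

(* The primes avoiding [x_1^N (S + R x_1)] omit [x_1] and are strictly
   contained in primes avoiding [S]; iterating from [S = 1] produces chains. *)
Lemma collapsing_chain x (I : R -> Prop) : is_ideal I -> (forall r, I r -> ~ collapsing x r) ->
  exists c : nat -> R -> Prop,
  [/\ forall i, (i <= size x)%N -> is_prime (c i), forall r, I r -> c 0%N r &
      forall i, (i < size x)%N -> (forall r, c i r -> c i.+1 r) /\
        exists2 r, c i.+1 r & ~ c i r].
Proof.
elim: x I => [|a y IHy] I hI IS.
  have [|P pP IP] := prime_over hI; first by move=> I1; exact: (IS 1).
  by exists (fun=> P).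
have [P [pP IP PS]] := prime_avoiding hI (collapsing1 (a :: y)) (@collapsingM (a :: y)) IS.
have nPa : ~ P a.
  move=> Pa; apply: (PS a) => //; exists 1%N, 1, 0; split; first exact: collapsing1.
  by rewrite mul0r addr0 mulr1.
have [|r [e Pe [s ->]] h|c [pc Pc inc]] := IHy (add_elt P a).
- exact: idl_add (prime_idl pP) a.
- apply: (PS _ Pe); exists 0%N, (e + s * a), (- s); split=> //; by ring.
exists (fun i => if i is i'.+1 then c i' else P); split=> // [[|i] //|[_|i] /=]; first exact: pc.
  split; first by move=> r Pr; apply: Pc; exact: add_eltW.
  by exists a => //; apply: Pc; exact: add_elt_self (prime_idl pP) a.
exact: inc.
Qed.

(** Raising all exponents [n_i] to a common [K] turns [r] into [(\prod x)^K] plus multiples of the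
    [x_i^(K+1)]. All large [K] are allowed so that the exponents of head and tail can be matched. *)
Lemma collapsing_pow x r : collapsing x r -> exists k, forall K, (k <= K)%N ->
  exists c : R, ((\prod_(a <- x) a) ^+ K - c * r : R^o) \in seq_mul (seq_pow K.+1 x) R^o.
Proof.
elim: x r => [|a y IHy] r /=.
  move=> ->; exists 0%N => K _; exists 1; rewrite big_nil expr1n mul1r subrr.
  exact: sbm0 (seq_mul_sbm _ _).
move=> [n [s [b [/IHy[k hk] ->]]]]; exists (maxn n k) => K; rewrite geq_max => /andP[nK kK].
have [c hc] := hk K kK; exists (c * a ^+ (K - n)).
pose A (v : R^o) := (a ^+ K *: v : R^o) \in seq_mul (seq_pow K.+1 (a :: y)) R^o.
have hA : A ((\prod_(a <- y) a) ^+ K - c * s).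
  apply: (@seq_mul_min (seq_pow K.+1 y) R^o A _ _ _ hc).
    split=> [|d u w hu hw]; rewrite /A ?scaler0; first exact: sbm0 (seq_mul_sbm _ _).
    have -> : a ^+ K *: (d *: u + w) = d *: (a ^+ K *: u) + a ^+ K *: w by lin.
    by apply: (sbmD (seq_mul_sbm _ _)) => //; apply: (sbmZ (seq_mul_sbm _ _)).
  move=> d v dy; rewrite /A scalerA mulrC -scalerA; apply: seq_mul_gen.
  by rewrite inE dy orbT.
have eK : a ^+ K = a ^+ (K - n) * a ^+ n by rewrite -exprD subnK.
rewrite big_cons exprMn.
have -> : a ^+ K * (\prod_(j <- y) j) ^+ K - c * a ^+ (K - n) * (a ^+ n * (s + b * a)) =
   a ^+ K * ((\prod_(a <- y) a) ^+ K - c * s) - a ^+ K.+1 * (c * b).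
  by rewrite exprSr {3}eK {1 2}eK; ring.
apply: (sbmB (seq_mul_sbm _ _)); first exact: hA.
by apply: (@seq_mul_gen _ R^o (a ^+ K.+1) (c * b)); exact: mem_head.
Qed.

Definition annihilator N : R -> Prop := fun r => forall v : N, r *: v = 0.

Lemma idl_ann N : is_ideal (annihilator N).
Proof.
split=> [v|a r s hr hs v]; first by rewrite scale0r.
by rewrite scalerDl -scalerA hr hs scaler0 addr0.
Qed.

Lemma short_chains_top_vanish x N :
  (forall c : nat -> R -> Prop,
    (forall i, (i <= size x)%N -> is_prime (c i)) -> (forall r, annihilator N r -> c 0%N r) ->
    (forall i, (i < size x)%N -> (forall r, c i r -> c i.+1 r) /\
        exists2 r, c i.+1 r & ~ c i r) -> False) ->
  top_vanish x N.
Proof.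
(* Collapsing the [n.+1]-st powers gives the required exponents, as [n.+1 * k.+1] is at least
   [n + n.+1 * k]. *)
move=> H n u; pose y := seq_pow n.+1 x.
have sy : size y = size x by rewrite size_map.
have [[r rN rc]|nex] := pselect (exists2 r, annihilator N r & collapsing y r); last first.
  have [|c [pc Nc inc]] := @collapsing_chain y _ (idl_ann N).
    by move=> r rN rc; apply: nex; exists r.
  by exfalso; move: pc inc; rewrite sy => pc inc; exact: (H c).
have [k hk] := collapsing_pow rc; have [c hc] := hk k (leqnn k).
exists (n.+1 * k)%N.
apply: (@seq_mul_pow_mono (n.+1 * k.+1)); first by rewrite mulnS leq_add2r.
have := seq_mul_scale u hc; rewrite prod_seq_pow -exprM seq_powM.
by rewrite scalerBl -scalerA rN scaler0 subr0.
Qed.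
End SeqMul.

(** * Finitely generated modules: Nakayama's lemma and quotients isomorphic to ideals *)

Section FiniteModules.
Variables (R : comPzRingType) (N : lmodType R) (N_fin : fin_gen N).

Lemma fg_common (S : R -> Prop) (U : N -> Prop) : is_submodule U -> S 1 ->
  (forall a b, S a -> S b -> S (a * b)) ->
  (forall v, exists2 t, S t & U (t *: v)) -> exists2 t, S t & forall v, U (t *: v).
Proof.
move=> hU S1 SM H; have [s hs] := N_fin.
have [t St tU] : exists2 t, S t & forall v, v \in s -> U (t *: v).
  elim: s {hs} => [|v s [t St tU]]; first by exists 1.
  have [t' St' tU'] := H v; exists (t * t'); first exact: SM.
  move=> w; rewrite inE => /orP[/eqP->|/tU h].
    by rewrite -scalerA; exact: sbmZ.
  by rewrite mulrC -scalerA; exact: sbmZ.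
exists t => // v; apply: (@span_min _ _ _ (fun v => U (t *: v)) _ _ _ v (hs v)) => // [|a u w hu hw]; first by rewrite scaler0; exact: sbm0.
have -> : t *: (a *: u + w) = a *: (t *: u) + t *: w by lin.
by case: hU => _; apply.
Qed.

(** Induction on the generators: the first one is a combination with its own coefficient in [m],
    hence redundant. *)
Lemma nakayama (m : R -> Prop) (y : seq R) : local_max m -> {in y, forall a, m a} ->
  (forall v : N, v \in seq_mul y N) -> forall v : N, v = 0.
Proof.
move=> hm ym yN; have [s hs] := N_fin; have hI := prime_idl hm.1.
elim: s hs => [|u s IHs] hs.
  move=> v; apply: (@span_min _ _ _ (fun v => v = 0) _ _ _ v (hs v)) => // a w z -> ->.
  by rewrite scaler0 addr0.
apply: IHs; pose U v := v \in span [set` s]%classic.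
have hU : is_submodule U by exact: sbm_mem.
have gen v : exists a w, U w /\ v = a *: u + w.
  apply: (@span_min _ _ _ (fun v => exists a w, U w /\ v = a *: u + w) _ _ _ v (hs v)) => [|b v1 v2 [a1 [w1 [U1 ->]]] [a2 [w2 [U2 ->]]]|w /=].
  - by exists 0, 0; split; [exact: sbm0 hU | rewrite scale0r addr0].
  - exists (b * a1 + a2), (b *: w1 + w2); split; first by case: hU => _; apply.
    by lin.
  - rewrite inE => /orP[/eqP->|ws].
      by exists 1, 0; split; [exact: sbm0 hU | rewrite scale1r addr0].
    by exists 0, w; split; [exact: span_gen | rewrite scale0r add0r].
have [a [w [ma Uw e]]] : exists a w, [/\ m a, U w & u = a *: u + w].
  pose A v := exists a w, [/\ m a, U w & v = a *: u + w].
  apply: (@seq_mul_min R y N A _ _ _ (yN u)).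
    split=> [|b v1 v2 [a1 [w1 [m1 U1 ->]]] [a2 [w2 [m2 U2 ->]]]].
      by exists 0, 0; split; [exact: idl0 hI | exact: sbm0 hU | rewrite scale0r addr0].
    exists (b * a1 + a2), (b *: w1 + w2); split; last by lin.
      by case: hI => _; apply.
    by case: hU => _; apply.
  move=> b v /ym mb; have [a [w [Uw ->]]] := gen v.
  exists (b * a), (b *: w); split; [exact: (idlMr hI) | exact: (sbmZ hU) | by lin].
have [t te] := local_unit hm 1 ma.
have Uu : U u.
  rewrite -[u]scale1r -te mul1r mulrC -scalerA; apply: (sbmZ hU).
  by rewrite scalerBl scale1r {1}e addrAC subrr add0r.
move=> v; have [b [z [Uz ->]]] := gen v.
by apply: (sbmD hU) => //; apply: (sbmZ hU).
Qed.

(* If [N] is supported at the prime [P], a nonzero ideal of [R / P] is a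
   quotient of [N]; the map is the relation [F]. *)
Lemma ideal_quotient (P : R -> Prop) : is_prime P -> (forall r, annihilator N r -> P r) ->
  exists (F : N -> R -> Prop) (u : N) (c : R),
    [/\ F 0 0, forall b v r w s, F v r -> F w s -> F (b *: v + w) (b * r + s),
      forall v r s, F v r -> F v s -> P (r - s), forall v, exists r, F v r &
      F u c /\ ~ P c].
Proof.
move=> pP annP; have [hP P1 pr] := pP; have [gs hgs] := N_fin.
have nPM a b : ~ P a -> ~ P b -> ~ P (a * b) by move=> na nb /pr[].
pose tors (U : N -> Prop) (v : N) := exists2 c, ~ P c & U (c *: v).
have htors (U : N -> Prop) : is_submodule U -> is_submodule (tors U).
  move=> hU; split=> [|a v w [c nc cv] [d nd dw]].
    by exists 1 => //; rewrite scaler0; exact: sbm0.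
  exists (c * d); first exact: nPM.
  have -> : (c * d) *: (a *: v + w) = (a * d) *: (c *: v) + c *: (d *: w) by lin.
  by apply: (sbmD hU); exact: sbmZ.
pose sp (s : seq N) v := v \in span [set` s]%classic.
have hsp s : is_submodule (sp s) by exact: sbm_mem.
pose full s := forall v, tors (sp s) v.
(* Generators are dropped until the rest no longer span [N] up to multipliers outside [P]; together
   with the last one dropped, [u], they still do. *)
have [s [u [nfull full']]] : exists s u, ~ full s /\ full (u :: s).
  have : full gs by move=> v; exists 1 => //; rewrite scale1r; exact: hgs.
  have : ~ full [::].
    move=> H; have [] := @fg_common (fun a => ~ P a) (fun v => v = 0) _ P1 nPM.
    - by split=> // a v w -> ->; rewrite scaler0 addr0.
    - move=> v; have [c nc cv] := H v; exists c => //.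
      apply: (@span_min _ _ _ (fun v => v = 0) _ _ _ _ cv) => // a w z -> ->; by rewrite scaler0 addr0.
    - by move=> t nt tN; apply: nt; apply: annP.
  elim: gs {hgs} => [//|u s IHs] n0 fu.
  have [fs|nfs] := pselect (full s); first exact: IHs.
  by exists s, u.
pose W := tors (sp s); have hW : is_submodule W by exact: htors.
have Wsat c v : ~ P c -> W (c *: v) -> W v.
  move=> nc [d nd h]; exists (d * c); first exact: nPM.
  by rewrite -scalerA.
have gen v : sp (u :: s) v -> exists a w, W w /\ v = w + a *: u.
  apply: (@span_min _ _ _ (fun v => exists a w, W w /\ v = w + a *: u)).
  - by exists 0, 0; split; [exact: sbm0 hW | rewrite scale0r addr0].
  - move=> b v1 v2 [a1 [w1 [U1 ->]]] [a2 [w2 [U2 ->]]].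
    exists (b * a1 + a2), (b *: w1 + w2); split; first by case: hW => _; apply.
    by lin.
  - move=> w /=; rewrite inE => /orP[/eqP->|ws].
      by exists 1, 0; split; [exact: sbm0 hW | rewrite scale1r add0r].
    exists 0, w; split; last by rewrite scale0r addr0.
    by exists 1 => //; rewrite scale1r; exact: span_gen.
have nWu : ~ W u.
  move=> Wu; apply: nfull => v; have [c nc /gen[a [w [Ww e]]]] := full' v.
  by apply: (Wsat c) => //; rewrite e; apply: (sbmD hW) => //; exact: (sbmZ hW).
have [c nc cN] := @fg_common (fun a => ~ P a) (fun v => sp (u :: s) v) (hsp _) P1 nPM full'.
(* In [c *: v = w + r *: u] the coefficient [r] is determined modulo [P], since [W] is saturated and
   omits [u]; the image of [u] is [c]. *)
exists (fun v r => exists2 w, W w & c *: v = w + r *: u), u, c; split.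
- by exists 0; [exact: sbm0 hW | rewrite scaler0 scale0r addr0].
- move=> b v r w t [v1 Wv1 e1] [w1 Ww1 e2]; exists (b *: v1 + w1).
    by case: hW => _; apply.
  have -> : c *: (b *: v + w) = b *: (c *: v) + c *: w by lin.
  by rewrite e1 e2; lin.
- move=> v r t [v1 Wv1 e1] [w1 Ww1 e2]; apply: contrapT => nrt; apply: nWu.
  apply: (Wsat _ _ nrt); have -> : (r - t) *: u = w1 - v1.
    by apply/eqP; rewrite -subr_eq0; apply/eqP; transitivity ((v1 + r *: u) - (w1 + t *: u));
      [lin | rewrite -e1 -e2 subrr].
  exact: (sbmB hW).
- by move=> v; have [a [w [Ww e]]] := gen _ (cN v); exists a, w.
- by split=> //; exists 0; [exact: sbm0 hW | rewrite add0r].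
Qed.

(** Vanishing on [N], applied to [r *: u] and carried to [R / P] by [F], would put [(\prod x)^k c r]
    in [(x^(n+k)) + P]. The image of [N] is only an ideal of [R / P], which is why nonvanishing is
    required for multiples [a * r]. *)
Lemma top_nonvanish_module (P : R -> Prop) x : is_prime P -> (forall r, annihilator N r -> P r) ->
  (forall a, ~ P a -> exists n r, forall k (v : R^o), v \in seq_mul (seq_pow (n + k) x) R^o ->
    ~ P ((\prod_(b <- x) b) ^+ k * (a * r) - v)) -> ~ top_vanish x N.
Proof.
move=> pP NP H tv; have [F [u [c [F0 FL Funiq Ftot [Fuc nPc]]]]] := ideal_quotient pP NP.
have FZ b v r : F v r -> F (b *: v) (b * r).
  by move=> h; rewrite -[b *: v]addr0 -[b * r]addr0; exact: FL.
have [n [r nv]] := H c nPc; have [k hk] := tv n (r *: u).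
have [a Fa ax] : exists2 a : R^o, F ((\prod_(b <- x) b) ^+ k *: (r *: u)) a & a \in seq_mul (seq_pow (n + k) x) R^o.
  pose A v := exists2 a : R^o, F v a & a \in seq_mul (seq_pow (n + k) x) R^o.
  apply: (@seq_mul_min _ _ _ A _ _ _ hk).
    split=> [|b v w [a Fa ax] [a' Fa' ax']]; first by exists 0 => //; exact: sbm0 (seq_mul_sbm _ _).
    exists (b *: a + a'); first exact: FL.
    by case: (seq_mul_sbm (seq_pow (n + k) x) R^o) => _; apply.
  move=> b v bx; have [s Fs] := Ftot v; exists (b *: (s : R^o)); first exact: FZ.
  exact: seq_mul_gen.
apply: (nv k a ax); apply: Funiq Fa; rewrite (mulrC c).
exact: (FZ _ _ _ (FZ _ _ _ Fuc)).
Qed.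
End FiniteModules.

(** * Top Cech cohomology *)

Lemma frac0P (R : comPzRingType) (S : mulrClosed R) (N : lmodType R) (u : N) (s : denom S) :
  frac u s = 0 <-> exists2 r, r \in S & r *: u = 0.
Proof.
split=> [/fracP[r rS]|[r rS ru]].
  by rewrite scaler0 scaler0 scale1r => ru; exists r.
by apply/fracP; exists r => //; rewrite !scaler0 scale1r.
Qed.

Section TensorLemmas.
Variables (R : comPzRingType).

(** The universal property for balanced biadditive maps, by which equations between tensors are
    brought back to modules. *)
Lemma tensor_lift (A B : lmodType R) (G : zmodType) (beta : A -> B -> G) :
  (forall a a' b, beta (a + a') b = beta a b + beta a' b) ->
  (forall a b b', beta a (b + b') = beta a b + beta a b') ->
  (forall r a b, beta (r *: a) b = beta a (r *: b)) ->
  exists f : tensor A B -> G, f 0 = 0 /\ forall a b, f (tens a b) = beta a b.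
Proof.
move=> bDl bDr bZ; pose f s := \sum_(p <- s) beta p.1 p.2.
have fP s t : tens_rel s t -> f s = f t.
  elim=> {s t} [//|s t _ ->//|s t u _ -> _ ->//|s s' t t' _ e _ e'|s t|a a' b|a b b'|r a b|b];
    rewrite /f ?big_cat ?big_cons ?big_nil /= ?addr0 //.
  - by rewrite -/(f s) -/(f t) e e'.
  - by rewrite addrC.
  - by have := bDl 0 0 b; rewrite addr0 => /(congr1 (fun z => z - beta 0 b)); rewrite addrK subrr.
exists (fun t => f (repr t)); split.
  by rewrite (fP _ [::]) /f ?big_nil //; exact: (tens_repr (A := A) (B := B) [::]).
by move=> a b; rewrite (fP _ [:: (a, b)]) /f ?big_cons ?big_nil ?addr0 //; exact: tens_repr.
Qed.

Lemma tens0r (A B : lmodType R) (a : A) : tens a (0 : B) = 0.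
Proof. by rewrite -(scale0r (0 : B)) tensZr scale0r. Qed.

Lemma tensNr (A B : lmodType R) (a : A) (b : B) : tens a (- b) = - tens a b.
Proof. by rewrite -scaleN1r tensZr scaleN1r. Qed.

Lemma tensor_zero (A B : lmodType R) (t : tensor A B) : (forall b : B, b = 0) -> t = 0.
Proof.
move=> B0; elim/tensW: t => [//|a b|p q -> ->]; last by rewrite addr0.
by rewrite (B0 b) tens0r.
Qed.

Lemma tensor_regular (B : lmodType R) (t : tensor R^o B) : exists b, t = tens (1 : R^o) b.
Proof.
elim/tensW: t => [|a b|p q [b ->] [c ->]].
- by exists 0; rewrite tens0r.
- by exists (a *: b); rewrite tensZr -tensZl; congr tens; exact: (esym (mulr1 (a : R))).
- by exists (b + c); rewrite tensDr.
Qed.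

Variable a : R.
Local Notation L := (locring (powers a)).

Definition pow_den n : denom (powers a) :=
  exist _ (a ^+ n) (asboolT (ex_intro (fun k => a ^+ n = a ^+ k) n erefl)).

Definition ipow n : L := rfrac 1 (pow_den n).

Lemma scale_rfrac r b (s : denom (powers a)) : r *: (rfrac b s : L) = rfrac (r * b) s.
Proof.
by rewrite -[r *: _]/(to_loc _ r * rfrac b s) [LHS]locring_mulE; apply: rfrac_eq => /=; ring.
Qed.

Lemma ipow_shift n k : a ^+ k *: ipow (n + k) = ipow n.
Proof. by rewrite scale_rfrac; apply: rfrac_eq; rewrite /= exprD; ring. Qed.

Lemma to_loc_ipow n : to_loc (powers a) 1 = a ^+ n *: ipow n.
Proof. by rewrite scale_rfrac; apply: rfrac_eq => /=; ring. Qed.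

Lemma locring_ipow (z : L) : exists r n, z = r *: ipow n.
Proof.
elim/rfracW: z => b [s sa]; have [n e] := asboolW sa.
by exists b, n; rewrite scale_rfrac; apply: rfrac_eq; rewrite /= e; ring.
Qed.

Lemma tensor_powers (B : lmodType R) (t : tensor L B) : exists n b, t = tens (ipow n) b.
Proof.
elim/tensW: t => [|z b|p q [n [b ->]] [k [c ->]]].
- by exists 0%N, 0; rewrite tens0r.
- by have [r [n ->]] := locring_ipow z; exists n, (r *: b); rewrite tensZr -tensZl.
- exists (n + k)%N, (a ^+ k *: b + a ^+ n *: c).
  by rewrite tensDr !tensZr -!tensZl ipow_shift addnC ipow_shift.
Qed.

Lemma tens_ipow_eq0 (B : lmodType R) n (b : B) : tens (ipow n) b = 0 ->
  exists k, a ^+ k *: b = 0.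
Proof.
have [|||f [f0 fE]] := @tensor_lift L B (loc (powers a) B) (fun z b => loc_scale z (frac b (denom1 _))).
- by move=> z w c; exact: loc_scaleDl.
- move=> z c d; rewrite -[in RHS](loc_scaleDr z); congr loc_scale.
  by rewrite fracD; apply: frac_eq; rewrite /= !scale1r mulr1 scale1r.
- move=> r z c; elim/rfracW: z => d s; rewrite scale_rfrac !loc_scaleE.
  by apply: frac_eq; rewrite !scalerA; congr (_ *: _); ring.
move=> /(congr1 f); rewrite f0 fE loc_scaleE => /frac0P[r /asboolW[k ->]].
by rewrite scale1r; exists k.
Qed.
End TensorLemmas.

Section TopCech.
Variables (R : comPzRingType) (M : lmodType R).

(** The fraction [u / (x_1 ... x_l)^n] in the top Cech module, which is the localization of [M] at
    [x_1 ... x_l]. *)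
Fixpoint cech_top (x : seq R) (n : nat) (u : M) : cech M x (size x) :=
  match x with
  | [::] => u
  | a :: y => (0, tens (ipow a n) (cech_top y n u))
  end.

Lemma cech_top_lin x n a u v : cech_top x n (a *: u + v) = a *: cech_top x n u + cech_top x n v.
Proof.
elim: x => [|b y IHy] //=; rewrite IHy tensDr tensZr.
by apply: pair_eq => //=; rewrite scaler0 addr0.
Qed.

Lemma cech_topZ x n a u : cech_top x n (a *: u) = a *: cech_top x n u.
Proof.
elim: x => [|b y IHy] //=; rewrite IHy tensZr.
by apply: pair_eq => //=; rewrite scaler0.
Qed.

Lemma cech_top_shift x n k u :
  cech_top x (n + k) ((\prod_(a <- x) a) ^+ k *: u) = cech_top x n u.
Proof.
elim: x u => [|b y IHy] u /=; first by rewrite big_nil expr1n scale1r.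
by rewrite big_cons exprMn mulrC -scalerA IHy cech_topZ tensZr -tensZl ipow_shift.
Qed.

Lemma cech_big x j (z : cech M x j) : (size x < j)%N -> z = 0.
Proof.
elim: x j z => [|a y IHy] [|j] //= z sj.
  by apply/rowP => -[].
apply: pair_eq; apply: tensor_zero => b; apply: IHy => //.
exact: ltnW.
Qed.

Lemma cech_top_surj x (z : cech M x (size x)) : exists n u, z = cech_top x n u.
Proof.
elim: x z => [|a y IHy] /= z; first by exists 0%N, z.
have [n [b e]] := tensor_powers z.2; have [k [u eb]] := IHy b.
exists (n + k)%N, ((\prod_(c <- y) c) ^+ n *: (a ^+ k *: u)); apply: pair_eq => /=.
  by apply: tensor_zero => c; exact: cech_big.
by rewrite addnC cech_top_shift cech_topZ tensZr -tensZl addnC ipow_shift e eb.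
Qed.

Lemma coboundaries_sbm (C : cochain_complex R) n : is_submodule (fun z => z \in coboundaries C n).
Proof. exact: sbm_mem. Qed.

Lemma cech_topB x n u v : cech_top x n (u - v) = cech_top x n u - cech_top x n v.
Proof. by rewrite addrC -scaleN1r cech_top_lin scaleN1r addrC. Qed.

Lemma in_coboundaries (C : cochain_complex R) n (w : C n) : cochain_d C n w \in coboundaries C n.+1.
Proof. by apply/asboolP; exists w. Qed.

Lemma cech_top_coboundary_pow x n (v : M) : v \in seq_mul (seq_pow n x) M ->
  cech_top x n v \in coboundaries (cech M x) (size x).
Proof.
elim: x v => [|a y IHy] v.
  pose A v := cech_top [::] n v \in coboundaries (cech M [::]) 0.
  apply: (@seq_mul_min R _ M A) => //; split; first exact: sbm0 (coboundaries_sbm _ 0).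
  by move=> r u w hu hw; rewrite /A cech_top_lin; case: (coboundaries_sbm (cech M [::]) 0) => _; apply.
pose A v := cech_top (a :: y) n v \in coboundaries (cech M (a :: y)) (size y).+1.
apply: (@seq_mul_min R _ M A).
  split=> [|r u w hu hw]; rewrite /A.
    rewrite -(scale0r 0) cech_topZ scale0r; exact: sbm0 (coboundaries_sbm (cech M (a :: y)) _).
  by rewrite cech_top_lin; case: (coboundaries_sbm (cech M (a :: y)) (size y).+1) => _; apply.
move=> b w; rewrite inE => /orP[/eqP->|by_]; rewrite /A.
  have e : cech_top (a :: y) n (a ^+ n *: w) = (0, tens (to_loc (powers a) 1) (cech_top y n w)).
    by rewrite /= cech_topZ tensZr -tensZl -to_loc_ipow.
  rewrite e; case: y {IHy A e} => [|c y].
    apply/asboolP; exists (tens (1 : R^o) (cech_top [::] n w)) => //.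
    apply: pair_eq => /=; last by rewrite tens_mapE.
    by apply: tensor_zero => z; exact: (@cech_big [::] 1).
  apply/asboolP; exists (tens (1 : R^o) (cech_top (c :: y) n w), 0) => //.
  apply: pair_eq => /=; last by rewrite tens_mapE linear0 subr0.
  by apply: tensor_zero => z; exact: (@cech_big (c :: y) (size y).+2 z (ltnSn _)).
case: y by_ IHy {A} => [//|c y] by_ IHy.
have /asboolP[z _ ez] := IHy (b *: w) (seq_mul_gen w by_).
apply/asboolP; exists (0, - tens (ipow a n) z) => //.
apply: pair_eq => /=; first by rewrite linear0.
rewrite linear0 sub0r linearN opprK -[RHS]/(tens _ (cech_top (c :: y) n (b *: w))) -ez.
exact: tens_mapE.
Qed.

(** One shape for both forms of the last differential: for empty [y] no differential enters degree
    0, and [w] is zero. *)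
Lemma cech_coboundary_form a y (z : cech M (a :: y) (size y).+1) :
  z \in coboundaries (cech M (a :: y)) (size y).+1 ->
  exists (c : cech M y (size y)) k (w : cech M y (size y)),
    w \in coboundaries (cech M y) (size y) /\
    z.2 = tens (to_loc (powers a) 1) c - tens (ipow a k) w.
Proof.
case: y z => [|b y] z /asboolP[v _ <-].
  have [c ->] := tensor_regular (v : tensor R^o M); exists c, 0%N, 0; split.
    exact: sbm0 (coboundaries_sbm (cech M [::]) 0).
  by rewrite /= tens_mapE tens0r subr0.
case: v => v1 v2; have [c ->] := tensor_regular v1.
have [k [w ->]] := tensor_powers v2.
exists c, k, (cochain_d (cech M (b :: y)) (size y) w); split; first exact: in_coboundaries.
by rewrite /= !tens_mapE.
Qed.

(** Clearing the powers of [a] in the boundary equation leaves an equation in the top Cech module of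
    [y]; with [c] written as a fraction of the same level as [u], the induction hypothesis applies
    to a combination of the two numerators. *)
Lemma cech_top_coboundary x n (u : M) :
  cech_top x n u \in coboundaries (cech M x) (size x) ->
  exists k, (\prod_(a <- x) a) ^+ k *: u \in seq_mul (seq_pow (n + k) x) M.
Proof.
elim: x n u => [|a y IHy] n u.
  move=> /asboolP[v _ /= <-]; exists 0%N; rewrite scaler0; exact: sbm0 (seq_mul_sbm _ _).
move=> /cech_coboundary_form[c [k [w [wB e]]]].
have : tens (ipow a (n + k)) (a ^+ k *: cech_top y n u - a ^+ (n + k) *: c + a ^+ n *: w) = 0.
  rewrite !tensDr tensNr !tensZr -!tensZl -to_loc_ipow ipow_shift addnC ipow_shift.
  by rewrite -[tens _ (cech_top y n u)]/(cech_top (a :: y) n u).2 e; lin.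
move=> /tens_ipow_eq0[j]; have [p [v ->]] := cech_top_surj c.
rewrite -(cech_top_shift y n p u) -[in cech_top y p v](cech_top_shift y p n v) (addnC p) => E.
have [q hq] : exists q, (\prod_(a <- y) a) ^+ q *:
    (a ^+ (j + k) *: ((\prod_(a <- y) a) ^+ p *: u) -
     a ^+ (j + (n + k)) *: ((\prod_(a <- y) a) ^+ n *: v)) \in seq_mul (seq_pow (n + p + q) y) M.
  apply: IHy; rewrite cech_topB !(cech_topZ _ _ (a ^+ _)).
  have -> : a ^+ (j + k) *: cech_top y (n + p) ((\prod_(a <- y) a) ^+ p *: u) -
     a ^+ (j + (n + k)) *: cech_top y (n + p) ((\prod_(a <- y) a) ^+ n *: v) = - (a ^+ (j + n) *: w).
    apply/eqP; rewrite -subr_eq0 opprK -[X in _ == X]E; apply/eqP.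
    by rewrite !exprD; lin.
  apply: (sbmN (coboundaries_sbm _ _)); exact: (sbmZ (coboundaries_sbm _ _)).
set Y := \prod_(a <- y) a in hq *.
(* The power of [a] needed is [j + k], that of [Y] is [p + q]; the sum serves for both. *)
exists (j + k + (p + q))%N; rewrite big_cons -/Y.
have incl (z : M) l : z \in seq_mul (seq_pow l y) M -> z \in seq_mul (seq_pow l (a :: y)) M.
  apply: (@seq_mul_min _ _ M (fun z => z \in seq_mul (seq_pow l (a :: y)) M)).
    exact: seq_mul_sbm.
  by move=> b z' by_; apply: seq_mul_gen; rewrite inE by_ orbT.
have -> : (a * Y) ^+ (j + k + (p + q)) *: u =
    a ^+ (p + q) *: (Y ^+ (j + k) *: (Y ^+ q *: (a ^+ (j + k) *: (Y ^+ p *: u) -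
       a ^+ (j + (n + k)) *: (Y ^+ n *: v)))) +
    a ^+ (n + (j + k + (p + q))) *: (Y ^+ (j + k + q + n) *: v).
  by rewrite exprMn !exprD; lin.
apply: (sbmD (seq_mul_sbm _ _)); last by apply: seq_mul_gen; exact: mem_head.
apply: (sbmZ (seq_mul_sbm _ _)); apply: incl.
have := seq_mul_pow_prod (j + k) hq.
by have -> : (n + p + q + (j + k) = n + (j + k + (p + q)))%N by rewrite -!addnA; congr addn; rewrite addnA [RHS]addnA addnC.
Qed.

Lemma local_top_cech (p : prime_ideal R) x :
  (exists h : lmod p (cohomology (cech M x) (size x)), h <> 0) <->
  exists z : cech M x (size x), forall s : R, ~ (s : R^o) \in p ->
    ~ s *: z \in coboundaries (cech M x) (size x).
Proof.
split=> [[h]|[z hz]].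
  elim/fracW: h => h s; elim/quot_classW: h => z h0.
  exists (val z) => t tp tz; apply: h0; apply/frac0P; exists t; first exact/negP.
  apply/esym; rewrite -linearZ -[0](linear0 (quot_class _)); apply/quot_classE.
  by rewrite sub0r -scaleN1r; apply: rpredZ; rewrite unfold_in linearZ.
have dz : z \in lin_ker (cochain_d (cech M x) (size x)).
  by apply/eqP; exact: cech_big.
pose z' : submod_type (lin_ker (cochain_d (cech M x) (size x))) := Sub z dz.
exists (frac (quot_class (restrict _ (coboundaries (cech M x) (size x))) z') (denom1 _)).
move=> /frac0P[r rp]; rewrite -linearZ -[0](linear0 (quot_class _)) => /quot_classE.
rewrite subr0 => h; apply: (hz r); first exact/negP.
by move: h; rewrite unfold_in linearZ.
Qed.

(** Top Cech cohomology is the direct limit of the [M / (x^n) M] under multiplication by [\prod x];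
    localization at [p] contributes the multiplier [s]. *)
Lemma local_top_cechP (p : prime_ideal R) x :
  ~ (exists h : lmod p (cohomology (cech M x) (size x)), h <> 0) <->
  forall n (u : M), exists k (s : R), ~ (s : R^o) \in p /\
    s *: ((\prod_(a <- x) a) ^+ k *: u) \in seq_mul (seq_pow (n + k) x) M.
Proof.
split=> [H n u|H].
  apply: contrapT => H'; apply: H; apply/local_top_cech; exists (cech_top x n u) => s sp.
  rewrite -cech_topZ => /cech_top_coboundary[k hk]; apply: H'; exists k, s; split=> //.
  by rewrite scalerA mulrC -scalerA.
move=> /local_top_cech[z hz]; have [n [u e]] := cech_top_surj z.
have [k [s [sp hs]]] := H n u; apply: (hz s sp).
by rewrite e -(cech_top_shift x n k) -cech_topZ; exact: cech_top_coboundary_pow.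
Qed.
End TopCech.

(** * Weak proregularity *)

(** Induction on the generators: a submodule is controlled by its part in the span of [s] and by the
    ideal of the coefficients of [u]. *)
Lemma fg_acc (R : comPzRingType) (M : lmodType R) : acc R -> fin_gen M ->
  forall U : nat -> M -> Prop, (forall n, is_submodule (U n)) -> (forall n v, U n v -> U n.+1 v) ->
  exists T, forall n v, U n v -> U T v.
Proof.
move=> hacc [s hs] U hU inc.
suff [T hT] : exists T, forall n v, v \in span [set` s]%classic -> U n v -> U T v.
  by exists T => n v; apply: hT; exact: hs.
have mono n m v : (n <= m)%N -> U n v -> U m v.
  by move=> /subnKC <-; elim: (m - n)%N => [|k IHk]; rewrite ?addn0 // addnS => /IHk /inc.
elim: s {hs} => [|u s [T hT]].
  exists 0%N => n v vs _; have -> : v = 0.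
    by apply: (@span_min _ _ _ (fun v => v = 0) _ _ _ v vs) => // a w z -> ->; rewrite scaler0 addr0.
  exact: sbm0 (hU _).
have hsp : is_submodule (fun v : M => v \in span [set` s]%classic) by exact: sbm_mem.
pose I n r := exists2 w, w \in span [set` s]%classic & U n (r *: u + w).
have [||T' hT'] := hacc I.
- move=> n; split=> [|a r t [v vs vU] [w ws wU]].
    by exists 0; [exact: sbm0 hsp | rewrite scale0r addr0; exact: sbm0 (hU _)].
  exists (a *: v + w); first by case: hsp => _; apply.
  have -> : (a * r + t) *: u + (a *: v + w) = a *: (r *: u + v) + (t *: u + w) by lin.
  by case: (hU n) => _; apply.
- by move=> n r [w ws wU]; exists w => //; exact: inc.
exists (maxn T T') => n v vs vU.
have [a [w [ws e]]] : exists a w, w \in span [set` s]%classic /\ v = a *: u + w.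
  apply: (@span_min _ _ _ (fun v => exists a w, w \in span [set` s]%classic /\ v = a *: u + w) _ _ _ v vs).
  - by exists 0, 0; split; [exact: sbm0 hsp | rewrite scale0r addr0].
  - move=> b v1 v2 [a1 [w1 [U1 ->]]] [a2 [w2 [U2 ->]]].
    exists (b * a1 + a2), (b *: w1 + w2); split; first by case: hsp => _; apply.
    by lin.
  - move=> w /=; rewrite inE => /orP[/eqP->|ws].
      by exists 1, 0; split; [exact: sbm0 hsp | rewrite scale1r addr0].
    by exists 0, w; split; [exact: span_gen | rewrite scale0r add0r].
have [w' ws' wU'] : I T' a by apply: (hT' n); exists w => //; rewrite -e.
rewrite e; have -> : a *: u + w = (w - w') + (a *: u + w') by lin.
apply: (sbmD (hU _)); last by apply: mono wU'; exact: leq_maxr.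
apply: (mono T); first exact: leq_maxl.
apply: (hT (maxn n T')); first exact: (sbmB hsp).
have -> : w - w' = v - (a *: u + w') by rewrite e; lin.
by apply: (sbmB (hU _)); [apply: mono vU; exact: leq_maxl | apply: mono wU'; exact: leq_maxr].
Qed.

Lemma tens1_inj (R : comPzRingType) (B : lmodType R) (b : B) : tens (1 : R^o) b = 0 -> b = 0.
Proof.
have [|||f [f0 fE]] := @tensor_lift R R^o B B (fun r b => (r : R) *: b).
- by move=> r s c; exact: scalerDl.
- by move=> r c d; exact: scalerDr.
- by move=> r s c; rewrite scalerA mulrC.
by move=> /(congr1 f); rewrite f0 fE scale1r.
Qed.

Section KoszulProregular.
Variables (R : comPzRingType) (M : lmodType R).
Local Notation K n y := (koszul M (seq_pow n y)).
Local Notation t1 := (tens (1 : R^o)).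

Lemma tens1Z (B : lmodType R) (a : R) (b : B) : t1 (a *: b) = a *: t1 b.
Proof. exact: tensZr. Qed.

Lemma koszul_d0 n a y (u : K n y 1) (v : K n y 0) :
  chain_d (K n (a :: y)) 0 (t1 u, t1 v) = t1 (chain_d (K n y) 0 u + a ^+ n *: v).
Proof. by rewrite /= !tens_mapE tensDr tens1Z -tensZl. Qed.

Lemma koszul_dS n a y i (u : K n y i.+2) (v : K n y i.+1) :
  chain_d (K n (a :: y)) i.+1 (t1 u, t1 v) =
  (t1 (chain_d (K n y) i.+1 u + a ^+ n *: v), - t1 (chain_d (K n y) i v)).
Proof. by rewrite /= !tens_mapE tensDr tens1Z -tensZl. Qed.

Lemma koszul_map0 m n (nm : (n <= m)%N) a y (u : K m y 0) :
  koszul_map M nm (a :: y) 0 (t1 u) = t1 (koszul_map M nm y 0 u).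
Proof. exact: tens_mapE. Qed.

Lemma koszul_mapS m n (nm : (n <= m)%N) a y i (u : K m y i.+1) (v : K m y i) :
  koszul_map M nm (a :: y) i.+1 (t1 u, t1 v) =
  (t1 (koszul_map M nm y i.+1 u), t1 (a ^+ (m - n) *: koszul_map M nm y i v)).
Proof. by rewrite /= !tens_mapE tens1Z -tensZl. Qed.

Lemma koszul_pair n a y i (z : K n (a :: y) i.+1) :
  exists (u : K n y i.+1) (v : K n y i), z = (t1 u, t1 v).
Proof.
case: z => z1 z2; have [u ->] := tensor_regular z1; have [v ->] := tensor_regular z2.
by exists u, v.
Qed.

Lemma koszul_map_comp m n k (nm : (n <= m)%N) (kn : (k <= n)%N) (km : (k <= m)%N) y i (z : K m y i) :
  koszul_map M kn y i (koszul_map M nm y i z) = koszul_map M km y i z.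
Proof.
elim: y i z => [//|a y IHy] [|i] z.
  by have [u ->] := tensor_regular z; rewrite !koszul_map0 IHy.
have [u [v ->]] := koszul_pair z.
rewrite !koszul_mapS !IHy linearZ IHy scalerA -exprD; congr (_, t1 (a ^+ _ *: _)).
by rewrite addnC addnBA // subnK.
Qed.

Fixpoint koszul_const n y (w : M) : K n y 0 :=
  match y with
  | [::] => w
  | a :: y => t1 (koszul_const n y w)
  end.

Lemma koszul_const_lin n y a v w :
  koszul_const n y (a *: v + w) = a *: koszul_const n y v + koszul_const n y w.
Proof. by elim: y => [//|b y IHy] /=; rewrite IHy tensDr tens1Z. Qed.

Lemma koszul_const0 n y : koszul_const n y 0 = 0.
Proof. by elim: y => [//|b y IHy] /=; rewrite IHy tens0r. Qed.

Lemma koszul_const_surj n y (z : K n y 0) : exists w, z = koszul_const n y w.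
Proof.
elim: y z => [|a y IHy] z /=; first by exists z.
by have [u ->] := tensor_regular z; have [w ->] := IHy u; exists w.
Qed.

Lemma koszul_map_const m n (nm : (n <= m)%N) y w :
  koszul_map M nm y 0 (koszul_const m y w) = koszul_const n y w.
Proof. by elim: y => [//|a y IHy]; rewrite koszul_map0 IHy. Qed.

Definition pro_zero y := forall n, exists m (nm : (n <= m)%N),
  forall i (z : K m y i.+1), chain_d (K m y) i z = 0 ->
    exists w, koszul_map M nm y i.+1 z = chain_d (K n y) i.+1 w.

Hypothesis accM : forall U : nat -> M -> Prop, (forall n, is_submodule (U n)) ->
  (forall n v, U n v -> U n.+1 v) -> exists T, forall n v, U n v -> U T v.

(** The complex of [a :: y] is the cone of [a]. In a cycle [(u, v)], the component [v] of positive
    degree becomes a boundary by induction; in degree 0 it is killed by a power of [a] modulo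
    [(y^n1) M], and the chain condition on [M] bounds that power. Once a multiple of [v] is bounded
    by [q], a correction of [u] by [q] is a cycle, which bounds after one more transition. *)
Lemma pro_zero_all y : pro_zero y.
Proof.
elim: y => [|a y IHy] n.
  by exists n, (leqnn n) => i z _; exists 0; rewrite linear0; apply/rowP => -[].
have [n1 [nn1 h1]] := IHy n; have [m0 [n1m0 h0]] := IHy n1.
pose W t w := exists q, a ^+ t *: koszul_const n1 y w = chain_d (K n1 y) 0 q.
have [|t w [q e]|T hT] := accM (U := W).
- move=> t; split=> [|b v w [q eq] [r er]].
    by exists 0; rewrite linear0 koszul_const0 scaler0.
  exists (b *: q + r); rewrite linearP -eq -er koszul_const_lin; lin.
- by exists (a *: q); rewrite exprS -scalerA e linearZ.
(* [m0] handles [v] in positive degree; [n1 + T] ensures that [a ^+ (m - n1)] contains the factor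
   [a ^+ T] needed in degree 0. *)
pose m := maxn m0 (n1 + T).
have m0m : (m0 <= m)%N by exact: leq_maxl.
have n1Tm : (n1 + T <= m)%N by exact: leq_maxr.
have n1m : (n1 <= m)%N by exact: leq_trans (leq_addr _ _) n1Tm.
have nm : (n <= m)%N by exact: leq_trans n1m.
have key i (u : K m y i.+1) (v : K m y i) :
    chain_d (K m y) i u + a ^+ m *: v = 0 ->
    (exists2 q, chain_d (K n1 y) i q = a ^+ (m - n1) *: koszul_map M n1m y i v & True) ->
    exists (p : K n y i.+2) (q : K n y i.+1),
      koszul_map M nm y i.+1 u = chain_d (K n y) i.+1 p + a ^+ n *: q /\
      a ^+ (m - n) *: koszul_map M nm y i v = - chain_d (K n y) i q.
  move=> uv [q eq _].
  have [|p ep] := h1 i (koszul_map M n1m y i.+1 u + a ^+ n1 *: q).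
    rewrite linearD linearZ /= -chain_mapP eq scalerA -exprD subnKC //.
    by rewrite -linearZ -linearD uv linear0.
  exists p, (- (a ^+ (n1 - n) *: koszul_map M nn1 y i.+1 q)); split.
    rewrite -ep linearD linearZ /= (koszul_map_comp n1m nn1 nm) scalerN scalerA -exprD subnKC //.
    by rewrite addrK.
  rewrite linearN opprK linearZ /= -chain_mapP eq linearZ /= (koszul_map_comp n1m nn1 nm).
  by rewrite scalerA -exprD addnC addnBA // subnK.
exists m, nm => i z; have [u [v ->]] := koszul_pair z.
rewrite koszul_mapS; case: i u v {z} => [|i] u v.
  rewrite koszul_d0 => /tens1_inj uv; have [|p [q [e1 e2]]] := key 0%N u v uv.
    have [w ew] := koszul_const_surj v.
    have [|r er] := hT m w.
      exists (- koszul_map M n1m y 1 u); rewrite linearN /= -chain_mapP.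
      apply/eqP; rewrite -subr_eq0 opprK -(koszul_map_const n1m) -ew -linearZ -linearD.
      by rewrite addrC uv linear0.
    exists (a ^+ (m - n1 - T) *: r) => //; rewrite linearZ /= -er scalerA -exprD subnK.
      by rewrite ew koszul_map_const.
    by rewrite leq_subRL.
  exists (t1 p, t1 q); rewrite koszul_dS e1 e2.
  by rewrite tensNr.
rewrite koszul_dS => -[/tens1_inj uv /eqP]; rewrite oppr_eq0 => /eqP/tens1_inj dv.
have [|p [q [e1 e2]]] := key i.+1 u v uv.
  have [|q eq] := h0 i (koszul_map M m0m y i.+1 v); first by rewrite -chain_mapP dv linear0.
  exists (a ^+ (m - n1) *: q) => //; rewrite linearZ /= -eq.
  by rewrite (koszul_map_comp m0m n1m0 n1m).
exists (t1 p, t1 q); rewrite koszul_dS e1 e2.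
by rewrite tensNr.
Qed.

Lemma weakly_proregular_acc x : weakly_proregular M x.
Proof.
move=> n; have [m [nm H]] := pro_zero_all x n; exists m, nm => -[//|i] h _.
elim/quot_classW: h => -[z zZ]; rewrite homology_mapE /=.
rewrite -[RHS](linear0 (quot_class _)); apply/quot_classE; rewrite subr0 unfold_in /=.
have [|w ->] := H i z; first exact/eqP.
by apply/asboolP; exists w.
Qed.
End KoszulProregular.

(** * Heights *)

Section Support.
Variables (R : comPzRingType) (N : lmodType R).

Lemma supp_ann (p : prime_ideal R) r : supp N p -> annihilator N r -> (r : R^o) \in p.
Proof.
move=> [h h0] rN; apply: contrapT => rp; apply: h0.
elim/fracW: h => u s; apply/frac0P; exists r; [exact/negP | exact: rN].
Qed.

Lemma ann_supp (p : prime_ideal R) : fin_gen N ->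
  (forall r, annihilator N r -> (r : R^o) \in p) -> supp N p.
Proof.
move=> Nf annp; apply: contrapT => H.
have [_ p1 pp] := of_primeP p.
have [||||t tp tN] := @fg_common R N Nf (fun r => ~ (r : R^o) \in p) (fun v => v = 0).
- by split=> // a v w -> ->; rewrite scaler0 addr0.
- exact: p1.
- by move=> a b na nb /pp[].
- move=> v; apply: contrapT => Hv; apply: H; exists (frac v (denom1 _)).
  by move=> /frac0P[r rp rv]; apply: Hv; exists r => //; exact/negP.
- exact: tp (annp t tN).
Qed.

Definition chain_in n := exists c : nat -> prime_ideal R,
  (forall i, (i <= n)%N -> supp N (c i)) /\
  (forall i, (i < n)%N -> ([set` c i] `<` [set` c i.+1])%classic).

Lemma chain_in_primes n : chain_in n -> exists c : nat -> R -> Prop,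
  [/\ forall i, (i <= n)%N -> is_prime (c i), forall r, annihilator N r -> c 0%N r &
      forall i, (i < n)%N -> (forall r, c i r -> c i.+1 r) /\
        exists2 r, c i.+1 r & ~ c i r].
Proof.
move=> [c [cs inc]]; exists (fun i r => (r : R^o) \in c i); split.
- by move=> i _; exact: of_primeP.
- by move=> r; apply: supp_ann; apply: cs.
- move=> i /inc[sub nsub]; split; first exact: sub.
  by move: nsub => /existsNP[r /not_implyP[r1 r0]]; exists r.
Qed.

Lemma primes_chain_in n (c : nat -> R -> Prop) : fin_gen N ->
  (forall i, (i <= n)%N -> is_prime (c i)) -> (forall r, annihilator N r -> c 0%N r) ->
  (forall i, (i < n)%N -> (forall r, c i r -> c i.+1 r) /\ exists2 r, c i.+1 r & ~ c i r) ->
  chain_in n.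
Proof.
(* [c] is known to be prime only up to [n]; truncating the index extends the chain to all natural
   numbers. *)
move=> Nf pc c0 inc; pose d i := to_prime (pc (minn i n) (geq_minr i n)).
have dE i (r : R^o) : (i <= n)%N -> r \in d i <-> c i r.
  by move=> ni; rewrite -{2}(minn_idPl ni); exact: mem_to_prime.
exists d; split=> [i ni|i ni].
  apply: ann_supp => // r rN; apply/dE => //.
  elim: i ni => [|i IHi] ni; first exact: c0.
  by apply: (inc i ni).1; apply: IHi; exact: ltnW.
have [sub [r r1 r0]] := inc i ni; split=> [s /= /(dE _ _ (ltnW ni))/sub h|h]; first exact/dE.
by apply: r0; apply/(dE _ _ (ltnW ni)); apply: h; apply/dE.
Qed.

Lemma chain_inW n k : (n <= k)%N -> chain_in k -> chain_in n.
Proof.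
move=> nk [c [cs inc]]; exists c; split=> i ni; [apply: cs | apply: inc]; exact: leq_trans nk.
Qed.
End Support.

Section Extrema.
Local Open Scope classical_set_scope.

Lemma supremumE (d : Order.disp_t) (T : orderType d) (x0 s : T) (A : set T) :
  A !=set0 -> supremums A s -> supremum x0 A = s.
Proof.
move=> A0 As; rewrite /supremum ifN; last exact/set0P.
by case: xgetP => [y _ Ay|/(_ s)//]; exact: is_subset1_supremums Ay As.
Qed.

Lemma infimumE (d : Order.disp_t) (T : orderType d) (x0 s : T) (A : set T) :
  A !=set0 -> infimums A s -> infimum x0 A = s.
Proof.
move=> A0 As; rewrite /infimum ifN; last exact/set0P.
by case: xgetP => [y _ Ay|/(_ s)//]; exact: is_subset1_infimums Ay As.
Qed.

Variant supremum_nat_spec (S : set nat) : \bar int -> Prop :=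
  | SupNatEmpty : (forall n, ~ S n) -> supremum_nat_spec S -oo%E
  | SupNatMax n : S n -> (forall k, S k -> (k <= n)%N) -> supremum_nat_spec S (n%:Z)%:E
  | SupNatInf : (forall k, exists2 n, S n & (k <= n)%N) -> supremum_nat_spec S +oo%E.

Lemma supremum_natP (S : set nat) :
  supremum_nat_spec S (supremum -oo%E [set (n%:Z)%:E | n in S]).
Proof.
have [[n0 Sn0]|S0] := pselect (exists n, S n); last first.
  have -> : [set (n%:Z)%:E | n in S] = set0.
    by rewrite -subset0 => _ [n Sn <-]; case: S0; exists n.
  by rewrite supremum0; constructor => n Sn; apply: S0; exists n.
have A0 : [set (n%:Z)%:E | n in S] !=set0 by exists (n0%:Z)%:E, n0.
have [H|/existsNP[k Hk]] := pselect (forall k, exists2 n, S n & (k <= n)%N).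
  rewrite (@supremumE _ _ _ +oo%E) //; first by constructor.
  split=> [y _|y yA]; first exact: leey.
  move: y yA => [r||] yA //; last first.
    by have := yA _ (ex_intro2 _ _ n0 Sn0 erefl).
  exfalso; have [n Sn rn] := H `|r|%N.+1.
  have := yA _ (ex_intro2 _ _ n Sn erefl); rewrite lee_fin => h.
  have : ((`|r|%N.+1)%:Z <= `|r|%N%:Z)%R.
    apply: (le_trans (y := n%:Z)); first by rewrite lez_nat.
    by apply: (le_trans h); rewrite abszE ler_norm.
  by rewrite lez_nat ltnn.
have bnd n : S n -> (n <= k)%N.
  by move=> Sn; rewrite leqNgt; apply/negP => kn; apply: Hk; exists n => //; exact: ltnW.
have ex : exists n, `[< S n >] by exists n0; exact: asboolT.
have bnd' n : `[< S n >] -> (n <= k)%N by move/asboolW/bnd.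
case: (ex_maxnP ex bnd') => n /asboolW Sn nmax.
have nmax' j : S j -> (j <= n)%N by move=> Sj; apply: nmax; exact: asboolT.
rewrite (@supremumE _ _ _ (n%:Z)%:E) //; first by constructor.
split=> [_ [j Sj <-]|y yA]; first by rewrite lee_fin lez_nat; exact: nmax'.
by apply: yA; exists n.
Qed.

Lemma le_infimum (A : set (\bar int)) (b : \bar int) :
  (forall h, A h -> (b <= h)%E) -> (b <= infimum +oo%E A)%E.
Proof.
move=> H; rewrite /infimum; case: ifP => _; first exact: leey.
by case: xgetP => [y _ [_ h]|_]; [apply: h | exact: leey].
Qed.

(** A finite value rules out the default [+oo], so the set has a member; for heights, this is a
    prime of the support containing [x], whence [x M] is not [M]. *)
Lemma infimum_fin (A : set (\bar int)) (n : nat) : infimum +oo%E A = (n%:Z)%:E ->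
  A !=set0 /\ forall h, A h -> ((n%:Z)%:E <= h)%E.
Proof.
rewrite /infimum; case: ifPn => [//|/set0P A0].
by case: xgetP => [y -> [yA _] <-|//]; split.
Qed.
End Extrema.

Section KrullDim.
Variables (R : comPzRingType) (N : lmodType R).

Lemma krull_dim_ge n : ((n%:Z)%:E <= krull_dim N)%E -> chain_in N n.
Proof.
rewrite /krull_dim; case: supremum_natP => [//|k ck _|H _].
  by rewrite lee_fin lez_nat => nk; exact: chain_inW ck.
by have [k ck nk] := H n; exact: chain_inW ck.
Qed.

Lemma krull_dim_le n : (forall k, chain_in N k -> (k <= n)%N) -> (krull_dim N <= (n%:Z)%:E)%E.
Proof.
move=> H; rewrite /krull_dim; case: supremum_natP => [_|k ck _|Hn].
- exact: leNye.
- by rewrite lee_fin lez_nat; exact: H.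
- by have [k /H kn] := Hn n.+1; rewrite ltnNge kn.
Qed.
End KrullDim.

(** * Localized modules and their top cohomology *)

Section LocalizedModule.
Variables (R : comPzRingType) (p : prime_ideal R) (M : lmodType R).
Local Notation tl := (to_loc (prime_compl p)).
Local Notation N := (lmod p M).

Lemma to_loc_scale (a : R) (u : M) s : tl a *: (frac u s : N) = (frac (a *: u) s : N).
Proof.
rewrite -[_ *: _]/(loc_scale (rfrac a (denom1 _)) (frac u s)) loc_scaleE.
by apply: frac_eq; rewrite /= !scalerA; congr (_ *: _); ring.
Qed.

Lemma frac_den (u : M) s : (frac u s : N) = rfrac 1 s *: (frac u (denom1 _) : N).
Proof.
rewrite -[RHS]/(loc_scale (rfrac 1 s) (frac u (denom1 _))) loc_scaleE.
by apply: frac_eq; rewrite /= !scalerA; congr (_ *: _); ring.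
Qed.

Lemma frac_lin (a : R) (u v : M) : (frac (a *: u + v) (denom1 _) : N) =
  tl a *: (frac u (denom1 _) : N) + frac v (denom1 _).
Proof.
rewrite to_loc_scale fracD; apply: frac_eq.
by rewrite /= !scale1r mulr1 scale1r.
Qed.

Lemma loc_fin_gen : fin_gen M -> fin_gen N.
Proof.
move=> [s hs]; exists [seq (frac u (denom1 _) : N) | u <- s]; elim/fracW=> u t.
rewrite frac_den; apply: rpredZ.
pose A (u : M) := (frac u (denom1 _) : N) \in span [set` [seq (frac u (denom1 _) : N) | u <- s]]%classic.
apply: (@span_min _ _ _ A _ _ _ u (hs u)) => [|a v w hv hw|v vs].
- rewrite /A; have -> : (frac 0 (denom1 _) : N) = 0 by [].
  exact: rpred0.
- by rewrite /A frac_lin; apply: rpredD => //; apply: rpredZ.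
- by apply: span_gen; apply/mapP; exists v.
Qed.

Lemma to_locX (a : R) n : tl (a ^+ n) = tl a ^+ n.
Proof. by elim: n => [//|n IHn]; rewrite !exprS to_locM IHn. Qed.

Lemma seq_pow_to_loc n (x : seq R) : seq_pow n [seq tl a | a <- x] = [seq tl a | a <- seq_pow n x].
Proof. by rewrite /seq_pow -!map_comp; apply: eq_map => a /=; rewrite to_locX. Qed.

Lemma prod_to_loc (x : seq R) : \prod_(z <- [seq tl a | a <- x]) z = tl (\prod_(a <- x) a).
Proof.
elim: x => [|a x IHx]; first by rewrite !big_nil.
by rewrite /= !big_cons to_locM IHx.
Qed.

Lemma frac_seq_mul (y : seq R) (u : M) s : (frac u s : N) \in seq_mul [seq tl a | a <- y] N ->
  exists2 t : R, ~ (t : R^o) \in p & t *: u \in seq_mul y M.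
Proof.
pose A (z : N) := exists (v : M) t, v \in seq_mul y M /\ z = frac v t.
move=> /(@seq_mul_min _ _ _ A)[||v [t [vy /fracP[r rp e]]]].
- split=> [|a z w [v [t [vy ->]]] [v' [t' [vy' ->]]]].
    by exists 0, (denom1 _); split=> //; exact: sbm0 (seq_mul_sbm _ _).
  elim/rfracW: a => b r.
  rewrite -[rfrac b r *: _]/(loc_scale (rfrac b r) (frac v t)) loc_scaleE fracD.
  eexists _, _; split; last by [].
  by apply: (sbmD (seq_mul_sbm _ _)); do ?apply: (sbmZ (seq_mul_sbm _ _)).
- move=> _ z /mapP[a ay ->]; elim/fracW: z => v t; exists (a *: v), t.
  by rewrite to_loc_scale; split=> //; exact: seq_mul_gen.
exists (r * sval t).
  by have := den_notin (s := denom_mul (exist _ r rp) t); apply.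
by rewrite -scalerA e; do 2! apply: (sbmZ (seq_mul_sbm _ _)).
Qed.

Lemma seq_mul_frac (y : seq R) (u : M) s : u \in seq_mul y M ->
  (frac u s : N) \in seq_mul [seq tl a | a <- y] N.
Proof.
move=> uy; rewrite frac_den; apply: rpredZ.
pose A (u : M) := (frac u (denom1 _) : N) \in seq_mul [seq tl a | a <- y] N.
apply: (@seq_mul_min _ _ _ A _ _ _ uy).
  split=> [|a v w hv hw].
    rewrite /A; have -> : (frac 0 (denom1 _) : N) = 0 by [].
    exact: rpred0.
  by rewrite /A frac_lin; apply: rpredD => //; apply: rpredZ.
by move=> a v ay; rewrite /A -to_loc_scale; apply: seq_mul_gen; exact: map_f.
Qed.

Lemma local_top_vanish (x : seq R) : top_vanish [seq tl a | a <- x] N <->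
  forall n (u : M), exists k (s : R), ~ (s : R^o) \in p /\
    s *: ((\prod_(a <- x) a) ^+ k *: u) \in seq_mul (seq_pow (n + k) x) M.
Proof.
split=> [H n u|H n].
  have [k] := H n (frac u (denom1 _)).
  rewrite prod_to_loc -to_locX to_loc_scale seq_pow_to_loc => /frac_seq_mul[s sp hs].
  by exists k, s.
elim/fracW=> u t; have [k [s [sp hs]]] := H n u; exists k.
rewrite prod_to_loc -to_locX to_loc_scale seq_pow_to_loc.
have -> : (frac ((\prod_(a <- x) a) ^+ k *: u) t : N) =
    frac (s *: ((\prod_(a <- x) a) ^+ k *: u)) (denom_mul (to_den sp) t).
  by apply: frac_eq; rewrite /= !scalerA; congr (_ *: _); ring.
exact: seq_mul_frac.
Qed.

Lemma ann_to_loc (r : R) : annihilator M r -> annihilator N (tl r).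
Proof.
move=> rM; elim/fracW=> u s; rewrite to_loc_scale rM; apply/frac0P.
by exists 1; rewrite ?rpred1 ?scaler0.
Qed.

(** If [M / x M] vanished at [p], then [M_p = x M_p] with [x] in the maximal ideal, and Nakayama's
    lemma would give [M_p = 0]. *)
Lemma supp_quotient (x : seq R) : fin_gen M -> supp M p -> (forall a, a \in x -> (a : R^o) \in p) ->
  supp (quotmod (seq_mul x M)) p.
Proof.
move=> Mf [z z0] xp; apply: contrapT => H; apply: z0.
apply: (nakayama (loc_fin_gen Mf) (loc_local p) (y := [seq tl a | a <- x])).
  by move=> _ /mapP[a ax ->]; apply/con_maxloc; exact: xp.
elim/fracW=> u s.
have [t tp tu] : exists2 t : R, ~ (t : R^o) \in p & t *: u \in seq_mul x M.
  apply: contrapT => H'; apply: H; exists (frac (quot_class _ u) (denom1 _)).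
  move=> /frac0P[r rp]; rewrite -linearZ -[0](linear0 (quot_class _)) => /quot_classE.
  by rewrite subr0 => h; apply: H'; exists r => //; exact/negP.
have -> : (frac u s : N) = frac (t *: u) (denom_mul (to_den tp) s).
  by apply: frac_eq; rewrite /= !scalerA; congr (_ *: _); ring.
exact: seq_mul_frac.
Qed.
End LocalizedModule.

(** * Heights of parameter sequences *)

Section Main.
Variables (R : comPzRingType) (M : lmodType R) (x : seq R) (M_fin : fin_gen M).

Lemma mem_seq_ideal (p : prime_ideal R) :
  (forall a : R^o, a \in seq_ideal x -> a \in p) <-> (forall a, a \in x -> (a : R^o) \in p).
Proof.
split=> [H a ax|H]; first by apply: H; exact: span_gen.
apply: (@span_min _ _ _ (fun a => a \in p)) => //; first exact: rpred0.
by move=> a u v up vp; rewrite rpredD ?rpredZ.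
Qed.

Lemma parameter_height_ge (p : prime_ideal R) : parameter_sequence M x -> supp M p ->
  (forall a, a \in x -> (a : R^o) \in p) -> ((size x)%:Z%:E <= prime_height M p)%E.
Proof.
move=> [_ _ top] sp xp; rewrite leNgt; apply/negP => hp.
apply: ((local_top_cechP M p x).2 _ (top p (supp_quotient M_fin sp xp))).
apply/local_top_vanish/short_chains_top_vanish => c pc c0 inc.
have : chain_in (lmod p M) (size x).
  rewrite size_map in pc inc.
  exact: (primes_chain_in (loc_fin_gen p M_fin) pc c0 inc).
move: hp; rewrite /prime_height /krull_dim; case: supremum_natP => [H _ /H //|n cn nmax|_ //].
by rewrite lte_fin ltz_nat => nx /nmax; rewrite leqNgt nx.
Qed.

Hypothesis hacc : acc R.

(** A minimal element of the support of [M / x M], which for finitely generated [M] consists of the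
    primes over [ann M + x R]. *)
Definition minimal_over (q : prime_ideal R) := [/\ supp M q, forall a, a \in x -> (a : R^o) \in q &
  forall P, is_prime P -> (forall r, annihilator M r -> P r) -> (forall a, a \in x -> P a) ->
    (forall r : R, P r -> (r : R^o) \in q) -> forall r : R, (r : R^o) \in q -> P r].

Lemma exists_minimal_over (P : R -> Prop) : is_prime P -> (forall r, annihilator M r -> P r) ->
  (forall a, a \in x -> P a) ->
  exists2 q, minimal_over q & forall r : R, (r : R^o) \in q -> P r.
Proof.
move=> pP MP xP; pose I (r : R) := exists a e : R, [/\ (a : R^o) \in seq_mul x R^o, annihilator M e & r = a + e].
have hI : is_ideal I.
  split=> [|b u v [a [e [ax eM ->]]] [a' [e' [ax' eM' ->]]]].
    exists 0, 0; split; [exact: sbm0 (seq_mul_sbm _ _) | exact: idl0 (idl_ann M) | by rewrite addr0].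
  exists (b * a + a'), (b * e + e'); split; last by ring.
    by case: (seq_mul_sbm x R^o) => _; apply.
  by case: (idl_ann M) => _; apply.
have IP J : is_prime J -> (forall r, annihilator M r -> J r) -> (forall a, a \in x -> J a) ->
    forall r, I r -> J r.
  move=> pJ MJ xJ _ [a [e [ax /MJ Je ->]]]; apply: (idlD (prime_idl pJ)) => //.
  apply: (@seq_mul_min R x R^o J _ _ a ax); first exact: (prime_idl pJ).
  by move=> b v /xJ Jb; exact: (@idlMr R J (prime_idl pJ) v b Jb).
have [Q [pQ IQ QP minQ]] := minimal_prime hacc hI pP (IP P pP MP xP).
have MQ r : annihilator M r -> Q r.
  by move=> rM; apply: IQ; exists 0, r; split; [exact: sbm0 (seq_mul_sbm _ _) | | rewrite add0r].
have xQ a : a \in x -> Q a.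
  move=> ax; apply: IQ; exists a, 0; split; [|exact: idl0 (idl_ann M) | by rewrite addr0].
  by have := @seq_mul_gen R x R^o a 1 ax; have -> : a *: (1 : R^o) = a by exact: mulr1.
exists (to_prime pQ); last by move=> r /mem_to_prime; exact: QP.
split.
- by apply: ann_supp => // r /MQ Qr; apply/mem_to_prime.
- by move=> a /xQ Qa; apply/mem_to_prime.
- move=> J pJ MJ xJ JQ r /mem_to_prime; apply: minQ => //; first exact: IP.
  by move=> s /JQ /mem_to_prime.
Qed.

Section MinimalOver.
Variables (q : prime_ideal R) (hq : minimal_over q).
Local Notation tl := (to_loc (prime_compl q)).
Local Notation N := (lmod q M).

Lemma minimal_over_in : {in [seq tl a | a <- x], forall z, maxloc (p := q) z}.
Proof. by move=> _ /mapP[a ax ->]; case: hq => _ xq _; apply/con_maxloc; exact: xq. Qed.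

(** Minimality of [q], carried to the local ring at [q] by contraction: the hypothesis [onlym] of
    the cohomological part, with the annihilator of [M_q] as [Q]. *)
Lemma minimal_over_only J : is_prime J -> (forall r, annihilator N r -> J r) ->
  {in [seq tl a | a <- x], forall z, J z} -> forall z, maxloc (p := q) z -> J z.
Proof.
move=> pJ NJ xJ; case: hq => _ _ minq; apply: loc_mono.
- exact: prime_idl (loc_local q).1.
- exact: prime_idl.
move=> a /con_maxloc; apply: minq.
- exact: con_prime.
- by move=> r rM; apply: NJ; exact: ann_to_loc.
- by move=> b bx; apply: xJ; exact: map_f.
- by move=> r; exact: con_sub.
Qed.

Lemma minimal_over_height : (prime_height M q <= (size x)%:Z%:E)%E.
Proof.
apply: krull_dim_le => n /chain_in_primes[c [pc c0 inc]].
have := chain_length (loc_acc (p := q) hacc) (loc_local q) (idl_ann N) minimal_over_in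
  minimal_over_only pc c0 inc.
by rewrite size_map.
Qed.

Lemma minimal_over_top : ((size x)%:Z%:E <= prime_height M q)%E ->
  ~ top_vanish [seq tl a | a <- x] N.
Proof.
move=> /krull_dim_ge/chain_in_primes[c [pc c0 inc]].
have sx : size [seq tl a | a <- x] = size x by rewrite size_map.
apply: (top_nonvanish_module (loc_fin_gen q M_fin) (pc 0%N isT) c0) => a ca.
apply: (top_nonvanish (loc_acc (p := q) hacc) (loc_local q) (idl_ann N) minimal_over_in
  minimal_over_only _ c0 _ ca); rewrite sx //.
Qed.
End MinimalOver.
End Main.

Theorem proposition3p8 (R : comPzRingType) (M : lmodType R) (x : seq R)
    (M_fin : fin_gen M) :
  (parameter_sequence M x -> ((size x)%:Z%:E <= height M (seq_ideal x))%E) /\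
  (noetherian R ->
     (parameter_sequence M x <-> height M (seq_ideal x) = (size x)%:Z%:E)).
Proof.
have low : parameter_sequence M x -> forall h, (exists p : prime_ideal R,
    [/\ supp M p, forall a : R^o, a \in seq_ideal x -> a \in p & h = prime_height M p]) ->
    ((size x)%:Z%:E <= h)%E.
  by move=> par h [p [sp /mem_seq_ideal xp ->]]; exact: parameter_height_ge.
split=> [/low low'|noe]; first exact: le_infimum.
have hacc := noetherian_acc noe.
split=> [par|ht].
  have [_ xM _] := par; have [v0 nv0] : exists v, ~ v \in seq_mul x M by apply/existsNP.
  (* The annihilator of a nonzero class in [M / x M] is proper and contains both [ann M] and [x]; a
     prime over it leads to a minimal [q], where the height is exactly [size x]. *)
  have hI : is_ideal (fun r : R => r *: v0 \in seq_mul x M).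
    split=> [|a r s hr hs]; first by rewrite scale0r; exact: rpred0.
    rewrite scalerDl -scalerA; apply: rpredD => //; exact: rpredZ.
  have [|P pP IP] := prime_over hI; first by rewrite scale1r.
  have [||q hq _] := exists_minimal_over (x := x) M_fin hacc pP.
  - by move=> r rM; apply: IP; rewrite rM; exact: rpred0.
  - by move=> a ax; apply: IP; exact: seq_mul_gen.
  have [sq xq _] := hq.
  have hA : exists p : prime_ideal R, [/\ supp M p,
      forall a : R^o, a \in seq_ideal x -> a \in p & (size x)%:Z%:E = prime_height M p].
    exists q; split=> //; first exact/mem_seq_ideal.
    apply: le_anti; rewrite (minimal_over_height hacc hq) andbT.
    by apply: (low par); exists q; split=> //; exact/mem_seq_ideal.
  apply: infimumE; first by exists (size x)%:Z%:E.
  by split=> [h /(low par)|h]; last exact.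
have [[h0 [p0 [sp /mem_seq_ideal xp _]]] bnd] := infimum_fin ht.
split.
- exact: (@weakly_proregular_acc R M (@fg_acc R M hacc M_fin) x).
- move=> xM; have [u] := supp_quotient M_fin sp xp; apply.
  elim/fracW: u => w s; elim/quot_classW: w => v; apply/frac0P; exists 1; first exact: rpred1.
  by rewrite scale1r -[RHS](linear0 (quot_class _)); apply/quot_classE; rewrite subr0.
move=> {sp xp} p sp; apply: contrapT => /local_top_cechP top.
have annp (r : R) : (forall v : M, r *: v \in seq_mul x M) -> (r : R^o) \in p.
  move=> rM; apply: (supp_ann sp); elim/quot_classW=> v.
  by rewrite -linearZ -[RHS](linear0 (quot_class _)); apply/quot_classE; rewrite subr0.
have [||q hq qp] := exists_minimal_over (x := x) M_fin hacc (of_primeP p).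
- by move=> r rM; apply: annp => v; rewrite rM; exact: rpred0.
- by move=> a ax; apply: annp => v; exact: seq_mul_gen.
have [sq xq _] := hq.
(* Vanishing at [p] passes to [q], since multipliers outside [p] are outside [q]; but the height of
   [q] is at least [size x], so the top cohomology at [q] is not zero. *)
apply: (minimal_over_top M_fin hacc hq).
  by apply: bnd; exists q; split=> //; exact/mem_seq_ideal.
apply/local_top_vanish => n u; have [k [s [sp' hs]]] := top n u.
by exists k, s; split=> // /qp.
Qed.
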